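(* Assume (H1), (H2), (H3). There exists $L_\infty\in\mathbb R$ such that for all $L>L_\infty$: the number of positive eigenvalues of $\mathcal L_L$ coincides with the number of positive eigenvalues of $\mathcal L$ on $\mathbb R$ (with domain $H^4(\mathbb R)$); moreover (a) $L$ is not a conjugate point and $\mathcal L_L$ is invertible; and (b) the number of conjugate points in $(-\infty,L)$ is finite and independent of $L$, so that $\mathrm{Mor}(\mathcal L)$ equals the number of conjugate points in $(-\infty,\infty)$ counted with multiplicity, where $\mathrm{Mor}$ denotes the number of positive eigenvalues.
   Context: Fix real $\nu,\mu$, $f(u)=\nu u^2-u^3-\mu u$. (H1): $\varphi$ is a smooth stationary solution of $u_t=-(1+\partial_x^2)^2u+f(u)$ with $\varphi\to0$ at $\pm\infty$. (H2): $f'(0)<0$. $\mathcal L=-\partial_x^4-2\partial_x^2-1+f'(\varphi(x))$; for $s\in\mathbb R$, $\mathcal L_s$ is the same differential expression on $(-\infty,s]$ with domain $\{u\in H^4((-\infty,s]):u(s)=u'(s)=0\}$. With $q=(u,u_{xx},u_{xxx}+2u_x,u_x)$, $\mathcal Lu=\lambda u$ becomes $q'=B(x,\lambda)q$, $B(x,\lambda)=\begin{pmatrix}0&0&0&1\\0&0&1&-2\\-\lambda-1+f'(\varphi(x))&0&0&0\\0&1&0&0\end{pmatrix}$. $\mathbb E^u_-(x,\lambda)$ is the set of values $q(x)$ of solutions with $q(y)\to0$ as $y\to-\infty$. $\ell_*^{sand}=\{q:q_1=q_4=0\}$. A conjugate point is $x$ with $\mathbb E^u_-(x,0)\cap\ell_*^{sand}\ne\{0\}$,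 with multiplicity the dimension of the intersection. (H3): $\dim(\mathbb E^u_-(x,0)\cap\ell_*^{sand})\le1$ for all $x$. *)

(* Defs.v *)
From HB Require Import structures.
From mathcomp Require Import all_boot all_order all_algebra.
From mathcomp Require Import all_classical all_reals all_analysis.
Set Implicit Arguments. Unset Strict Implicit. Unset Printing Implicit Defensive.
Import Order.TTheory GRing.Theory Num.Theory.
Import numFieldNormedType.Exports.
Local Open Scope classical_set_scope.
Local Open Scope ring_scope.

Section Defs.
Variable R : realType.
Local Notation mu := (@lebesgue_measure R).

Definition fnl (nu m u : R) : R := nu * u ^+ 2 - u ^+ 3 - m * u.
Definition fnl' (nu m u : R) : R := 2 * nu * u - 3 * u ^+ 2 - m.

Definition smooth (g : R -> R) : Prop :=
  forall (n : nat) (x : R), derivable (derive1n n g) x 1.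

(* (H1): phi smooth stationary solution of u_t = -(1+d_x^2)^2 u + f(u),
   decaying at +-oo *)
Definition H1 (nu m : R) (phi : R -> R) : Prop :=
  smooth phi /\
  (forall x, - derive1n 4 phi x - 2 * derive1n 2 phi x - phi x + fnl nu m (phi x) = 0) /\
  (phi x @[x --> +oo] --> 0) /\ (phi x @[x --> -oo] --> 0).

Definition H2 (nu m : R) : Prop := fnl' nu m 0 < 0.

(* H^4(I) for an interval I, written in the one-dimensional form:
   us k (k = 0..4) are the (continuous representatives of the) derivatives
   u, u', u'', u''', u''''; each us k (k<4) is the integral of us (k+1)
   on every compact subinterval, and all are square integrable on I. *)
Definition H4on (I : set R) (us : nat -> R -> R) : Prop :=
  (forall k, (k <= 4)%N ->
     measurable_fun I (us k) /\ mu.-integrable I (fun x => ((us k x) ^+ 2)%:E)) /\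
  (forall k, (k < 4)%N -> forall x y, I x -> I y -> x <= y ->
     mu.-integrable [set t | (x <= t <= y)%R] (fun t => (us k.+1 t)%:E) /\
     ((us k y - us k x)%:E =
        \int[mu]_(t in [set t | (x <= t <= y)%R]) (us k.+1 t)%:E)%E).

Definition halfline (s : R) : set R := [set x | x <= s].

Definition dom_half (s : R) (us : nat -> R -> R) : Prop :=
  H4on (halfline s) us /\ us 0%N s = 0 /\ us 1%N s = 0.
Definition dom_full (us : nat -> R -> R) : Prop := H4on setT us.

Definition Lexpr (nu m : R) (phi : R -> R) (us : nat -> R -> R) (x : R) : R :=
  - us 4%N x - 2 * us 2%N x - us 0%N x + fnl' nu m (phi x) * us 0%N x.

Definition eigenfun (D : (nat -> R -> R) -> Prop) (I : set R)
  (nu m : R) (phi : R -> R) (lam : R) (us : nat -> R -> R) : Prop :=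
  D us /\ (exists x, I x /\ us 0%N x <> 0) /\
  {ae mu, forall x, I x -> Lexpr nu m phi us x = lam * us 0%N x}.

Definition lin_indep_on (I : set R) (n : nat) (u : 'I_n -> R -> R) : Prop :=
  forall c : 'I_n -> R, (forall x, I x -> \sum_(i < n) c i * u i x = 0) ->
  forall i, c i = 0.

Definition has_pos_eigs (D : (nat -> R -> R) -> Prop) (I : set R)
  (nu m : R) (phi : R -> R) (n : nat) : Prop :=
  exists (lam : 'I_n -> R) (us : 'I_n -> nat -> R -> R),
    (forall i, 0 < lam i /\ eigenfun D I nu m phi (lam i) (us i)) /\
    lin_indep_on I (fun i => us i 0%N).

Definition MorIs (D : (nat -> R -> R) -> Prop) (I : set R)
  (nu m : R) (phi : R -> R) (N : nat) : Prop :=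
  has_pos_eigs D I nu m phi N /\ ~ has_pos_eigs D I nu m phi N.+1.

Definition invertible_half (nu m : R) (phi : R -> R) (s : R) : Prop :=
  let I := halfline s in
  (forall us, dom_half s us ->
     {ae mu, forall x, I x -> Lexpr nu m phi us x = 0} ->
     forall x, I x -> us 0%N x = 0) /\
  (forall g : R -> R, measurable_fun I g ->
     mu.-integrable I (fun x => (g x ^+ 2)%:E) ->
     exists us, dom_half s us /\
       {ae mu, forall x, I x -> Lexpr nu m phi us x = g x}) /\
  (exists C : R, forall (g : R -> R) us,
     measurable_fun I g -> mu.-integrable I (fun x => (g x ^+ 2)%:E) ->
     dom_half s us -> {ae mu, forall x, I x -> Lexpr nu m phi us x = g x} ->
     (\int[mu]_(x in I) ((us 0%N x) ^+ 2)%:E <=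
        C%:E * \int[mu]_(x in I) ((g x) ^+ 2)%:E)%E).

Definition Bent (nu m : R) (phi : R -> R) (lam y : R) (i j : nat) : R :=
  match i, j with
  | 0, 3 => 1
  | 1, 2 => 1
  | 1, 3 => -2
  | 2, 0 => - lam - 1 + fnl' nu m (phi y)
  | 3, 1 => 1
  | _, _ => 0
  end.

Definition first_order_sol (nu m : R) (phi : R -> R) (lam : R)
  (q : 'I_4 -> R -> R) : Prop :=
  forall (y : R) (i : 'I_4), derivable (q i) y 1 /\
    derive1 (q i) y = \sum_(j < 4) Bent nu m phi lam y i j * q j y.

Definition Eu (nu m : R) (phi : R -> R) (x lam : R) : set ('I_4 -> R) :=
  [set v | exists q : 'I_4 -> R -> R, first_order_sol nu m phi lam q /\
     (forall i, q i y @[y --> -oo] --> 0) /\ (forall i, v i = q i x)].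

Definition lsand : set ('I_4 -> R) :=
  [set v | v (inord 0) = 0 /\ v (inord 3) = 0].

Definition vec_indep (n : nat) (v : 'I_n -> 'I_4 -> R) : Prop :=
  forall c : 'I_n -> R, (forall j, \sum_(i < n) c i * v i j = 0) ->
  forall i, c i = 0.

Definition has_indep (S : set ('I_4 -> R)) (n : nat) : Prop :=
  exists v : 'I_n -> 'I_4 -> R, (forall i, S (v i)) /\ vec_indep v.

Definition dimIs (S : set ('I_4 -> R)) (n : nat) : Prop :=
  has_indep S n /\ ~ has_indep S n.+1.

Definition conj_set (nu m : R) (phi : R -> R) (x : R) : set ('I_4 -> R) :=
  Eu nu m phi x 0 `&` lsand.

Definition conjugate_point (nu m : R) (phi : R -> R) (x : R) : Prop :=
  has_indep (conj_set nu m phi x) 1.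

Definition H3 (nu m : R) (phi : R -> R) : Prop :=
  forall x, ~ has_indep (conj_set nu m phi x) 2.

Definition conj_count (nu m : R) (phi : R -> R) (J : set R) (N : nat) : Prop :=
  exists (xs : seq R) (ms : seq nat),
    uniq xs /\ (forall x, (J x /\ conjugate_point nu m phi x) <-> x \in xs) /\
    size ms = size xs /\
    (forall i, (i < size xs)%N ->
       dimIs (conj_set nu m phi (nth 0 xs i)) (nth 0%N ms i)) /\
    sumn ms = N.

End Defs.

(* Main.v *)
From HB Require Import structures.
From mathcomp Require Import all_boot all_order all_algebra.
From mathcomp Require Import all_classical all_reals all_analysis.
From mathcomp Require Import measurable_realfun ring lra perm.
Require Import Defs.
Set Implicit Arguments. Unset Strict Implicit. Unset Printing Implicit Defensive.
Import Order.TTheory GRing.Theory Num.Theory.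
Import numFieldNormedType.Exports.
Local Open Scope classical_set_scope.
Local Open Scope ring_scope.

(** Put [V = - f'(phi)], so that [- L u = u'''' + 2 u'' + u + V u] with [V] positive
    near both ends. On functions [u] in H^2 with [u = u' = 0] at the endpoint [s], the
    form [int (u'' + u)^2 + V u^2] of [- L] is coercive outside a finite-dimensional
    space: split [(-oo, s]] into a half-line where [V] is positive and short segments
    where [u''] dominates; functions vanishing to first order at the nodes are
    orthogonal to the finitely many functions that solve [L b = 0] between the nodes.
    Diagonalizing the form leaves [n s] negative directions and a kernel of dimension
    [k s], spanned by decaying solutions of [L u = 0] with [u = u' = 0] at [s], that is
    by the intersection of the unstable subspace with the sandwich plane.

    If [V] is replaced by [V + lam], then [n] is a nonincreasing function of [lam],
    zero for large [lam], which by semicontinuity drops at each [lam] exactly by the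
    dimension of the kernel; hence [n] counts the positive eigenvalues. Likewise [n s]
    is nondecreasing in [s] (extension by zero and unique continuation), zero near
    [-oo], and jumps exactly by [k s] just after [s] (translations perturb the form
    little, [V] being uniformly continuous); hence it counts the conjugate points.
    Extension by zero and, conversely, cutting off by a cubic spline show that [n L] is
    the index on the whole line once [L] is large, whence also [k L = 0]. *)

(** * Integrals, primitives and decay *)

(** The operator is never diagonalized: all spectral information is read off from the Gram matrix of
    finitely many functions. This works because values and slopes at the nodes determine a function
    up to an element of the coercive space, and the functions dual to these data are form-orthogonal
    to that space; a null direction of the matrix has continuous momentum across the nodes and so is
    a true solution. Zero extension and gluing preserve H^2 but not H^4, whence the form rather than
    the operator; eigenfunctions in H^4 re-enter through integration by parts. The size of a jump
    comes from two bounds. Negative directions satisfy a strict inequality, so they survive small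
    perturbations, while [n + k] bounds, for some [e > 0], the dimension of any space on which the
    form lies below [e] times the squared norm: this limits the perturbed index. Conversely, the
    [n + k] nonpositive directions force the index up to at least [n + k] as soon as the shift
    decreases or the endpoint advances. *)

Section Integrals.
Variable R : realType.
Local Notation mu := (@lebesgue_measure R).
Implicit Types (D I : set R) (f g h : R -> R).

Definition itg D f := mu.-integrable D (EFin \o f).
Definition integ D f : R := Rintegral mu D f.

Lemma itg_meas D f : itg D f -> measurable_fun D f.
Proof. by move=> /(measurable_int mu) /measurable_EFinP. Qed.

Lemma eq_itg D f g : measurable D -> (forall x, D x -> f x = g x) ->
  itg D f -> itg D g.
Proof.
by move=> mD fg; apply: eq_integrable => // x /set_mem Dx /=; rewrite fg.
Qed.

Lemma eq_integ D f g : (forall x, D x -> f x = g x) -> integ D f = integ D g.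
Proof. by move=> fg; apply: eq_Rintegral => x /set_mem; exact: fg. Qed.

Lemma itgS D E f : measurable D -> measurable E -> E `<=` D ->
  itg D f -> itg E f.
Proof. by move=> mD mE ED; apply: integrableS. Qed.

Lemma itgD D f g : measurable D -> itg D f -> itg D g ->
  itg D (fun x => f x + g x).
Proof. by move=> mD; apply: integrableD. Qed.

Lemma itgZ D f c : measurable D -> itg D f -> itg D (fun x => c * f x).
Proof. by move=> mD fi; exact: (@integrableZl _ _ _ mu D mD c (EFin \o f) fi). Qed.

Lemma itgN D f : measurable D -> itg D f -> itg D (fun x => - f x).
Proof. by move=> mD; apply: integrableN. Qed.

Lemma itgB D f g : measurable D -> itg D f -> itg D g ->
  itg D (fun x => f x - g x).
Proof. by move=> mD; apply: integrableB. Qed.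

Lemma itg0 D : measurable D -> itg D (fun=> 0).
Proof. by move=> mD; apply: (@integrable0 _ _ _ mu D). Qed.

Lemma itg_sum D (T : Type) (s : seq T) (F : T -> R -> R) : measurable D ->
  (forall i, itg D (F i)) -> itg D (fun x => \sum_(i <- s) F i x).
Proof.
move=> mD Fi; elim: s => [|a s IH].
  by apply: (eq_itg mD _ (itg0 mD)) => x _; rewrite big_nil.
by apply: (eq_itg mD _ (itgD mD (Fi a) IH)) => x _; rewrite big_cons.
Qed.

Lemma itg_abs D f : measurable D -> itg D f -> itg D (fun x => `|f x|).
Proof. by move=> mD /integrable_norm. Qed.

Lemma itg_le D f g : measurable D -> measurable_fun D f ->
  (forall x, D x -> `|f x| <= g x) -> itg D g -> itg D f.
Proof.
move=> mD mf fg; apply: le_integrable => //; first exact/measurable_EFinP.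
move=> x Dx /=; rewrite lee_fin (le_trans (fg x Dx))//; exact: ler_norm.
Qed.

Lemma integD D f g : measurable D -> itg D f -> itg D g ->
  integ D (fun x => f x + g x) = integ D f + integ D g.
Proof. by move=> *; exact: RintegralD. Qed.

Lemma integB D f g : measurable D -> itg D f -> itg D g ->
  integ D (fun x => f x - g x) = integ D f - integ D g.
Proof. by move=> *; exact: RintegralB. Qed.

Lemma integZ D f c : measurable D -> itg D f ->
  integ D (fun x => c * f x) = c * integ D f.
Proof. by move=> *; exact: RintegralZl. Qed.

Lemma integ0 D : measurable D -> integ D (fun=> 0) = 0.
Proof. by move=> mD; rewrite /integ Rintegral_cst// mul0r. Qed.

Lemma integ_sum D (T : Type) (s : seq T) (F : T -> R -> R) : measurable D ->
  (forall i, itg D (F i)) ->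
  integ D (fun x => \sum_(i <- s) F i x) = \sum_(i <- s) integ D (F i).
Proof.
move=> mD Fi; elim: s => [|a s IH].
  by rewrite big_nil -[RHS](integ0 mD); apply: eq_integ => x _; rewrite big_nil.
rewrite big_cons -IH -integD//; last exact: itg_sum.
by apply: eq_integ => x _; rewrite big_cons.
Qed.

Lemma integ_ge0 D f : (forall x, D x -> 0 <= f x) -> 0 <= integ D f.
Proof. by move=> f0; rewrite /integ Rintegral_ge0. Qed.

Lemma le_integ D f g : measurable D -> itg D f -> itg D g ->
  (forall x, D x -> f x <= g x) -> integ D f <= integ D g.
Proof. by move=> *; exact: le_Rintegral. Qed.

Lemma le_abs_integ D f : measurable D -> itg D f ->
  `|integ D f| <= integ D (fun x => `|f x|).
Proof. by move=> mD fi; rewrite /integ le_normr_Rintegral. Qed.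

Lemma EFin_integ D f : measurable D -> itg D f ->
  (integ D f)%:E = (\int[mu]_(x in D) (f x)%:E)%E.
Proof. by move=> mD fi; rewrite fineK//; exact: integrable_fin_num. Qed.

Lemma le_integS D E f : measurable D -> measurable E -> E `<=` D ->
  itg D f -> (forall x, D x -> 0 <= f x) -> integ E f <= integ D f.
Proof.
move=> mD mE ED fi f0; have mf := itg_meas fi.
rewrite -lee_fin !EFin_integ//; last exact: itgS fi.
apply: ge0_subset_integral => //; exact/measurable_EFinP.
Qed.

Lemma integU D E f : measurable D -> measurable E -> itg (D `|` E) f ->
  [disjoint D & E] -> integ (D `|` E) f = integ D f + integ E f.
Proof. by move=> *; exact: Rintegral_setU. Qed.

Lemma aeS (P Q : R -> Prop) : (forall x, P x -> Q x) ->
  {ae mu, forall x, P x} -> {ae mu, forall x, Q x}.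
Proof.
move=> PQ; apply: (@filterS _ _ (ae_filter_ringOfSetsType mu)).
by move=> x; exact: PQ.
Qed.

Lemma ae_integ D f g : measurable D -> measurable_fun D f -> measurable_fun D g ->
  {ae mu, forall x, D x -> f x = g x} -> integ D f = integ D g.
Proof.
move=> mD mf mg fg; congr fine; apply: ae_eq_integral => //.
- exact/measurable_EFinP.
- exact/measurable_EFinP.
- by move: fg; apply: aeS => x h Dx; rewrite h.
Qed.

Lemma ae_itg D f g : measurable D -> measurable_fun D g ->
  {ae mu, forall x, D x -> f x = g x} -> itg D f -> itg D g.
Proof.
move=> mD mg fg /integrableP[mf fi]; apply/integrableP; split.
  exact/measurable_EFinP.
rewrite (_ : (\int[mu]_(x in D) _)%E = (\int[mu]_(x in D) `|(EFin \o f) x|)%E)//.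
apply: ae_eq_integral => //.
- by apply: measurableT_comp => //; exact/measurable_EFinP.
- exact: measurableT_comp.
- by move: fg; apply: aeS => x h Dx /=; rewrite h.
Qed.

Definition L2 D f := measurable_fun D f /\ itg D (fun x => f x ^+ 2).

Lemma L2M D f g : measurable D -> L2 D f -> L2 D g ->
  itg D (fun x => f x * g x).
Proof.
move=> mD [mf f2] [mg g2].
apply: (itg_le mD _ _ (itgD mD f2 g2)); first exact: measurable_funM.
move=> x _; rewrite ler_norml; apply/andP; split; nra.
Qed.

Lemma L2D D f g : measurable D -> L2 D f -> L2 D g ->
  L2 D (fun x => f x + g x).
Proof.
move=> mD f2 g2; split; first by apply: measurable_funD; [case: f2|case: g2].
apply: (eq_itg mD _ (itgD mD (itgD mD f2.2 g2.2) (itgZ 2 mD (L2M mD f2 g2)))).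
by move=> x _; ring.
Qed.

Lemma L2Z D f c : measurable D -> L2 D f -> L2 D (fun x => c * f x).
Proof.
move=> mD [mf f2]; split; first exact: measurable_funM.
by apply: (eq_itg mD _ (itgZ (c ^+ 2) mD f2)) => x _; rewrite exprMn.
Qed.

Lemma eq_L2 D f g : measurable D -> (forall x, D x -> f x = g x) ->
  L2 D f -> L2 D g.
Proof.
move=> mD fg [mf f2]; split.
  by apply: (eq_measurable_fun f) => // x /set_mem; exact: fg.
by apply: (eq_itg mD _ f2) => x Dx; rewrite fg.
Qed.

Lemma L2B D f g : measurable D -> L2 D f -> L2 D g ->
  L2 D (fun x => f x - g x).
Proof.
move=> mD f2 g2; apply: (eq_L2 mD _ (L2D mD f2 (L2Z (-1) mD g2))) => x _.
by rewrite mulN1r.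
Qed.

Lemma L2N D f : measurable D -> L2 D f -> L2 D (fun x => - f x).
Proof.
by move=> mD /(L2Z (-1) mD); apply: eq_L2 => // x _; rewrite mulN1r.
Qed.

Lemma L20 D : measurable D -> L2 D (fun=> 0).
Proof.
move=> mD; split => //.
by apply: (eq_itg mD _ (itg0 mD)) => x _; rewrite expr0n.
Qed.

Lemma L2S D E f : measurable D -> measurable E -> E `<=` D ->
  L2 D f -> L2 E f.
Proof.
move=> mD mE ED [mf f2]; split; first exact: measurable_funS mf.
exact: itgS f2.
Qed.

Lemma L2_bdd D f h M : measurable D -> measurable_fun D h ->
  (forall x, D x -> `|h x| <= M) -> L2 D f -> L2 D (fun x => h x * f x).
Proof.
move=> mD mh hM [mf f2]; split; first exact: measurable_funM.
apply: (itg_le mD _ _ (itgZ (M ^+ 2) mD f2)).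
  by apply: measurable_funX; exact: measurable_funM.
move=> x Dx; rewrite normrX normrM exprMn -[X in _ * X <= _]normrX.
rewrite [X in _ * X](@ger0_norm _ (f x ^+ 2)) ?sqr_ge0//.
apply: ler_wpM2r; first exact: sqr_ge0.
by rewrite ler_pXn2r ?nnegrE ?hM// (le_trans _ (hM x Dx)).
Qed.

Lemma cauchy_schwarz D f g : measurable D -> L2 D f -> L2 D g ->
  integ D (fun x => f x * g x) ^+ 2 <=
  integ D (fun x => f x ^+ 2) * integ D (fun x => g x ^+ 2).
Proof.
move=> mD f2 g2.
set F := integ D (fun x => f x ^+ 2); set A := integ D (fun x => g x ^+ 2).
set B := integ D (fun x => f x * g x).
have key s t : 0 <= s ^+ 2 * F + 2 * s * t * B + t ^+ 2 * A.
  have -> : s ^+ 2 * F + 2 * s * t * B + t ^+ 2 * A =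
     integ D (fun x => (s * f x + t * g x) ^+ 2).
    have fg := L2M mD f2 g2; case: f2 => _ f2; case: g2 => _ g2.
    rewrite -!integZ// -!integD//; last exact: itgZ.
    - by apply: eq_integ => x _; ring.
    - by apply: itgD => //; exact: itgZ.
    - exact: itgZ.
    - exact: itgZ.
  by apply: integ_ge0 => x _; exact: sqr_ge0.
have A0 : 0 <= A by apply: integ_ge0 => x _; exact: sqr_ge0.
have F0 : 0 <= F by apply: integ_ge0 => x _; exact: sqr_ge0.
have [A00|An0] := eqVneq A 0.
  have [->|Bn0] := eqVneq B 0; first by rewrite expr0n /= mulr_ge0.
  (* Here the quadratic is affine in [t], and this choice would give it the value -1. *)
  have := key 1 (- (F + 1) / B / 2).
  rewrite A00 mulr0 addr0 expr1n mul1r.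
  have -> : 2 * 1 * (- (F + 1) / B / 2) * B = - (F + 1) by field.
  by lra.
have Apos : 0 < A by rewrite lt_def An0.
have := key A (- B); have -> : A ^+ 2 * F + 2 * A * - B * B + (- B) ^+ 2 * A =
  A * (F * A - B ^+ 2) by ring.
by rewrite pmulr_rge0// subr_ge0.
Qed.

End Integrals.

(** * Primitives, Fubini on a triangle and the product rule *)

Section Primitives.
Variable R : realType.
Local Notation mu := (@lebesgue_measure R).
Implicit Types (D I : set R) (f g h G H : R -> R).

Lemma segP (a b x : R) : `[a, b]%classic x <-> a <= x <= b.
Proof. by rewrite /= in_itv. Qed.

Lemma mseg (a b : R) : measurable `[a, b]%classic.
Proof. exact: measurable_itv. Qed.
Hint Resolve mseg : core.

Lemma integ_segD (a b c : R) f : a <= b -> b <= c -> itg `[a, c] f ->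
  integ `[a, c] f = integ `[a, b] f + integ `[b, c] f.
Proof.
move=> ab bc fi; have := @Rintegral_itvB _ f (BLeft a) (BRight c) b fi.
rewrite !bnd_simp => /(_ ab bc) e.
rewrite /integ -[X in _ + X]Rintegral_itv_obnd_cbnd -?e; first by rewrite addrC subrK.
by apply: itgS fi => //; apply: subset_itvr; rewrite bnd_simp.
Qed.

Lemma integ_seg1 (a : R) f : integ `[a, a] f = 0.
Proof. by rewrite /integ set_itv1 Rintegral_set1. Qed.

Lemma integ_mkcond D f : integ D f = integ setT (f \_ D).
Proof. exact: Rintegral_mkcond. Qed.

Lemma itg_mkcond D f : measurable D -> itg D f <-> itg setT (f \_ D).
Proof.
move=> mD; have := @integrable_mkcond _ _ _ mu D (EFin \o f) mD.
by rewrite (_ : (EFin \o f) \_ D = EFin \o f \_ D)//; exact: restrict_EFin.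
Qed.

Lemma itgU D E f : measurable D -> measurable E -> itg D f -> itg E f ->
  itg (D `|` E) f.
Proof.
move=> mD mE f1 f2; apply/itg_mkcond; first exact: measurableU.
have f3 : itg (E `\` D) f.
  by apply: itgS f2 => //; first exact: measurableD.
move/itg_mkcond in f1; move/itg_mkcond in f3.
apply: eq_itg (itgD _ (f1 mD) (f3 (measurableD mE mD))) => // x _.
rewrite /patch !in_setU in_setD; case: (x \in D); case: (x \in E) => /=;
  by rewrite ?addr0 ?add0r.
Qed.

Lemma itg_segU (a b c : R) f : a <= b -> b <= c -> itg `[a, b] f ->
  itg `[b, c] f -> itg `[a, c] f.
Proof.
move=> ab bc f1 f2.
have -> : `[a, c]%classic = `[a, b]%classic `|` `[b, c]%classic; last exact: itgU.
apply/seteqP; split => x.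
  move=> /segP/andP[ax xc]; have [xb|bx] := leP x b; [left|right]; apply/segP; lra.
by move=> [] /segP h; apply/segP; lra.
Qed.

Definition cvx I := forall x y z : R, I x -> I z -> x <= y <= z -> I y.

Lemma cvx_seg (a b : R) : cvx `[a, b].
Proof. by move=> x y z /segP ? /segP ? ?; apply/segP; lra. Qed.

Lemma cvxT : cvx setT. Proof. by []. Qed.

Lemma seg_sub I (x y : R) : cvx I -> I x -> I y -> `[x, y]%classic `<=` I.
Proof. by move=> cI Ix Iy z /segP; exact: cI. Qed.

Definition prim I G g := forall x y, I x -> I y -> x <= y ->
  itg `[x, y] g /\ G y - G x = integ `[x, y] g.

Lemma primS I J G g : J `<=` I -> prim I G g -> prim J G g.
Proof. by move=> JI p x y /JI Ix /JI Iy; exact: p. Qed.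

Lemma eq_prim I G g G' g' : cvx I -> (forall x, I x -> G x = G' x) ->
  (forall x, I x -> g x = g' x) -> prim I G g -> prim I G' g'.
Proof.
move=> cI GG gg p x y Ix Iy xy; have [i e] := p _ _ Ix Iy xy; split.
  by apply: eq_itg i => // z /(seg_sub cI Ix Iy); exact: gg.
by rewrite -!GG// e; apply: eq_integ => z /(seg_sub cI Ix Iy); exact: gg.
Qed.

Lemma primD I G g H h : prim I G g -> prim I H h ->
  prim I (fun x => G x + H x) (fun x => g x + h x).
Proof.
move=> p q x y Ix Iy xy; have [i e] := p _ _ Ix Iy xy.
have [j e'] := q _ _ Ix Iy xy; split; first exact: itgD.
by rewrite integD// -e -e'; ring.
Qed.

Lemma primZ I G g c : prim I G g ->
  prim I (fun x => c * G x) (fun x => c * g x).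
Proof.
move=> p x y Ix Iy xy; have [i e] := p _ _ Ix Iy xy; split; first exact: itgZ.
by rewrite integZ// -e; ring.
Qed.

Lemma primB I G g H h : prim I G g -> prim I H h ->
  prim I (fun x => G x - H x) (fun x => g x - h x).
Proof.
move=> p q x y Ix Iy xy; have [i e] := p _ _ Ix Iy xy.
have [j e'] := q _ _ Ix Iy xy; split; first exact: itgB.
by rewrite integB// -e -e'; ring.
Qed.

Lemma prim_cst I c : prim I (fun=> c) (fun=> 0).
Proof. by move=> x y _ _ _; split; [exact: itg0|rewrite subrr integ0]. Qed.

Arguments prim_cst I c : clear implicits.

Lemma prim_sum I (T : Type) (s : seq T) (F f : T -> R -> R) :
  (forall i, prim I (F i) (f i)) ->
  prim I (fun x => \sum_(i <- s) F i x) (fun x => \sum_(i <- s) f i x).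
Proof.
move=> p x y Ix Iy xy; split; first by apply: itg_sum => // i; case: (p i x y).
rewrite integ_sum//; last by move=> i; case: (p i x y).
rewrite -sumrB; apply: eq_bigr => i _; by case: (p i x y).
Qed.

Lemma prim_cont_seg (a b : R) G g : a <= b -> prim `[a, b] G g ->
  {within `[a, b], continuous G}.
Proof.
move=> ab p; have Ha : `[a, b]%classic a by apply/segP; lra.
have Hb : `[a, b]%classic b by apply/segP; lra.
have [gi _] := p a b Ha Hb ab.
have := parameterized_integral_continuous ab gi.
rewrite /parameterized_integral => c.
have c2 : {within `[a, b], continuous (fun x => G a + \int[mu]_(t in `[a, x]) g t)}.
  by move=> x; apply: cvgD; [exact: cvg_cst|exact: c].
apply: subspace_eq_continuous c2 => x /set_mem abx.
have /segP/andP[ax _] := abx; have [_ e] := p a x Ha abx ax.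
by rewrite /from_subspace -[X in _ + X]/(integ _ g) -e addrC subrK.
Qed.

Lemma prim_meas_seg (a b : R) G g : a <= b -> prim `[a, b] G g ->
  measurable_fun `[a, b] G.
Proof.
by move=> ab p; apply: subspace_continuous_measurable_fun => //; exact: prim_cont_seg p.
Qed.

Lemma prim_bdd_seg (a b : R) G g : a <= b -> prim `[a, b] G g ->
  exists M, forall x, a <= x <= b -> `|G x| <= M.
Proof.
move=> ab p; exists (`|G a| + integ `[a, b] (fun t => `|g t|)) => x axb.
have Ha : `[a, b]%classic a by apply/segP; lra.
have Hb : `[a, b]%classic b by apply/segP; lra.
have [gi _] := p a b Ha Hb ab.
have abx : `[a, b]%classic x by apply/segP.
have /andP[ax xb] := axb.
have [gx e] := p a x Ha abx ax.
have -> : G x = G a + integ `[a, x] g by rewrite -e addrC subrK.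
apply: le_trans (ler_normD _ _) _; rewrite lerD2l.
apply: le_trans (le_abs_integ _ gx) _ => //; apply: le_integS => //.
- by move=> t /segP ?; apply/segP; lra.
- exact: itg_abs.
Qed.

Lemma itg_mul_bdd D f h M : measurable D -> itg D f -> measurable_fun D h ->
  (forall x, D x -> `|h x| <= M) -> itg D (fun x => f x * h x).
Proof.
move=> mD fi mh hM.
apply: (itg_le mD _ _ (itgZ M mD (itg_abs mD fi))).
  by apply: measurable_funM => //; exact: itg_meas.
by move=> x Dx; rewrite normrM mulrC ler_wpM2r ?hM.
Qed.

(** Both sides are iterated integrals of [g t * h r] over the triangle [a <= r <= t <= b].
    Integration by parts needs this when the primitives are not differentiable everywhere. *)
Lemma triangle_fubini (a b : R) g h : a <= b -> itg `[a, b] g -> itg `[a, b] h ->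
  integ `[a, b] (fun t => g t * integ `[a, t] h) =
  integ `[a, b] (fun r => h r * integ `[r, b] g).
Proof.
move=> ab gi hi.
have gi' := (itg_mkcond g (mseg a b)).1 gi.
have hi' := (itg_mkcond h (mseg a b)).1 hi.
set g' := g \_ _ in gi'; set h' := h \_ _ in hi'.
pose F (z : R * R) : R := g' z.1 * h' z.2 * (z.2 <= z.1)%R%:R.
have mchi : measurable_fun [set: R * R] (fun z : R * R => (z.2 <= z.1)%R%:R : R).
  have -> : (fun z : R * R => (z.2 <= z.1)%R%:R : R) =
            (fun z => if (z.2 <= z.1)%R then 1 else 0 : R).
    by apply/funext => z; case: ifP.
  by apply: measurable_fun_ifT => //; exact: measurable_fun_ler.
have mF : measurable_fun [set: R * R] (EFin \o F).
  apply/measurable_EFinP; apply: measurable_funM => //.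
  apply: measurable_funM.
    by apply: (measurableT_comp (itg_meas gi')); exact: measurable_fst.
  by apply: (measurableT_comp (itg_meas hi')); exact: measurable_snd.
have mle (s : R) : measurable_fun setT (fun r : R => (r <= s)%R%:R : R).
  have -> : (fun r : R => (r <= s)%R%:R : R) = (fun z : R => if (z <= s)%R then 1 else 0 : R).
    by apply/funext => z; case: ifP.
  by apply: measurable_fun_ifT => //; exact: measurable_fun_ler.
have mge (s : R) : measurable_fun setT (fun r : R => (s <= r)%R%:R : R).
  have -> : (fun r : R => (s <= r)%R%:R : R) = (fun z : R => if (s <= z)%R then 1 else 0 : R).
    by apply/funext => z; case: ifP.
  by apply: measurable_fun_ifT => //; exact: measurable_fun_ler.
have hle s : itg setT (fun r => h' r * (r <= s)%R%:R).
  by apply: (@itg_mul_bdd _ _ _ 1) => // r _; case: (r <= s); rewrite ?normr1 ?normr0.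
have gge s : itg setT (fun r => g' r * (s <= r)%R%:R).
  by apply: (@itg_mul_bdd _ _ _ 1) => // r _; case: (s <= r); rewrite ?normr1 ?normr0.
(* By Tonelli it suffices that the integral of [|F|] be finite; dropping the indicator bounds it by
   a product of L1 norms. *)
have iF : ((@lebesgue_measure R) \x (@lebesgue_measure R))%E.-integrable setT (EFin \o F).
  apply/integrable12ltyP; first exact: mF.
  pose C := integ setT (fun r => `|h' r|).
  apply: (@le_lt_trans _ _ (\int[mu]_t (`|g' t| * C)%:E)%E); last first.
    rewrite -(@EFin_integ _ setT (fun t => `|g' t| * C)) ?ltry//.
    apply: eq_itg (itgZ C _ (itg_abs _ gi')) => // t _; exact: mulrC.
  apply: ge0_le_integral => //.
  - by move=> t _; exact: integral_ge0.
  - have mAF : measurable_fun [set: R * R] (abse \o (EFin \o F)).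
      exact: (measurableT_comp _ mF).
    have aF0 z : (0 <= (abse \o (EFin \o F)) z)%E by exact: abse_ge0.
    exact: (@measurable_fun_fubini_tonelli_F _ _ _ _ _ mu _ mAF aF0).
  - apply/measurable_EFinP; apply: measurable_funM => //.
    by apply: measurableT_comp => //; exact: itg_meas.
  - move=> t _ /=.
    apply: (@le_trans _ _ (\int[mu]_r (`|g' t| * `|h' r|)%:E)%E).
      apply: ge0_le_integral => //.
      + apply/measurable_EFinP; apply: measurableT_comp => //.
        have := itg_meas (itgZ (g' t) measurableT (hle t)).
        by congr (measurable_fun _ _); apply/funext => r; rewrite /F /= mulrA.
      + apply/measurable_EFinP; apply: measurable_funM => //.
        by apply: measurableT_comp => //; exact: itg_meas.
      + move=> r _; rewrite lee_fin /F /= !normrM; case: (r <= t).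
          by rewrite normr1 mulr1.
        by rewrite normr0 mulr0 mulr_ge0.
    rewrite -EFin_integ//; last exact/itgZ/itg_abs.
    by rewrite lee_fin integZ//; exact: itg_abs.
have e1 : (fun t => \int[mu]_r (EFin \o F) (t, r))%E =
    EFin \o ((fun t => g t * integ `[a, t] h) \_ `[a, b]).
  apply/funext => t; rewrite /= /F /=.
  under eq_integral do rewrite -mulrA.
  rewrite -(@EFin_integ _ setT (fun r => g' t * (h' r * (r <= t)%R%:R)))//; last exact: itgZ.
  rewrite integZ// /g' /patch; case: ifPn => [/set_mem/segP abt|_]; last by rewrite mul0r.
  congr (_ * _)%:E; rewrite [RHS]integ_mkcond; apply: eq_integ => r _.
  rewrite /h' /patch; case: ifPn => [/set_mem/segP abr|/negP nr].
    case: ifPn => [/set_mem/segP h1|/negP h1].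
      by have -> : r <= t by [lra]; rewrite mulr1.
    have -> : (r <= t) = false; last by rewrite mulr0.
    by apply/negP => rt; apply: h1; apply/mem_set/segP; lra.
  rewrite mul0r; case: ifPn => [/set_mem/segP h1|//].
  by case: nr; apply/mem_set/segP; lra.
have e2 : (fun r => \int[mu]_t (EFin \o F) (t, r))%E =
    EFin \o ((fun r => h r * integ `[r, b] g) \_ `[a, b]).
  apply/funext => r; rewrite /= /F /=.
  under eq_integral do rewrite (mulrC (g' _)) -mulrA.
  rewrite -(@EFin_integ _ setT (fun t => h' r * (g' t * (r <= t)%R%:R)))//; last exact: itgZ.
  rewrite integZ// /h' /patch; case: ifPn => [/set_mem/segP abt|_]; last by rewrite mul0r.
  congr (_ * _)%:E; rewrite [RHS]integ_mkcond; apply: eq_integ => t _.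
  rewrite /g' /patch; case: ifPn => [/set_mem/segP abr|/negP nr].
    case: ifPn => [/set_mem/segP h1|/negP h1].
      by have -> : r <= t by [lra]; rewrite mulr1.
    have -> : (r <= t) = false; last by rewrite mulr0.
    by apply/negP => rt; apply: h1; apply/mem_set/segP; lra.
  rewrite mul0r; case: ifPn => [/set_mem/segP h1|//].
  by case: nr; apply/mem_set/segP; lra.
rewrite integ_mkcond [RHS]integ_mkcond; congr fine.
have := Fubini iF; rewrite /= in e1 e2 *.
by rewrite [X in (integral _ _ X = _)%E -> _]e1 [X in (_ = integral _ _ X)%E -> _]e2.
Qed.

(** Writing [H] from the left end and [G] from the right end turns both terms into integrals over
    the triangle, which cancel by [triangle_fubini]. *)
Lemma primM I G g H h : cvx I -> prim I G g -> prim I H h ->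
  prim I (fun x => G x * H x) (fun x => g x * H x + G x * h x).
Proof.
move=> cI p q a b Ia Ib ab.
have sI := seg_sub cI Ia Ib.
have p' := primS sI p; have q' := primS sI q.
have [gi eg] := p _ _ Ia Ib ab; have [hi eh] := q _ _ Ia Ib ab.
have mG := prim_meas_seg ab p'; have mH := prim_meas_seg ab q'.
have [M1 bG] := prim_bdd_seg ab p'; have [M2 bH] := prim_bdd_seg ab q'.
have gHi : itg `[a, b] (fun x => g x * H x).
  by apply: (@itg_mul_bdd _ _ _ M2) => // x /segP; exact: bH.
have hGi : itg `[a, b] (fun x => h x * G x).
  by apply: (@itg_mul_bdd _ _ _ M1) => // x /segP; exact: bG.
have Ghi : itg `[a, b] (fun x => G x * h x).
  by apply: eq_itg hGi => // x _; rewrite mulrC.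
split; first exact: itgD.
rewrite integD//.
have Ht t : `[a, b]%classic t -> H t = H a + integ `[a, t] h.
  by move=> abt; have /segP/andP[at_ _] := abt; have [_ <-] := q a t Ia (sI _ abt) at_; ring.
have Gt t : `[a, b]%classic t -> G t = G b - integ `[t, b] g.
  by move=> abt; have /segP/andP[_ tb] := abt; have [_ <-] := p t b (sI _ abt) Ib tb; ring.
have i1 : itg `[a, b] (fun t => g t * integ `[a, t] h).
  apply: eq_itg (itgB _ gHi (itgZ (H a) _ gi)) => // t abt.
  by rewrite (Ht t)//; ring.
have i2 : itg `[a, b] (fun t => h t * integ `[t, b] g).
  apply: eq_itg (itgB _ (itgZ (G b) _ hi) hGi) => // t abt.
  by rewrite (Gt t)//; ring.
have -> : integ `[a, b] (fun x => g x * H x) =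
    H a * (G b - G a) + integ `[a, b] (fun t => g t * integ `[a, t] h).
  rewrite eg -integZ// -integD//; last exact: itgZ.
  by apply: eq_integ => t abt; rewrite (Ht t)//; ring.
have -> : integ `[a, b] (fun x => G x * h x) =
    G b * (H b - H a) - integ `[a, b] (fun t => h t * integ `[t, b] g).
  rewrite eh -integZ// -integB//; last exact: itgZ.
  by apply: eq_integ => t abt; rewrite (Gt t)//; ring.
by rewrite triangle_fubini//; ring.
Qed.

End Primitives.
#[global] Arguments prim_cst {R} I c.

(** * Integrals and limits at -oo *)

Section Tails.
Variable R : realType.
Local Notation mu := (@lebesgue_measure R).
Implicit Types (D I : set R) (f g h G H : R -> R).

Hint Resolve mseg : core.

Lemma mhl (s : R) : measurable (halfline s).
Proof.
rewrite (_ : halfline s = `]-oo, s]%classic); first exact: measurable_itv.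
by rewrite set_itvE.
Qed.
Hint Resolve mhl : core.

Lemma cvx_hl (s : R) : cvx (halfline s).
Proof. by move=> x y z /= xs zs xyz; rewrite /halfline/=; move: xs zs; rewrite /halfline /=; lra. Qed.

Lemma seg_hl (a s : R) : `[a, s]%classic `<=` halfline s.
Proof. by move=> x /segP ?; rewrite /halfline/=; lra. Qed.

Lemma nat_above (x : R) : exists n : nat, x <= n%:R.
Proof.
exists (Num.truncn x).+1; have [x0|x0] := leP 0 x; last by rewrite (le_trans (ltW x0)).
by rewrite ltW// truncnS_gt.
Qed.

Lemma hl_bigcup (s : R) : halfline s = \bigcup_(n : nat) `[s - n%:R, s]%classic.
Proof.
apply/seteqP; split => x; last by move=> [n _ /segP h]; rewrite /halfline/=; lra.
rewrite /halfline/= => xs; have [n hn] := nat_above (s - x).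
by exists n => //; apply/segP; lra.
Qed.

Lemma cvg_integral_hl (s : R) f : measurable_fun (halfline s) f ->
  (forall x, x <= s -> 0 <= f x) ->
  (\int[mu]_(x in (`[(s - n%:R)%R, s]%classic)) (f x)%:E)%E @[n --> \oo] -->
  (\int[mu]_(x in halfline s) (f x)%:E)%E.
Proof.
move=> mf f0; rewrite hl_bigcup.
apply: (@ge0_nondecreasing_set_cvg_integral _ (measurableTypeR R) R
  (fun n : nat => `[s - n%:R, s]%classic) (EFin \o f) mu).
- apply/nondecreasing_seqP => n; rewrite subsetEset => x /segP h.
  have := ler_nat R n n.+1; rewrite leqnSn => h2; apply/segP; lra.
- by move=> n; exact: mseg.
- by move=> n; apply/measurable_EFinP; apply: measurable_funS mf => //; exact: seg_hl.
- by move=> n x /segP h; rewrite lee_fin f0//; lra.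
Qed.

(** Monotone convergence along [[s - n, s]]; this is how bounded energy on segments becomes square
    integrability on the half-line. *)
Lemma itg_hl_bdd (s C : R) f : measurable_fun (halfline s) f ->
  (forall x, x <= s -> 0 <= f x) ->
  (forall x, x <= s -> itg `[x, s] f /\ integ `[x, s] f <= C) ->
  itg (halfline s) f /\ integ (halfline s) f <= C.
Proof.
move=> mf f0 b.
have le : (\int[mu]_(x in halfline s) (f x)%:E <= C%:E)%E.
  have c := cvg_integral_hl mf f0.
  rewrite -(cvg_lim (@ereal_hausdorff R) c); apply: lime_le; first by apply: cvgP c.
  apply: nearW => n; have h : s - n%:R <= s by rewrite gerBl.
  by have [i j] := b _ h; rewrite -EFin_integ// lee_fin.
have i : itg (halfline s) f.
  apply/integrableP; split; first exact/measurable_EFinP.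
  apply: le_lt_trans (ltry C); apply: le_trans le; rewrite le_eqVlt; apply/orP; left.
  by apply/eqP/eq_integral => x /set_mem xs; rewrite /= ger0_norm// f0.
by split=> //; rewrite -lee_fin EFin_integ.
Qed.

Lemma itg_hl_tail (s : R) f : itg (halfline s) f ->
  (forall x, x <= s -> 0 <= f x) ->
  forall e, 0 < e -> exists2 A, A <= s & forall x, x <= A -> integ (halfline x) f <= e.
Proof.
move=> fi f0 e e0; have c := cvg_integral_hl (itg_meas fi) f0.
have c2 : integ `[s - n%:R, s] f @[n --> \oo] --> integ (halfline s) f.
  by move: c; rewrite -EFin_integ// => /fine_cvg.
move/cvgrPdist_le : c2 => /(_ e e0) [n _ /(_ n (leqnn n)) hn].
exists (s - n%:R - 1); first by have : (0 <= n%:R :> R) by []; lra.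
move=> x xA; have n0 : (0 <= n%:R :> R) by [].
have sub : halfline x `<=` halfline s by move=> y; rewrite /halfline/=; lra.
have e1 : integ (halfline x `|` `[s - n%:R, s]) f =
    integ (halfline x) f + integ `[s - n%:R, s] f.
  apply: integU => //; first by apply: itgU => //; apply: itgS fi => //; exact: seg_hl.
  by apply/disj_setPS => y [/=]; rewrite /halfline /= => ? /segP; lra.
have : integ (halfline x `|` `[s - n%:R, s]) f <= integ (halfline s) f.
  apply: le_integS => //; first exact: measurableU.
  by move=> y [/sub//|/seg_hl].
have := le_trans (ler_norm _) hn; lra.
Qed.

(** The limit 0 at -oo in epsilon form; [vanlP] identifies it with the filter limit required of the
    solutions in [Eu]. *)
Definition vanl f := forall e : R, 0 < e -> exists A, forall x, x <= A -> `|f x| <= e.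

Lemma eq_vanl f g : (exists A, forall x, x <= A -> f x = g x) -> vanl f -> vanl g.
Proof.
move=> [A fg] v e e0; have [B h] := v e e0; exists (Num.min A B) => x.
by rewrite le_min => /andP[xA xB]; rewrite -fg// h.
Qed.

Lemma vanlD f g : vanl f -> vanl g -> vanl (fun x => f x + g x).
Proof.
move=> v w e e0; have e2 : 0 < e / 2 by rewrite divr_gt0.
have [A a] := v _ e2; have [B b] := w _ e2.
exists (Num.min A B) => x; rewrite le_min => /andP[/a xA /b xB].
by rewrite (le_trans (ler_normD _ _))//; lra.
Qed.

Lemma vanlM_bdd f g M A0 : (forall x, x <= A0 -> `|g x| <= M) -> vanl f ->
  vanl (fun x => f x * g x).
Proof.
move=> gM v e e0; pose M' := `|M| + 1.
have M0 : 0 < M' by rewrite /M' ltr_wpDl.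
have [A h] := v (e / M') (divr_gt0 e0 M0).
exists (Num.min A0 A) => x; rewrite le_min => /andP[xA0 /h xA].
rewrite normrM; apply: (@le_trans _ _ (e / M' * M')); last by rewrite divfK ?gt_eqF.
apply: ler_pM => //; apply: le_trans (gM x xA0) _; rewrite /M'.
by apply: le_trans (ler_norm _) _; rewrite lerDl.
Qed.

Lemma vanl_bdd f : vanl f -> exists A, forall x, x <= A -> `|f x| <= 1.
Proof. by move=> /(_ 1 ltr01). Qed.

Lemma vanlM f g : vanl f -> vanl g -> vanl (fun x => f x * g x).
Proof. by move=> v /vanl_bdd[A h]; exact: (vanlM_bdd h v). Qed.

Lemma vanlZ f c : vanl f -> vanl (fun x => c * f x).
Proof.
move=> v; apply: (@eq_vanl (fun x => f x * c)); first by exists 0 => x _; rewrite mulrC.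
by apply: (@vanlM_bdd _ _ `|c| 0).
Qed.

Lemma vanl0 : vanl (fun=> 0).
Proof. by move=> e e0; exists 0 => x _; rewrite normr0 ltW. Qed.

Lemma vanlB f g : vanl f -> vanl g -> vanl (fun x => f x - g x).
Proof.
move=> v w; apply: (@eq_vanl (fun x => f x + -1 * g x)).
  by exists 0 => x _; rewrite mulN1r.
exact/vanlD/vanlZ.
Qed.

Lemma vanl_sum (T : Type) (s : seq T) (F : T -> R -> R) :
  (forall i, vanl (F i)) -> vanl (fun x => \sum_(i <- s) F i x).
Proof.
move=> Fi; elim: s => [|a s IH].
  by apply: (eq_vanl _ vanl0); exists 0 => x _; rewrite big_nil.
by apply: (eq_vanl _ (vanlD (Fi a) IH)); exists 0 => x _; rewrite big_cons.
Qed.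

(** The fundamental theorem of calculus started at -oo: far to the left, the tail of the integral
    and the value of [G] are each at most a third of any alleged discrepancy. *)
Lemma integ_hl_prim (s : R) G g : prim (halfline s) G g -> itg (halfline s) g ->
  vanl G -> integ (halfline s) g = G s.
Proof.
move=> p gi v; apply/eqP; rewrite -subr_eq0 -normr_eq0 -[_ == _]negbK; apply/negP.
rewrite neq_lt normr_lt0 /= => e0; set e := `|_| in e0.
have e3 : 0 < e / 3 by rewrite divr_gt0.
have gi' := itg_abs (mhl s) gi.
have [A As hA] := itg_hl_tail gi' (fun x _ => normr_ge0 (g x)) e3.
have [B hB] := v _ e3.
pose x := Num.min A B.
have xA : x <= A by rewrite /x ge_min lexx.
have xB : x <= B by rewrite /x ge_min lexx orbT.
have xs : x <= s by apply: le_trans As.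
have [gx ex] := p x s xs (lexx s) xs.
have ee : e = `|integ (halfline s) g - (G x + integ `[x, s] g)| by rewrite /e -ex; congr `|_|; ring.
have sub : halfline x `<=` halfline s by move=> y; rewrite /halfline/=; lra.
have gx2 : itg (halfline x) g by exact: itgS gi.
have hs : integ (halfline s) g = integ (halfline x) g + integ `[x, s] g.
  rewrite [integ `[x, s] g](_ : _ = integ `]x, s] g); last first.
    rewrite /integ -Rintegral_itv_obnd_cbnd//.
    by apply: itgS gx => //; apply: subset_itvr; rewrite bnd_simp.
  rewrite -integU//.
  - congr integ; apply/seteqP; split => y; rewrite /halfline/=.
      have [yx|yx] := leP y x; [by left|right; by rewrite /= in_itv/=; lra].
    by move=> [/=|]; rewrite ?in_itv/=; lra.
  - have -> : halfline x `|` `]x, s]%classic = halfline s; last by [].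
    apply/seteqP; split => y; rewrite /halfline/=; last first.
      have [yx|yx] := leP y x; [by left|right; by rewrite /= in_itv/=; lra].
    by move=> [/=|]; rewrite ?in_itv/=; lra.
  - by apply/disj_setPS => y [/=]; rewrite /halfline /= => ?; rewrite in_itv/=; lra.
have := hA x xA; have := le_abs_integ (mhl x) gx2; have := hB x xB.
rewrite ee hs in e0 e3 *.
set a := integ (halfline x) g; set b := integ `[x, s] g; set c := integ _ _ => h1 h2 h3.
have := ler_normB a (G x).
rewrite (_ : a - G x = a + b - (G x + b)); last by ring.
by move: h1 h2 h3 e0; set u := `|a + b - _|; lra.
Qed.

End Tails.

(** * Change of variables and local estimates *)

Section Calculus.
Variable R : realType.
Local Notation mu := (@lebesgue_measure R).
Implicit Types (D I : set R) (f g h G H : R -> R).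

Hint Resolve mseg mhl : core.

Lemma cont_itg (a b : R) f : {within `[a, b], continuous f} -> itg `[a, b] f.
Proof. by move=> cf; apply: continuous_compact_integrable => //; exact: segment_compact. Qed.

Lemma continuous_itg (a b : R) f : continuous f -> itg `[a, b] f.
Proof. by move=> cf; apply: cont_itg; exact: continuous_subspaceT. Qed.

Lemma continuous_L2 (a b : R) f : continuous f -> L2 `[a, b] f.
Proof.
move=> cf; split.
  by apply: measurable_funS (continuous_measurable_fun cf).
apply: continuous_itg => x; under eq_fun do rewrite expr2.
by apply: continuousM; exact: cf.
Qed.

Lemma prim_continuous G g : prim setT G g -> continuous G.
Proof.
move=> p x; have h : x - 1 < x + 1 by lra.
have := prim_cont_seg (ltW h) (primS (@subsetT _ _) p).
move=> /(continuous_within_itvP _ h)[c _ _]; apply: c.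
by rewrite in_itv/=; lra.
Qed.

Lemma prim_derive G g : prim setT G g -> continuous g ->
  forall x : R, is_derive x 1 G (g x).
Proof.
move=> p cg x.
have gi := @continuous_itg (x - 1) (x + 1) g cg.
have xu : x < x + 1 by lra.
have ax : x - 1 < x by lra.
have [d e] := continuous_FTC1_closed xu gi ax (cg x).
pose F y := G (x - 1) + \int[mu]_(t in `[x - 1, y]) g t.
have dF : is_derive x 1 F (g x).
  rewrite -[g x]add0r /F; apply: is_deriveD; rewrite -e derive1E.
  by apply/derivableP.
apply: (near_eq_is_derive (f := F)) => //.
near=> y; have [//|//| |_ ee] := p (x - 1) y.
  by near: y; apply: lt_le_nbhsr.
by rewrite /F -[X in _ + X]/(integ _ g) -ee addrC subrK.
Unshelve. all: by end_near. Qed.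

Lemma derive_prim I G g : cvx I -> (forall x : R, I x -> is_derive x 1 G (g x)) ->
  (forall a b, I a -> I b -> {within `[a, b], continuous g}) -> prim I G g.
Proof.
move=> cI d cg x y Ix Iy xy; split; first exact/cont_itg/cg.
have [->|nxy] := eqVneq x y; first by rewrite integ_seg1 subrr.
have {nxy} xy : x < y by rewrite lt_neqAle nxy.
have Iz z : x <= z <= y -> I z by move=> ?; exact: (cI x z y).
apply/EFin_inj; rewrite EFin_integ//; last exact/cont_itg/cg.
rewrite EFinB; apply/esym/continuous_FTC2 => //; first exact: cg.
  have dG z : x <= z <= y -> derivable G z 1 by move=> /Iz/d[].
  have cG z : x <= z <= y -> {for z, continuous G}.
    by move=> /dG dz; apply: differentiable_continuous; exact/derivable1_diffP.
  split.
  - by move=> z; rewrite in_itv/= => zz; apply: dG; lra.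
  - by apply: cvg_at_right_filter; apply: cG; lra.
  - by apply: cvg_at_left_filter; apply: cG; lra.
move=> z; rewrite in_itv/= => zz; rewrite derive1E.
by have [|_ ->] := d z; first by apply: Iz; lra.
Qed.

Lemma prim_id I : prim I (fun x => x) (fun=> 1).
Proof.
apply: (primS (@subsetT _ I)); apply: derive_prim; first exact: cvxT.
by move=> ? ? _ _; apply: continuous_subspaceT => y; exact: cst_continuous.
Qed.
Arguments prim_id I : clear implicits.

Lemma integ_cst (a b c : R) : a <= b -> integ `[a, b] (fun=> c) = c * (b - a).
Proof.
move=> ab; have [//|//|//|_] := @primZ _ _ _ _ c (prim_id setT) a b.
rewrite -mulrBr => ->; apply: eq_integ => x _; by rewrite mulr1.
Qed.

Lemma integ_preserving (T : measurableTypeR R -> measurableTypeR R) D f :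
  measurable_fun setT T -> (forall A, measurable A -> mu A = pushforward mu T A) ->
  measurable D -> itg (T @^-1` D) (f \o T) -> measurable_fun D f ->
  itg D f /\ integ D f = integ (T @^-1` D) (f \o T).
Proof.
move=> mT pT mD fi mf.
have mDN : measurable (T @^-1` D) by rewrite -[X in measurable X]setTI; exact: mT.
have f'i := (itg_mkcond _ mDN).1 fi.
have ef : (f \_ D) \o T = (f \o T) \_ (T @^-1` D).
  by apply/funext => x; rewrite /= /patch; congr (if _ then _ else _); rewrite !inE.
have mf' : measurable_fun [set: measurableTypeR R] (EFin \o (f \_ D)).
  by apply/measurable_EFinP; apply/(measurable_restrictT _ mD).
have i1 : mu.-integrable (T @^-1` setT) ((EFin \o (f \_ D)) \o T).
  by rewrite preimage_setT; move: f'i; rewrite -ef.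
have e A : measurable A -> A `<=` setT -> mu A = pushforward mu T A.
  by move=> mA _; exact: pT.
split.
  apply/itg_mkcond => //.
  have /integrableP[m1 i] := @integrable_pushforward _ _ (measurableTypeR R)
    (measurableTypeR R) R T mT mu setT (EFin \o (f \_ D)) mf' i1 measurableT.
  apply/integrableP; split => //; apply: le_lt_trans i.
  by rewrite (eq_measure_integral _ e).
rewrite integ_mkcond [RHS]integ_mkcond /integ/Rintegral; congr fine.
rewrite (eq_measure_integral _ e) (@integral_pushforward _ _ (measurableTypeR R)
    (measurableTypeR R) R T mT mu setT (EFin \o (f \_ D)) mf' i1 measurableT).
by rewrite preimage_setT -ef.
Qed.

Lemma integ_reflect D f : measurable D -> itg [set x | D (- x)] (fun x => f (- x)) ->
  measurable_fun D f ->
  itg D f /\ integ D f = integ [set x | D (- x)] (fun x => f (- x)).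
Proof.
move=> mD fi mf; apply: (@integ_preserving (-%R : measurableTypeR R -> measurableTypeR R)) => //.
move=> A mA; exact/esym/lebesgue_measureN.
Qed.

Lemma integ_translate D f c : measurable D ->
  itg [set x | D (x + c)] (fun x => f (x + c)) -> measurable_fun D f ->
  itg D f /\ integ D f = integ [set x | D (x + c)] (fun x => f (x + c)).
Proof.
move=> mD fi mf; pose T (x : measurableTypeR R) : measurableTypeR R := x + c.
have mT : measurable_fun setT T by exact: measurable_funD.
pose T' := MeasurableFun.Pack (MeasurableFun.Class (isMeasurableFun.Build _ _ _ _ _ mT)).
apply: (@integ_preserving T) => //.
(* The translated measure agrees with Lebesgue measure on half-open intervals, hence everywhere. *)
apply: (@lebesgue_measure_unique R (pushforward mu T')) => //= _ [[a b]] _ <-.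
rewrite /pushforward (_ : T @^-1` _ = `]a - c, b - c]%classic); last first.
  by apply/seteqP; split => x /=; rewrite /T !in_itv/=; lra.
rewrite !lebesgue_measure_itv/= !lte_fin ltrD2r; case: ifP => // _.
by rewrite -!EFinB; congr _%:E; ring.
Qed.

Lemma integ_sq_eq0 (a b : R) f : a < b -> {within `[a, b], continuous f} ->
  integ `[a, b] (fun x => f x ^+ 2) = 0 -> forall x, a <= x <= b -> f x = 0.
Proof.
move=> ab cf f0 x abx; apply/eqP/negP => /negP fx0.
pose e := `|f x| / 2; have e0 : 0 < e by rewrite divr_gt0// normr_gt0.
have if2 : itg `[a, b] (fun x => f x ^+ 2).
  rewrite (_ : (fun x => _) = (fun x => f x * f x)); last first.
    by apply/funext => y; rewrite expr2.
  apply: cont_itg => y; by apply: (@cvgM _ _ (nbhs (y : subspace `[a, b]%classic))); exact: cf.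
have : \forall y \near within `[a, b]%classic (nbhs x), `|f x - f y| < e.
  move/subspace_continuousP : cf => /(_ x); rewrite segP => /(_ abx).
  by move/cvgrPdist_lt => /(_ e e0).
rewrite near_withinE => -[d /= d0 hd].
pose c1 := Num.max a (x - d / 2); pose c2 := Num.min b (x + d / 2).
have d2 : 0 < d / 2 by rewrite divr_gt0.
have c12 : c1 < c2 by rewrite /c1 /c2 gt_max !lt_min; lra.
have ac1 : a <= c1 by rewrite le_max lexx.
have bc2 : c2 <= b by rewrite ge_min lexx.
have xc1 : x - d / 2 <= c1 by rewrite le_max lexx orbT.
have xc2 : c2 <= x + d / 2 by rewrite ge_min lexx orbT.
have sub : `[c1, c2]%classic `<=` `[a, b]%classic.
  by move=> y /segP ?; apply/segP; lra.
have : integ `[c1, c2] (fun=> e ^+ 2) <= integ `[a, b] (fun x => f x ^+ 2).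
  apply: (@le_trans _ _ (integ `[c1, c2] (fun x => f x ^+ 2))); last first.
    by apply: le_integS => // y _; exact: sqr_ge0.
  apply: le_integ => //.
  - by apply: continuous_itg; exact: cst_continuous.
  - exact: itgS if2.
  move=> y c12y; have h : `|f x - f y| < e.
    apply: hd; last exact: sub.
    move/segP : c12y => ?; rewrite /ball/= ltr_norml; apply/andP; split; lra.
  rewrite -[f y ^+ 2]real_normK ?num_real// ler_pXn2r ?nnegrE// ?(ltW e0)//.
  have : `|f x| - `|f y| <= `|f x - f y| by exact: lerB_dist.
  by rewrite /e in h *; lra.
rewrite f0 integ_cst; last exact: ltW.
move=> h.
have : 0 < e ^+ 2 * (c2 - c1) by rewrite mulr_gt0 ?exprn_gt0// subr_gt0.
by move: h; lra.
Qed.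

(** Rules out isolated points, where a vanishing integral would say nothing about the value of the
    function. *)
Definition fat I := forall x : R, I x -> exists a b : R, a < b /\
  `[a, b]%classic `<=` I /\ a <= x <= b.

Lemma integ_sq_eq0_fat I f f1 : fat I -> measurable I -> prim I f f1 ->
  itg I (fun x => f x ^+ 2) -> integ I (fun x => f x ^+ 2) = 0 ->
  forall x, I x -> f x = 0.
Proof.
move=> fI mI p fi f0 x Ix; have [a [b [ab [sub abx]]]] := fI x Ix.
apply: (integ_sq_eq0 ab) abx.
  by apply: prim_cont_seg (primS sub p); exact: ltW.
apply/eqP; rewrite eq_le integ_ge0 ?andbT; last by move=> *; exact: sqr_ge0.
by rewrite -f0; apply: le_integS => // y _; exact: sqr_ge0.
Qed.

Lemma fat_hl (s : R) : fat (halfline s).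
Proof.
move=> x xs; exists (x - 1), s; rewrite /halfline/= in xs; split; first lra.
by split; [exact: seg_hl|lra].
Qed.

Lemma fatT : fat [set: R].
Proof. by move=> x _; exists (x - 1), (x + 1); split; [lra|split => //; lra]. Qed.

Lemma fat_seg (a b : R) : a < b -> fat `[a, b]%classic.
Proof. by move=> ab x /segP ?; exists a, b; split => //; split. Qed.

(** Integrating [f''] against cubic cut-offs that vanish to second order at
    [x - 1] recovers [f x] and [f' x]. *)
Lemma local_estimate (x : R) f f1 f2 :
  prim `[x - 1, x] f f1 -> prim `[x - 1, x] f1 f2 ->
  L2 `[x - 1, x] f -> L2 `[x - 1, x] f2 ->
  f x ^+ 2 + f1 x ^+ 2 <= 144 *
   (integ `[x - 1, x] (fun t => f t ^+ 2) + integ `[x - 1, x] (fun t => f2 t ^+ 2)).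
Proof.
move=> p1 p2 l0 l2; set J : set R := `[x - 1, x]%classic.
have cJ : cvx J by exact: cvx_seg.
have mJ : measurable J by exact: mseg.
have p s : prim J (fun t => t - s) (fun=> 1).
  apply: (eq_prim cJ _ _ (primB (prim_id J) (prim_cst J s))) => // t _.
  by rewrite subr0.
pose c := x - 1.
have pX2 : prim J (fun t => (t - c) ^+ 2) (fun t => 2 * (t - c)).
  by apply: (eq_prim cJ _ _ (primM cJ (p c) (p c))) => t _; ring.
have pX3 : prim J (fun t => (t - c) ^+ 3) (fun t => 3 * (t - c) ^+ 2).
  by apply: (eq_prim cJ _ _ (primM cJ pX2 (p c))) => t _; ring.
have key a b (X := fun t => a * (t - c) ^+ 2 + b * (t - c) ^+ 3)
    (X1 := fun t => 2 * a * (t - c) + 3 * b * (t - c) ^+ 2)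
    (X2 := fun t => 2 * a + 6 * b * (t - c)) :
    (forall s, 0 <= s <= 1 -> `|a * s ^+ 2 + b * s ^+ 3| <= 1 /\
       `|2 * a + 6 * b * s| <= 6) ->
    ((a + b) * f1 x - (2 * a + 3 * b) * f x) ^+ 2 <=
    2 * integ J (fun t => f2 t ^+ 2) + 72 * integ J (fun t => f t ^+ 2).
  move=> hab.
  have pX : prim J X X1.
    by apply: (eq_prim cJ _ _ (primD (primZ a pX2) (primZ b pX3))) => t _;
      rewrite /X/X1; ring.
  have pX1 : prim J X1 X2.
    by apply: (eq_prim cJ _ _ (primD (primZ (2 * a) (p c)) (primZ (3 * b) pX2))) => t _;
      rewrite /X2/X1; ring.
  have pp : prim J (fun t => X t * f1 t - X1 t * f t)
     (fun t => X t * f2 t - X2 t * f t).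
    by apply: (eq_prim cJ _ _ (primB (primM cJ pX p2) (primM cJ pX1 p1))) => t _; ring.
  have Jx : J x by apply/segP; lra.
  have Jc : J c by apply/segP; rewrite /c; lra.
  have cx : c <= x by rewrite /c; lra.
  have [gi e] := pp c x Jc Jx cx.
  set g := (fun t => _ - _) in gi e.
  have -> : (a + b) * f1 x - (2 * a + 3 * b) * f x = integ J g.
    by rewrite -e /X /X1 /c; ring.
  have gb t : J t -> g t ^+ 2 <= 2 * f2 t ^+ 2 + 72 * f t ^+ 2.
    move=> /segP Jt; have [|h1 h2] := hab (t - c); first by rewrite /c; lra.
    have : `|g t| <= `|f2 t| + 6 * `|f t|.
      rewrite /g /X /X2; apply: le_trans (ler_normB _ _) _; rewrite !normrM.
      apply: lerD; last exact: ler_wpM2r.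
      by rewrite -[leRHS]mul1r; exact: ler_wpM2r.
    move=> h.
    have hu : `|g t| ^+ 2 <= (`|f2 t| + 6 * `|f t|) ^+ 2.
      by rewrite ler_pXn2r ?nnegrE ?addr_ge0 ?mulr_ge0.
    have hv := sqr_ge0 (`|f2 t| - 6 * `|f t|).
    rewrite -[g t ^+ 2]real_normK ?num_real// -[f2 t ^+ 2]real_normK ?num_real//.
    by rewrite -[f t ^+ 2]real_normK ?num_real//; nra.
  have mg : measurable_fun J g by exact: itg_meas gi.
  have i2 : itg J (fun t => 2 * f2 t ^+ 2 + 72 * f t ^+ 2).
    by apply: itgD => //; apply: itgZ => //; [case: l2|case: l0].
  have l2g : L2 J g.
    split=> //; apply: itg_le i2 => //; first exact: measurable_funX.
    by move=> t Jt; rewrite ger0_norm ?sqr_ge0// gb.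
  have l21 : L2 J (fun=> 1) by apply: continuous_L2; exact: cst_continuous.
  have := cauchy_schwarz (mseg c x) l2g l21.
  rewrite (_ : integ _ (fun t => g t * 1) = integ J g); last first.
    by apply: eq_integ => t _; rewrite mulr1.
  rewrite (_ : integ _ (fun=> 1 ^+ 2) = 1); last first.
    by rewrite integ_cst// expr1n mul1r /c; ring.
  rewrite mulr1 => /le_trans; apply.
  rewrite -!integZ//; [|by case: l0|by case: l2].
  rewrite -integD//; [|by apply: itgZ => //; case: l2|by apply: itgZ => //; case: l0].
  by apply: le_integ => //; case: l2g.
(* [3 s^2 - 2 s^3] has value 1 and slope 0 at [s = 1], so it isolates [f1 x]; [s^3 - s^2] has value
   0 and slope 1 there, so it isolates [- f x]. Both are bounded by 1 and their second derivatives
   by 6, whence [72 = 2 * 6 ^ 2]. *)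
have k1 := key 3 (-2); have k2 := key (-1) 1.
have A0 : 0 <= integ J (fun t => f2 t ^+ 2) by apply: integ_ge0 => *; exact: sqr_ge0.
have B0 : 0 <= integ J (fun t => f t ^+ 2) by apply: integ_ge0 => *; exact: sqr_ge0.
have {}k1 : f1 x ^+ 2 <= 2 * integ J (fun t => f2 t ^+ 2) + 72 * integ J (fun t => f t ^+ 2).
  have -> : f1 x = (3 + -2) * f1 x - (2 * 3 + 3 * -2) * f x by ring.
  apply: k1 => s /andP[s0 s1].
  have h1 : 0 <= s ^+ 2 * (3 - 2 * s) by rewrite mulr_ge0 ?sqr_ge0//; lra.
  have h2 : 0 <= (1 - s) ^+ 2 * (1 + 2 * s) by rewrite mulr_ge0 ?sqr_ge0//; lra.
  by split; rewrite ler_norml; apply/andP; split; nra.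
have {}k2 : f x ^+ 2 <= 2 * integ J (fun t => f2 t ^+ 2) + 72 * integ J (fun t => f t ^+ 2).
  have -> : f x ^+ 2 = ((-1 + 1) * f1 x - (2 * -1 + 3 * 1) * f x) ^+ 2 by ring.
  apply: k2 => s /andP[s0 s1].
  have h1 : 0 <= s ^+ 2 * (1 - s) by rewrite mulr_ge0 ?sqr_ge0//; lra.
  have h2 : 0 <= s * (1 - s) by rewrite mulr_ge0//; lra.
  by split; rewrite ler_norml; apply/andP; split; nra.
by lra.
Qed.

(** By [local_estimate] on [[x - 1, x]], whose right-hand side is controlled by the tails of two
    convergent integrals. *)
Lemma vanl_L2 (s : R) f f1 f2 : prim (halfline s) f f1 -> prim (halfline s) f1 f2 ->
  L2 (halfline s) f -> L2 (halfline s) f2 -> vanl f /\ vanl f1.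
Proof.
move=> p1 p2 l0 l2.
have key e : 0 < e -> exists A, forall x, x <= A -> f x ^+ 2 + f1 x ^+ 2 <= e ^+ 2.
  (* Each of the two tails may use half of [e ^ 2] after the factor 144. *)
  move=> e0; have e2 : 0 < e ^+ 2 / 288 by rewrite divr_gt0// exprn_gt0.
  have [A As hA] := itg_hl_tail l0.2 (fun x _ => sqr_ge0 (f x)) e2.
  have [B Bs hB] := itg_hl_tail l2.2 (fun x _ => sqr_ge0 (f2 x)) e2.
  exists (Num.min A B) => x; rewrite le_min => /andP[xA xB].
  have sub : `[x - 1, x]%classic `<=` halfline s.
    by move=> y /segP ?; rewrite /halfline/=; lra.
  have h := local_estimate (primS sub p1) (primS sub p2)
    (L2S (mhl s) (mseg _ _) sub l0) (L2S (mhl s) (mseg _ _) sub l2).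
  apply: le_trans h _.
  have xs : halfline x `<=` halfline s by move=> y; rewrite /halfline/=; lra.
  have h1 : integ `[x - 1, x] (fun t => f t ^+ 2) <= integ (halfline x) (fun t => f t ^+ 2).
    apply: le_integS => //; first exact: seg_hl.
      by apply: itgS l0.2.
    by move=> *; exact: sqr_ge0.
  have h2 : integ `[x - 1, x] (fun t => f2 t ^+ 2) <= integ (halfline x) (fun t => f2 t ^+ 2).
    apply: le_integS => //; first exact: seg_hl.
      by apply: itgS l2.2.
    by move=> *; exact: sqr_ge0.
  by have := hA x xA; have := hB x xB; lra.
split=> e e0; have [A hA] := key e e0; exists A => x /hA h.
  by rewrite -(ler_pXn2r (_ : 0 < 2)%N) ?nnegrE ?(ltW e0)// real_normK ?num_real//; nra.
by rewrite -(ler_pXn2r (_ : 0 < 2)%N) ?nnegrE ?(ltW e0)// real_normK ?num_real//; nra.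
Qed.

Lemma prim_glue I G g (b : R) : cvx I -> I b ->
  prim (I `&` [set x | x <= b]) G g -> prim (I `&` [set x | b <= x]) G g ->
  prim I G g.
Proof.
move=> cI Ib p1 p2 x y Ix Iy xy.
have [yb|/ltW yb] := leP y b.
  by apply: p1 => //; split => //=; exact: le_trans yb.
have [bx|/ltW bx] := leP b x; first by apply: p2 => //; split => //=; exact: le_trans xy.
have [i1 e1] := p1 x b (conj Ix bx) (conj Ib (lexx b)) bx.
have [i2 e2] := p2 b y (conj Ib (lexx b)) (conj Iy yb) yb.
have i : itg `[x, y] g by exact: itg_segU i1 i2.
by split => //; rewrite (integ_segD bx yb i) -e1 -e2; ring.
Qed.

End Calculus.
#[global] Arguments prim_id {R} I.

(** * The linear equation and the quadratic form *)

Section ODE.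
Variable R : realType.
Local Notation mu := (@lebesgue_measure R).
Implicit Types (D I : set R) (f g h G H W : R -> R).

Hint Resolve mseg mhl : core.

(** The signed integral from [x0]: at least one of the two segments is empty or a point, so a single
    formula covers both sides. *)
Definition antider (x0 : R) f (x : R) : R := integ `[x0, x] f - integ `[x, x0] f.

Lemma antider0 x0 f : antider x0 f x0 = 0.
Proof. by rewrite /antider subrr. Qed.

Lemma integ_gt (a b : R) f : b < a -> integ `[a, b] f = 0.
Proof. by move=> ba; rewrite /integ set_itv_ge ?Rintegral_set0// bnd_simp -ltNge. Qed.

Lemma antider_prim x0 f : (forall a b, itg `[a, b] f) ->
  prim setT (antider x0 f) f.
Proof.
move=> fi; apply: (prim_glue (b := x0)) => //.
- move=> x y [_ /= xx] [_ /= yx] xy; split => //; rewrite /antider.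
  rewrite [integ `[x, x0] f](integ_segD xy yx (fi _ _)).
  have e z : z <= x0 -> integ `[x0, z] f = 0.
    by rewrite le_eqVlt => /predU1P[->|/integ_gt->//]; exact: integ_seg1.
  by rewrite !e//; ring.
- move=> x y [_ /= xx] [_ /= yx] xy; split => //; rewrite /antider.
  rewrite [integ `[x0, y] f](integ_segD xx xy (fi _ _)).
  have e z : x0 <= z -> integ `[z, x0] f = 0.
    by rewrite le_eqVlt => /predU1P[->|/integ_gt->//]; exact: integ_seg1.
  by rewrite !e//; ring.
Qed.

(** The weight making twofold integration a contraction. *)
Definition wt (k x0 x : R) : R := expR (k * `|x - x0|).

Lemma wt_ge1 k x0 x : 0 <= k -> 1 <= wt k x0 x.
Proof.
move=> k0; apply: le_trans (expR_ge1Dx _); rewrite lerDl.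
by rewrite mulr_ge0.
Qed.

Lemma wt_gt0 k x0 x : 0 < wt k x0 x. Proof. exact: expR_gt0. Qed.

Lemma prim_exp (a b : R) : prim setT (fun t => expR (a * (t - b)))
  (fun t => a * expR (a * (t - b))).
Proof.
have d (x : R) : is_derive x (1 : R) (fun t : R => a * (t - b)) a.
  have h := is_deriveZ a (is_deriveB (is_derive_id x (1 : R)) (is_derive_cst b x (1 : R))).
  by move: h; rewrite subr0 /GRing.scale /= mulr1.
have de x : is_derive x (1 : R) (fun t => expR (a * (t - b))) (a * expR (a * (x - b))).
  by rewrite mulrC; exact: (is_derive1_comp (is_derive_expR _) (d x)).
apply: derive_prim; first exact: cvxT.
move=> c e _ _; apply: continuous_subspaceT => x.
apply: cvgM; first exact: cvg_cst.
have /derivable1_diffP/differentiable_continuous : derivable (fun t => expR (a * (t - b))) x 1.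
  by case: (de x).
exact.
Qed.

(** The weight grows exponentially at rate [k] away from [x0], so every integration started at [x0]
    gains a factor [1 / k]. *)
Lemma prim_wt_bound (k x0 r C : R) F f : 0 < k -> prim setT F f -> F x0 = 0 ->
  (forall x, `|x - x0| <= r -> `|f x| <= C * wt k x0 x) ->
  forall x, `|x - x0| <= r -> `|F x| <= C / k * wt k x0 x.
Proof.
move=> k0 p F0 fC x xr.
have C0 : 0 <= C.
  have := fC x xr; have := normr_ge0 (f x); have := wt_gt0 k x0 x.
  by move=> w a b; rewrite -(pmulr_lge0 C w) (le_trans a).
have [xx|/ltW xx] := leP x0 x.
  have [fi e] := p x0 x I I xx.
  have [gi e2] := @primZ _ _ _ _ (C / k) (prim_exp k x0) x0 x I I xx.
  have -> : F x = integ `[x0, x] f by rewrite -e F0 subr0.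
  apply: le_trans (le_abs_integ _ fi) _ => //.
  apply: (@le_trans _ _ (integ `[x0, x] (fun t => C / k * (k * expR (k * (t - x0)))))).
    apply: le_integ => //; first exact: itg_abs.
    move=> t /segP tt; apply: le_trans (fC t _) _.
      by apply: le_trans xr; rewrite !ger0_norm ?subr_ge0; lra.
    rewrite mulrA divfK ?gt_eqF// ler_wpM2l// /wt ger0_norm ?subr_ge0//; lra.
  rewrite -e2 /wt ger0_norm ?subr_ge0// subrr mulr0 expR0 mulr1 lerBlDr lerDl.
  by rewrite divr_ge0// ltW.
have [fi e] := p x x0 I I xx.
have [gi e2] := @primZ _ _ _ _ (- (C / k)) (prim_exp (- k) x0) x x0 I I xx.
have -> : F x = - integ `[x, x0] f by rewrite -e F0; ring.
rewrite normrN; apply: le_trans (le_abs_integ _ fi) _ => //.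
apply: (@le_trans _ _ (integ `[x, x0] (fun t => - (C / k) * (- k * expR (- k * (t - x0)))))).
  apply: le_integ => //; first exact: itg_abs.
  move=> t /segP tt; apply: le_trans (fC t _) _.
    by apply: le_trans xr; rewrite !ler0_norm ?subr_le0; lra.
  rewrite mulrA mulrNN divfK ?gt_eqF// ler_wpM2l// /wt ler0_norm ?subr_le0; last lra.
  by rewrite mulrN mulNr.
have Ck : 0 <= C / k by rewrite divr_ge0// ltW.
rewrite -e2 /wt ler0_norm ?subr_le0// subrr mulr0 expR0 mulrN !mulNr mulr1.
by move: Ck; lra.
Qed.

(** The limit is the supremum of the lower bounds [y n - 2 B / 2 ^ n], each of which lies below
    every upper bound [y m + 2 B / 2 ^ m]. The factor 2 sums the geometric tail. *)
Lemma geometric_limit (y : nat -> R) (B : R) :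
  (forall n, `|y n.+1 - y n| <= B / 2 ^+ n) ->
  exists l, forall n, `|l - y n| <= 2 * B / 2 ^+ n.
Proof.
move=> h.
have p2 n : 0 < 2 ^+ n :> R by rewrite exprn_gt0.
have B0 : 0 <= B by have := le_trans (normr_ge0 _) (h 0%N); rewrite expr0 divr1.
have tel n m : `|y (n + m)%N - y n| <= 2 * B / 2 ^+ n - 2 * B / 2 ^+ (n + m).
  elim: m => [|m IH]; first by rewrite addn0 !subrr normr0.
  rewrite addnS; have -> : y (n + m).+1 - y n = (y (n + m).+1 - y (n + m)%N) + (y (n + m)%N - y n) by ring.
  apply: le_trans (ler_normD _ _) _; have := h (n + m)%N.
  have -> : 2 * B / 2 ^+ (n + m).+1 = B / 2 ^+ (n + m).
    by rewrite exprS; field; rewrite gt_eqF.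
  by move: IH; lra.
pose S := [set y n - 2 * B / 2 ^+ n | n in [set: nat]].
have q n : 0 <= 2 * B / 2 ^+ n by rewrite divr_ge0 ?mulr_ge0// ltW.
have cross n m : y n - 2 * B / 2 ^+ n <= y m + 2 * B / 2 ^+ m.
  have [nm|/ltnW nm] := leqP n m.
    have := tel n (m - n)%N; rewrite subnKC// ler_norml => /andP[]; have := q m; lra.
  have := tel m (n - m)%N; rewrite subnKC// ler_norml => /andP[_]; have := q n; lra.
have S0 : S !=set0 by exists (y 0%N - 2 * B / 2 ^+ 0); exists 0%N.
have ubS m : ubound S (y m + 2 * B / 2 ^+ m) by move=> _ [n _ <-].
exists (sup S) => n; rewrite ler_norml; apply/andP; split.
  have : y n - 2 * B / 2 ^+ n <= sup S.
    by apply: ub_le_sup; [exists (y 0%N + 2 * B / 2 ^+ 0)|exists n].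
  lra.
have : sup S <= y n + 2 * B / 2 ^+ n by exact: ge_sup.
lra.
Qed.

Variables (W : R -> R) (M : R).
Hypothesis cW : continuous W.
Hypothesis WM : forall x, `|W x| <= M.

(** [fsol g u]: [u 0] solves [u'''' + 2 u'' + (1 + W) u = - g], and [u k] is its
    [k]-th derivative. *)
Definition fsol (g : R -> R) (u : nat -> R -> R) : Prop :=
  (forall k, (k < 4)%N -> prim setT (u k) (u k.+1)) /\
  (forall x, u 4%N x = - 2 * u 2%N x - (1 + W x) * u 0%N x - g x).

Lemma M_ge0 : 0 <= M. Proof. exact: le_trans (normr_ge0 _) (WM 0). Qed.

(** Chosen so that a Picard step, made of four integrations with coefficients bounded by 2 and
    [1 + M], halves the weighted bound. *)
Let kap := 2 * (3 + M).

Let kap_gt0 : 0 < kap. Proof. by have := M_ge0; rewrite /kap; lra. Qed.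

Let kap_half (C : R) : 0 <= C -> (2 * C + (1 + M) * C / kap / kap) / kap / kap <= C / 2.
Proof.
move=> C0; have M0 := M_ge0.
have k6 : 6 <= kap by rewrite /kap; lra.
have -> : C / 2 = C * (3 + M) / kap.
  by rewrite /kap; field; rewrite gt_eqF//; lra.
rewrite ler_pM2r ?invr_gt0// ler_pdivrMr//.
have h : (1 + M) * C / kap / kap <= (1 + M) * C.
  rewrite -mulrA ler_piMr ?mulr_ge0//; first by lra.
  by rewrite -invfM invf_le1; nra.
apply: (@le_trans _ _ (C * (3 + M))); first by lra.
rewrite ler_peMr ?mulr_ge0//; lra.
Qed.

(* one Picard step, on the difference of two iterates *)
Let contract (x0 r C : R) (y u h u1 h1 : R -> R) :
  (forall x, `|x - x0| <= r -> `|y x| <= C * wt kap x0 x) -> 0 <= C ->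
  prim setT h h1 -> h x0 = 0 -> prim setT h1 (fun x => (1 + W x) * y x) -> h1 x0 = 0 ->
  prim setT u u1 -> u x0 = 0 -> prim setT u1 (fun x => - 2 * y x - h x) -> u1 x0 = 0 ->
  forall x, `|x - x0| <= r -> `|u x| <= C / 2 * wt kap x0 x.
Proof.
move=> yC C0 ph h0 ph1 h10 pu u0 pu1 u10 x xr; have M0 := M_ge0.
have b1 z : `|z - x0| <= r -> `|(1 + W z) * y z| <= ((1 + M) * C) * wt kap x0 z.
  move=> zr; rewrite normrM -mulrA ler_pM ?yC//.
  by apply: le_trans (ler_normD _ _) _; rewrite normr1 lerD2l.
have b2 := prim_wt_bound kap_gt0 ph1 h10 b1.
have b3 := prim_wt_bound kap_gt0 ph h0 b2.
have b4 z : `|z - x0| <= r -> `|- 2 * y z - h z| <= (2 * C + (1 + M) * C / kap / kap) * wt kap x0 z.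
  move=> zr; apply: le_trans (ler_normB _ _) _; rewrite mulrDl lerD ?b3//.
  have := yC z zr; rewrite !ler_norml => /andP[? ?]; apply/andP; split; lra.
have b5 := prim_wt_bound kap_gt0 pu1 u10 b4.
have b6 := prim_wt_bound kap_gt0 pu u0 b5.
by apply: le_trans (b6 x xr) _; rewrite ler_wpM2r ?kap_half// ltW// wt_gt0.
Qed.

Lemma fsol_cont g u k : fsol g u -> (k < 4)%N -> continuous (u k).
Proof. by move=> [p _] /p; exact: prim_continuous. Qed.

Let small (e B : R) : 0 < e -> 0 <= B -> exists n : nat, B / 2 ^+ n <= e.
Proof.
move=> e0 B0; have [n hn] := nat_above (B / e); exists n.
rewrite ler_pdivrMr ?exprn_gt0// mulrC -ler_pdivrMr//; apply: le_trans hn _.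
by rewrite -natrX ler_nat ltnW// ltn_expl.
Qed.

(** With [h = - (u'' + 2 u)] the homogeneous equation becomes the pair [h'' = (1 + W) u],
    [u'' = - 2 u - h]. With zero data at [x0], [u] is its own Picard image, so [contract] halves its
    bound indefinitely. *)
Lemma fsol_unique u x0 : fsol (fun=> 0) u -> (forall k, (k < 4)%N -> u k x0 = 0) ->
  forall k x, (k < 5)%N -> u k x = 0.
Proof.
move=> s u0; have [p e] := s.
have key : forall x, u 0%N x = 0.
  move=> x; pose r : R := `|x - x0|.
  have rr : x0 - r <= x0 + r by have := normr_ge0 (x - x0); rewrite /r; lra.
  have [B0 hB] := prim_bdd_seg rr (primS (@subsetT _ _) (p 0%N isT)).
  pose B : R := `|B0|.
  have inr z : `|z - x0| <= r -> x0 - r <= z <= x0 + r by rewrite ler_norml; lra.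
  have bd n : forall z, `|z - x0| <= r -> `|u 0%N z| <= B / 2 ^+ n * wt kap x0 z.
    elim: n => [|n IH].
      move=> z /inr zr; rewrite expr0 divr1; apply: le_trans (hB z zr) _.
      apply: le_trans (ler_norm _) _; rewrite ler_peMr//.
      by apply: wt_ge1; exact: ltW.
    move=> z zr; rewrite exprSr invfM mulrA.
    pose h t := -1 * (u 2%N t + 2 * u 0%N t).
    pose h1 t := -1 * (u 3%N t + 2 * u 1%N t).
    have ph : prim setT h h1 by exact: primZ (primD (p 2%N isT) (primZ 2 (p 0%N isT))).
    have ph1 : prim setT h1 (fun x => (1 + W x) * u 0%N x).
      apply: (eq_prim (@cvxT R) _ _ (primZ (-1) (primD (p 3%N isT) (primZ 2 (p 1%N isT))))) => t _ //.
      by rewrite e; ring.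
    have pu1 : prim setT (u 1%N) (fun x => - 2 * u 0%N x - h x).
      by apply: (eq_prim (@cvxT R) _ _ (p 1%N isT)) => t _ //; rewrite /h; ring.
    apply: (contract IH _ ph _ ph1 _ (p 0%N isT) _ pu1 _ zr).
    - by apply: divr_ge0; [exact: normr_ge0|exact: exprn_ge0].
    - by rewrite /h !u0//; ring.
    - by rewrite /h1 !u0//; ring.
    - exact: u0.
    - exact: u0.
  apply/eqP; rewrite -normr_le0; apply/ler_addgt0Pl => eps eps0; rewrite addr0.
  have [n hn] := @small _ _ eps0 (mulr_ge0 (normr_ge0 B0) (ltW (wt_gt0 kap x0 x))).
  by apply: le_trans (bd n x (lexx _)) _; rewrite mulrAC.
have step k : (k < 4)%N -> (forall x, u k x = 0) -> continuous (u k.+1) -> forall x, u k.+1 x = 0.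
  move=> k4 uk cu x; have d := prim_derive (p k k4) cu x.
  have d0 : is_derive x (1 : R) (u k) 0.
    by rewrite (_ : u k = cst 0); [exact: is_derive_cst|apply/funext].
  by case: d => _ <-; case: d0.
have k1 := step 0%N isT key (fsol_cont (k := 1) s isT).
have k2 := step 1%N isT k1 (fsol_cont (k := 2) s isT).
have k3 := step 2%N isT k2 (fsol_cont (k := 3) s isT).
by move=> [|[|[|[|[|//]]]]] x _ //; rewrite e k2 key; ring.
Qed.

Lemma antider_continuous x0 f : continuous f -> continuous (antider x0 f).
Proof.
by move=> cf; apply: prim_continuous (antider_prim x0 _) => a b; exact: continuous_itg.
Qed.

(** The forcing term is merely square integrable, so it goes, together with the Cauchy data, into
    the explicit part [c]; the iteration then acts on continuous functions only. The fixed point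
    satisfies [u = c + T u], where [T] integrates [- 2 u - B u] twice and [B] integrates [(1 + W) u]
    twice. *)
Lemma fsol_exists g x0 (a : nat -> R) : L2 setT g ->
  exists u, fsol g u /\ forall k, (k < 4)%N -> u k x0 = a k.
Proof.
move=> g2; have M0 := M_ge0.
have gi c d : itg `[c, d] (fun x => - g x).
  have l2 := L2S (@measurableT _ R) (mseg c d) (@subsetT _ _) (L2N (@measurableT _ R) g2).
  have l1 : L2 `[c, d] (fun=> 1) by apply: continuous_L2; exact: cst_continuous.
  by apply: eq_itg (L2M (mseg c d) l2 l1) => // x _; rewrite mulr1.
(* The solution of the equation with the [u]-terms dropped. *)
pose c3 x := (a 3%N + 2 * a 1%N) + antider x0 (fun x => - g x) x.
have pc3 : prim setT c3 (fun x => - g x).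
  apply: (eq_prim (@cvxT R) _ _ (primD (prim_cst setT (a 3%N + 2 * a 1%N)) (antider_prim x0 gi))) => // x _.
  by rewrite add0r.
have cc3 := prim_continuous pc3.
have next f (b : R) : continuous f -> exists F, [/\ prim setT F f, F x0 = b & continuous F].
  move=> cf; exists (fun x => b + antider x0 f x); split.
  - apply: (eq_prim (@cvxT R) _ _ (primD (prim_cst setT b) (antider_prim x0 _))) => // [x _|c d].
      by rewrite add0r.
    exact: continuous_itg.
  - by rewrite antider0 addr0.
  - move=> x; apply: cvgD; first exact: cvg_cst.
    exact: antider_continuous.
have [c2 [pc2 c20 cc2]] := next c3 (a 2%N + 2 * a 0%N) cc3.
have [c1 [pc1 c10 cc1]] := next c2 (a 1%N) cc2.
have [c [pc c0 cc]] := next c1 (a 0%N) cc1.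
have c30 : c3 x0 = a 3%N + 2 * a 1%N by rewrite /c3 antider0 addr0.
(* the Picard operator *)
pose A (y : R -> R) := antider x0 (fun x => (1 + W x) * y x).
pose B (y : R -> R) := antider x0 (A y).
pose E (y : R -> R) := antider x0 (fun x => - 2 * y x - B y x).
pose T (y : R -> R) := antider x0 (E y).
have A0 y : A y x0 = 0 by exact: antider0.
have B0 y : B y x0 = 0 by exact: antider0.
have E0 y : E y x0 = 0 by exact: antider0.
have T0 y : T y x0 = 0 by exact: antider0.
have cWy (y : R -> R) : continuous y -> continuous (fun x => (1 + W x) * y x).
  move=> cy x; apply: cvgM; last exact: cy.
  by apply: cvgD; [exact: cvg_cst|exact: cW].
have cA (y : R -> R) : continuous y -> continuous (A y) by move=> /cWy; exact: antider_continuous.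
have cB (y : R -> R) : continuous y -> continuous (B y) by move=> /cA; exact: antider_continuous.
have cE' (y : R -> R) : continuous y -> continuous (fun x => - 2 * y x - B y x).
  move=> cy x; apply: cvgB; last exact: cB.
  by apply: cvgM; [exact: cvg_cst|exact: cy].
have cE (y : R -> R) : continuous y -> continuous (E y) by move=> /cE'; exact: antider_continuous.
have cT (y : R -> R) : continuous y -> continuous (T y) by move=> /cE; exact: antider_continuous.
have pA (y : R -> R) : continuous y -> prim setT (A y) (fun x => (1 + W x) * y x).
  by move=> cy; apply: antider_prim => *; exact/continuous_itg/cWy.
have pB (y : R -> R) : continuous y -> prim setT (B y) (A y).
  by move=> cy; apply: antider_prim => *; exact/continuous_itg/cA.
have pE (y : R -> R) : continuous y -> prim setT (E y) (fun x => - 2 * y x - B y x).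
  by move=> cy; apply: antider_prim => *; exact/continuous_itg/cE'.
have pT (y : R -> R) : continuous y -> prim setT (T y) (E y).
  by move=> cy; apply: antider_prim => *; exact/continuous_itg/cE.
clearbody A B E T.
have lip (r C : R) (y z : R -> R) : continuous y -> continuous z -> 0 <= C ->
    (forall x, `|x - x0| <= r -> `|y x - z x| <= C * wt kap x0 x) ->
    forall x, `|x - x0| <= r -> `|T y x - T z x| <= C / 2 * wt kap x0 x.
  move=> cy cz C0 yz.
  apply: (contract (u := fun x => T y x - T z x) (h := fun x => B y x - B z x)
    (u1 := fun x => E y x - E z x) (h1 := fun x => A y x - A z x) yz C0).
  - exact: primB (pB _ cy) (pB _ cz).
  - by rewrite !B0 subrr.
  - by apply: (eq_prim (@cvxT R) _ _ (primB (pA _ cy) (pA _ cz))) => x _ //; ring.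
  - by rewrite !A0 subrr.
  - exact: primB (pT _ cy) (pT _ cz).
  - by rewrite !T0 subrr.
  - by apply: (eq_prim (@cvxT R) _ _ (primB (pE _ cy) (pE _ cz))) => x _ //; ring.
  - by rewrite !E0 subrr.
pose y := fix y n : R -> R := if n is n'.+1 then (fun x => c x + T (y n') x) else c.
have y0 : y 0%N = c by [].
have yS n x : y n.+1 x = c x + T (y n) x by [].
have cy n : continuous (y n).
  elim: n => [|n IH] //= x; apply: cvgD; first exact: cc.
  exact: cT.
clearbody y.
have bnd (r : R) : exists2 C : R, 0 <= C & forall n (x : R), `|x - x0| <= r ->
    `|y n.+1 x - y n x| <= C * wt kap x0 x / 2 ^+ n.
  have [r0|r0] := leP 0 r; last first.
    by exists 0 => // n x /(le_trans (normr_ge0 _)); rewrite leNgt r0.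
  have rr : x0 - r <= x0 + r by lra.
  have [C hC] := prim_bdd_seg rr (primS (@subsetT _ _) (pT _ cc)).
  exists `|C| => // n; elim: n => [|n IH] x xr.
    rewrite expr0 divr1 yS y0 (_ : c x + T c x - c x = T c x); last by ring.
    apply: (@le_trans _ _ C); first by apply: hC; rewrite ler_norml in xr; lra.
    apply: le_trans (ler_norm _) _; rewrite ler_peMr//.
    by apply: wt_ge1; exact: ltW.
  rewrite (_ : y n.+2 x - y n.+1 x = T (y n.+1) x - T (y n) x); last by rewrite !yS; ring.
  have -> : `|C| * wt kap x0 x / 2 ^+ n.+1 = `|C| / 2 ^+ n / 2 * wt kap x0 x.
    by rewrite exprS; field; rewrite gt_eqF ?exprn_gt0.
  apply: (lip r) => // z zr; rewrite mulrAC; exact: IH.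

(* The limit has to serve all windows [r] at once: limits obtained with two different constants are
   approached by the same sequence, hence equal. *)
have [u hu] : {u : R -> R | forall (r C : R), 0 <= C -> (forall n (x : R), `|x - x0| <= r ->
    `|y n.+1 x - y n x| <= C * wt kap x0 x / 2 ^+ n) ->
    forall n (x : R), `|x - x0| <= r -> `|u x - y n x| <= 2 * C * wt kap x0 x / 2 ^+ n}.
  apply: cid.
  have lim (x : R) : exists l : R, forall C : R, (forall n, `|y n.+1 x - y n x| <= C / 2 ^+ n) ->
      forall n, `|l - y n x| <= 2 * C / 2 ^+ n.
    have [C0 C00 hC0] := bnd `|x - x0|.
    have h0 n := hC0 n x (lexx _).
    have [l hl] := geometric_limit h0.
    exists l => C hC n; have [l' hl'] := geometric_limit hC.
    suff -> : l = l' by [].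
    apply/eqP; rewrite -subr_eq0 -normr_le0; apply/ler_addgt0Pl => eps eps0; rewrite addr0.
    pose D := C0 * wt kap x0 x.
    have D0 : 0 <= D by rewrite mulr_ge0// ltW// wt_gt0.
    have C0' : 0 <= C by have := le_trans (normr_ge0 _) (hC 0%N); rewrite expr0 divr1.
    have [|k hk] := @small _ _ eps0 (_ : 0 <= 2 * D + 2 * C); first by lra.
    apply: le_trans hk; rewrite (_ : l - l' = (l - y k x) - (l' - y k x)); last by ring.
    by apply: le_trans (ler_normB _ _) _; rewrite mulrDl lerD// hl'.
  exists (fun x => sval (cid (lim x))) => r C C0 h n x xr; case: cid => l /= hl.
  by rewrite -(mulrA 2 C); apply: hl => k; exact: h.
have cu : continuous u.
  move=> x; apply/cvgrPdist_le => eps eps0.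
  pose r := `|x - x0| + 1.
  have [C C0 hC] := bnd r.
  pose wr := expR (kap * r).
  have wtr z : `|z - x0| <= r -> wt kap x0 z <= wr by move=> zr; rewrite ler_expR ler_wpM2l// ltW.
  have wr0 : 0 < wr by exact: expR_gt0.
  have e3 : 0 < eps / 3 by rewrite divr_gt0.
  have Cw : 0 <= 2 * C * wr by rewrite !mulr_ge0// ltW.
  have [n hn] := small e3 Cw.
  have b z : `|z - x0| <= r -> `|u z - y n z| <= eps / 3.
    move=> zr; apply: le_trans (hu _ _ C0 hC n z zr) _; apply: le_trans hn.
    by rewrite ler_wpM2r ?invr_ge0 ?exprn_ge0// ler_wpM2l ?mulr_ge0// wtr.
  have := cy n x => /cvgrPdist_le/(_ (eps / 3)); rewrite divr_gt0// => /(_ isT) hy.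
  near=> z.
  have xz : `|x - z| <= 1 by near: z; apply: cvgr_dist_le => //; exact: cvg_id.
  have h1 : `|u x - y n x| <= eps / 3 by apply: b; rewrite /r lerDl.
  have h2 : `|u z - y n z| <= eps / 3.
    apply: b; rewrite /r (_ : z - x0 = (x - x0) - (x - z)); last by ring.
    by apply: le_trans (ler_normB _ _) _; rewrite lerD2l.
  have h3 : `|y n x - y n z| <= eps / 3 by near: z.
  rewrite (_ : u x - u z = (u x - y n x) + (y n x - y n z) - (u z - y n z)); last by ring.
  apply: le_trans (ler_normB _ _) _; have := ler_normD (u x - y n x) (y n x - y n z); lra.
have fixu x : u x = c x + T u x.
  apply/eqP; rewrite -subr_eq0 -normr_le0; apply/ler_addgt0Pl => eps eps0; rewrite addr0.
  have [C C0 hC] := bnd `|x - x0|.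
  have w0 := ltW (wt_gt0 kap x0 x).
  have [|n hn] := @small _ _ eps0 (_ : 0 <= 2 * C * wt kap x0 x); first by rewrite !mulr_ge0.
  apply: le_trans hn.
  rewrite (_ : u x - _ = (u x - y n.+1 x) + (T (y n) x - T u x)); last by rewrite yS; ring.
  apply: le_trans (ler_normD _ _) _.
  have h1 := hu _ _ C0 hC n.+1 x (lexx _).
  have h2 : `|T (y n) x - T u x| <= 2 * C / 2 ^+ n / 2 * wt kap x0 x.
    apply: (lip `|x - x0|) => //; first by rewrite divr_ge0 ?mulr_ge0// exprn_ge0.
    move=> z zr; rewrite distrC; apply: le_trans (hu _ _ C0 hC n z zr) _.
    by rewrite mulrAC.
  apply: le_trans (lerD h1 h2) _; rewrite le_eqVlt; apply/orP; left; apply/eqP.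
  by rewrite exprS; field; rewrite gt_eqF ?exprn_gt0.
(* The derivatives are read off from the integrated equations; the last branch imposes the
   differential equation itself, and there [g] enters pointwise. *)
exists (fun k => match k with
  | 0%N => u | 1%N => fun x => c1 x + E u x
  | 2%N => fun x => c2 x + (- 2 * u x - B u x)
  | 3%N => fun x => c3 x - 2 * (c1 x + E u x) - A u x
  | _ => fun x => - 2 * (c2 x + (- 2 * u x - B u x)) - (1 + W x) * u x - g x end).
have pu : prim setT u (fun x => c1 x + E u x).
  by apply: (eq_prim (@cvxT R) _ _ (primD pc (pT _ cu))) => x _ //; exact/esym/fixu.
have pu1 : prim setT (fun x => c1 x + E u x) (fun x => c2 x + (- 2 * u x - B u x)).
  exact: primD pc1 (pE _ cu).
split; [split => //|].
- move=> [|[|[|[|//]]]] _ //=.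
    have p := primB (primD pc2 (primZ (-2) pu)) (pB _ cu).
    by apply: (eq_prim (@cvxT R) _ _ p) => x _; ring.
  have p := primB (primB pc3 (primZ 2 pu1)) (pA _ cu).
  by apply: (eq_prim (@cvxT R) _ _ p) => x _; ring.
- have u0 : u x0 = a 0%N by rewrite fixu T0 addr0.
  move=> [|[|[|[|//]]]] _ //=; rewrite ?c10 ?c20 ?c30 ?E0 ?A0 ?B0 ?u0; ring.
Unshelve. all: by end_near. Qed.

Lemma fsol_lin g1 g2 u v c1 c2 : fsol g1 u -> fsol g2 v ->
  fsol (fun x => c1 * g1 x + c2 * g2 x) (fun k x => c1 * u k x + c2 * v k x).
Proof.
move=> [p e] [q f]; split; last by move=> x; rewrite e f; ring.
by move=> k k4; exact: primD (primZ _ (p k k4)) (primZ _ (q k k4)).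
Qed.

Lemma eq_fsol g1 g2 u : g1 =1 g2 -> fsol g1 u -> fsol g2 u.
Proof. by move=> g12 [p e]; split => // x; rewrite e g12. Qed.

End ODE.

(** * The quadratic form, its boundary terms and the decay of solutions *)

Section Form.
Variable R : realType.
Local Notation mu := (@lebesgue_measure R).
Implicit Types (D I : set R) (f g h : R -> R) (u v w : nat -> R -> R).

Hint Resolve mseg mhl : core.

Definition lin2 (a b : R) u v : nat -> R -> R := fun k x => a * u k x + b * v k x.

Definition comb (n : nat) (c : 'I_n -> R) (u : 'I_n -> nat -> R -> R) : nat -> R -> R :=
  fun k x => \sum_(i < n) c i * u i k x.

Definition H2on I u : Prop :=
  (forall k, (k < 3)%N -> L2 I (u k)) /\ (forall k, (k < 2)%N -> prim I (u k) (u k.+1)).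

Lemma H2on_lin I (a b : R) u v : measurable I -> H2on I u -> H2on I v -> H2on I (lin2 a b u v).
Proof.
move=> mI [lu pu] [lv pv]; split => k k3.
  by apply: L2D => //; apply: L2Z => //; [exact: lu|exact: lv].
by apply: primD; apply: primZ; [exact: pu|exact: pv].
Qed.

Lemma eq_H2on I u v : measurable I -> cvx I ->
  (forall k x, (k < 3)%N -> I x -> u k x = v k x) -> H2on I u -> H2on I v.
Proof.
move=> mI cI uv [lu pu]; split => k k3.
  by apply: eq_L2 (lu k k3) => // x; exact: uv.
apply: eq_prim (pu k k3) => // x Ix; apply: uv => //.
by rewrite (leq_trans k3).
Qed.

Lemma L2_sum D (T : Type) (s : seq T) (F : T -> R -> R) : measurable D ->
  (forall i, L2 D (F i)) -> L2 D (fun x => \sum_(i <- s) F i x).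
Proof.
move=> mD Fi; elim: s => [|a s IH].
  by apply: (eq_L2 mD _ (L20 mD)) => x _; rewrite big_nil.
by apply: (eq_L2 mD _ (L2D mD (Fi a) IH)) => x _; rewrite big_cons.
Qed.

Lemma H2on_comb I n (c : 'I_n -> R) (u : 'I_n -> nat -> R -> R) : measurable I ->
  (forall i, H2on I (u i)) -> H2on I (comb c u).
Proof.
move=> mI hu; split => k k3.
  by apply: L2_sum => // i; apply: L2Z => //; apply: (hu i).1.
by apply: (@prim_sum _ _ _ _ (fun i x => c i * u i k x)) => i; apply: primZ; exact: (hu i).2.
Qed.

Lemma H2onS I J u : measurable I -> measurable J -> J `<=` I -> H2on I u -> H2on J u.
Proof.
move=> mI mJ JI [lu pu]; split => k k3; first exact: L2S (lu k k3).
exact: primS (pu k k3).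
Qed.

Definition ip I u v : R := integ I (fun x => u 0%N x * v 0%N x).

Variables (W : R -> R) (M : R).
Hypothesis cW : continuous W.
Hypothesis WM : forall x, `|W x| <= M.

(** The form of [- L], where [W] stands for [- f'(phi)] plus a spectral shift. *)
Definition bf I u v : R := integ I (fun x =>
  (u 2%N x + u 0%N x) * (v 2%N x + v 0%N x) + W x * (u 0%N x * v 0%N x)).

Lemma W_L2 I f : measurable I -> L2 I f -> L2 I (fun x => W x * f x).
Proof.
move=> mI; apply: (L2_bdd mI (M := M)) => //.
by apply: measurable_funS (continuous_measurable_fun cW).
Qed.

Lemma bf_itg I u v : measurable I -> H2on I u -> H2on I v ->
  itg I (fun x => (u 2%N x + u 0%N x) * (v 2%N x + v 0%N x) + W x * (u 0%N x * v 0%N x)).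
Proof.
move=> mI [lu _] [lv _]; apply: itgD => //.
  by apply: L2M => //; apply: L2D => //; [exact: lu|exact: lu|exact: lv|exact: lv].
apply: eq_itg (L2M mI (W_L2 mI (lu 0%N isT)) (lv 0%N isT)) => // x _.
by rewrite mulrA.
Qed.

Lemma ip_itg I u v : measurable I -> H2on I u -> H2on I v ->
  itg I (fun x => u 0%N x * v 0%N x).
Proof. by move=> mI [lu _] [lv _]; apply: L2M => //; [exact: lu|exact: lv]. Qed.

Lemma bfC I u v : bf I u v = bf I v u.
Proof. by apply: eq_integ => x _; ring. Qed.

Lemma ipC I u v : ip I u v = ip I v u.
Proof. by apply: eq_integ => x _; ring. Qed.

Lemma bf_lin I (a b : R) u v w : measurable I -> H2on I u -> H2on I v -> H2on I w ->
  bf I (lin2 a b u v) w = a * bf I u w + b * bf I v w.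
Proof.
move=> mI hu hv hw.
rewrite /bf -!integZ//; [|exact: bf_itg|exact: bf_itg].
rewrite -integD//; [|by apply: itgZ => //; exact: bf_itg|by apply: itgZ => //; exact: bf_itg].
by apply: eq_integ => x _; rewrite /lin2; ring.
Qed.

Lemma ip_lin I (a b : R) u v w : measurable I -> H2on I u -> H2on I v -> H2on I w ->
  ip I (lin2 a b u v) w = a * ip I u w + b * ip I v w.
Proof.
move=> mI hu hv hw.
rewrite /ip -!integZ//; [|exact: ip_itg|exact: ip_itg].
rewrite -integD//; [|by apply: itgZ => //; exact: ip_itg|by apply: itgZ => //; exact: ip_itg].
by apply: eq_integ => x _; rewrite /lin2; ring.
Qed.

Lemma bf_comb I n (c : 'I_n -> R) (u : 'I_n -> nat -> R -> R) w : measurable I ->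
  (forall i, H2on I (u i)) -> H2on I w ->
  bf I (comb c u) w = \sum_(i < n) c i * bf I (u i) w.
Proof.
move=> mI hu hw; pose F i x := c i * ((u i 2%N x + u i 0%N x) * (w 2%N x + w 0%N x) + W x * (u i 0%N x * w 0%N x)).
transitivity (integ I (fun x => \sum_(i < n) F i x)).
  apply: eq_integ => x _; rewrite /comb /F -big_split /= mulr_suml.
  rewrite mulr_suml mulr_sumr -big_split /=; apply: eq_bigr => i _; ring.
rewrite integ_sum//; last by move=> i; apply: itgZ => //; exact: bf_itg.
by apply: eq_bigr => i _; rewrite integZ//; exact: bf_itg.
Qed.

Lemma ip_comb I n (c : 'I_n -> R) (u : 'I_n -> nat -> R -> R) w : measurable I ->
  (forall i, H2on I (u i)) -> H2on I w ->
  ip I (comb c u) w = \sum_(i < n) c i * ip I (u i) w.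
Proof.
move=> mI hu hw; pose F i x := c i * (u i 0%N x * w 0%N x).
transitivity (integ I (fun x => \sum_(i < n) F i x)).
  apply: eq_integ => x _; rewrite /comb /F mulr_suml.
  by apply: eq_bigr => i _; ring.
rewrite integ_sum//; last by move=> i; apply: itgZ => //; exact: ip_itg.
by apply: eq_bigr => i _; rewrite integZ//; exact: ip_itg.
Qed.

Lemma eq_bf I u u' v v' : (forall k x, (k < 3)%N -> I x -> u k x = u' k x) ->
  (forall k x, (k < 3)%N -> I x -> v k x = v' k x) -> bf I u v = bf I u' v'.
Proof. by move=> e f; apply: eq_integ => x Ix; rewrite !e// !f. Qed.

Lemma eq_ip I u u' v v' : (forall x, I x -> u 0%N x = u' 0%N x) ->
  (forall x, I x -> v 0%N x = v' 0%N x) -> ip I u v = ip I u' v'.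
Proof. by move=> e f; apply: eq_integ => x Ix; rewrite !e// !f. Qed.

Lemma ip_ge0 I u : 0 <= ip I u u.
Proof. by apply: integ_ge0 => x _; rewrite -expr2 sqr_ge0. Qed.

Lemma ip_eq0 I u : measurable I -> fat I -> H2on I u -> ip I u u = 0 ->
  forall x, I x -> u 0%N x = 0.
Proof.
move=> mI fI [lu pu] e; apply: (integ_sq_eq0_fat fI mI (pu 0%N isT) (lu 0%N isT).2).
by rewrite -e; apply: eq_integ => x _; rewrite expr2.
Qed.

Lemma mhr (s : R) : measurable [set x | s <= x].
Proof.
rewrite (_ : [set x | _] = `[s, +oo[%classic); first exact: measurable_itv.
by rewrite set_itvE.
Qed.
Hint Resolve mhr : core.

Lemma cvx_hr (s : R) : cvx [set x | s <= x].
Proof. by move=> x y z /= ? ? ?; lra. Qed.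

Lemma null_set1 (s : R) f : integ [set s] f = 0.
Proof. exact: Rintegral_set1. Qed.

Lemma integ_split I (s : R) f : measurable I -> itg I f ->
  integ I f = integ (I `&` halfline s) f + integ (I `&` [set x | s <= x]) f.
Proof.
move=> mI fi.
have m1 : measurable (I `&` halfline s) by exact: measurableI.
have m2 : measurable (I `&` [set x | s < x]).
  apply: measurableI => //; rewrite (_ : [set x | _] = `]s, +oo[%classic); first exact: measurable_itv.
  by rewrite set_itvE.
have e1 : I = (I `&` halfline s) `|` (I `&` [set x | s < x]).
  rewrite -setIUr; apply/seteqP; split => x; last by case.
  by move=> Ix; split => //; have [xs|xs] := leP x s; [left|right].
rewrite {1}e1 integU//; last 2 first.
- by rewrite -e1.
- by apply/disj_setPS => x [[_ a] [_ /=]]; rewrite /halfline/= in a; lra.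
congr (_ + _).
have m3 : measurable (I `&` [set s]) by exact: measurableI.
have e2 : I `&` [set x | s <= x] = (I `&` [set x | s < x]) `|` (I `&` [set s]).
  rewrite -setIUr; congr (_ `&` _); apply/seteqP; split => x /=.
    by rewrite le_eqVlt => /predU1P[->|]; [right|left].
  by move=> [/ltW//|->].
rewrite e2 integU//.
- have [Is|nIs] := pselect (I s).
    rewrite (_ : I `&` [set s] = [set s]) ?null_set1 ?addr0//.
    by apply/seteqP; split => x /=; [case|move=> ->].
  rewrite (_ : I `&` [set s] = set0); last first.
    by apply/seteqP; split => x //= [Ix xs]; apply: nIs; rewrite -xs.
  by rewrite (_ : integ set0 f = 0) ?addr0// /integ Rintegral_set0.
- by apply: itgS fi => //; [exact: measurableU|move=> x [[]|[]]].
- by apply/disj_setPS => x [[_ /= a] [_ /= b]]; move: a; rewrite b ltxx.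
Qed.

Lemma integ_TD (s : R) f : itg setT f ->
  integ setT f = integ (halfline s) f + integ [set x | s <= x] f.
Proof. by move=> fi; rewrite (integ_split s _ fi)// !setTI. Qed.

(** The boundary term of the integration by parts of [bf]. *)
Definition Bd u v (x : R) : R :=
  (u 2%N x + u 0%N x) * v 1%N x - (u 3%N x + u 1%N x) * v 0%N x.

Lemma Bd_prim I u v : cvx I -> (forall k, (k < 4)%N -> prim I (u k) (u k.+1)) ->
  (forall k, (k < 2)%N -> prim I (v k) (v k.+1)) ->
  prim I (Bd u v) (fun x => (u 2%N x + u 0%N x) * v 2%N x - (u 4%N x + u 2%N x) * v 0%N x).
Proof.
move=> cI pu pv.
have pw := primD (pu 2%N isT) (pu 0%N isT).
have pw1 := primD (pu 3%N isT) (pu 1%N isT).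
have p := primB (primM cI pw (pv 1%N isT)) (primM cI pw1 (pv 0%N isT)).
by apply: (eq_prim cI _ _ p) => x _; rewrite /Bd //; ring.
Qed.

Lemma fsol_bf_integrand g u v x : fsol W g u ->
  (u 2%N x + u 0%N x) * v 2%N x - (u 4%N x + u 2%N x) * v 0%N x =
  (u 2%N x + u 0%N x) * (v 2%N x + v 0%N x) + W x * (u 0%N x * v 0%N x) + g x * v 0%N x.
Proof. by move=> [_ e]; rewrite e; ring. Qed.

Lemma fsol_H2seg g u (a b : R) : fsol W g u -> H2on `[a, b] u.
Proof.
move=> s; split => k k3.
  apply: continuous_L2; apply: (fsol_cont s); exact: leq_trans k3 _.
by apply: primS (s.1 k _) => //; exact: leq_trans k3 _.
Qed.

Lemma ibp_seg g u v (a b : R) : a <= b -> L2 setT g -> fsol W g u -> H2on `[a, b] v ->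
  bf `[a, b] u v + integ `[a, b] (fun x => g x * v 0%N x) = Bd u v b - Bd u v a.
Proof.
move=> ab g2 su hv; have hu := fsol_H2seg a b su.
have p := @Bd_prim `[a, b] u v (@cvx_seg _ a b) (fun k k4 => primS (@subsetT _ _) (su.1 k k4)) hv.2.
have [//|//|//|_ ->] := p a b; try by apply/segP; lra.
have g2' : L2 `[a, b] g by apply: L2S g2.
rewrite -integD//; first by apply: eq_integ => x _; rewrite (fsol_bf_integrand _ _ su).
  exact: bf_itg.
by apply: L2M => //; apply: hv.1.
Qed.

Definition dec u := forall k, (k < 4)%N -> vanl (u k).

Lemma vanl_Bd u v : dec u -> vanl (v 0%N) -> vanl (v 1%N) -> vanl (Bd u v).
Proof.
move=> du v0 v1; apply: vanlB; apply: vanlM => //; apply: vanlD; exact: du.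
Qed.

Lemma H2on_vanl (s : R) v : H2on (halfline s) v -> vanl (v 0%N) /\ vanl (v 1%N).
Proof. by move=> [l p]; apply: (vanl_L2 (p 0%N isT) (p 1%N isT)); exact: l. Qed.

Lemma sol_L2_4 g u I : measurable I -> L2 I g -> fsol W g u -> L2 I (u 0%N) -> L2 I (u 2%N) -> L2 I (u 4%N).
Proof.
move=> mI g2 su u0 u2.
apply: (eq_L2 mI _ (L2B mI (L2B mI (L2Z (-2) mI u2) (L2D mI u0 (W_L2 mI u0))) g2)).
by move=> x _; rewrite su.2; ring.
Qed.

(** The equation puts [u''''] in L2 as well, so [vanl_L2] applies to [u] and to [u'']. *)
Lemma L2_dec g u (s : R) : L2 setT g -> fsol W g u -> L2 (halfline s) (u 0%N) ->
  L2 (halfline s) (u 2%N) -> dec u.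
Proof.
move=> g2 su u0 u2.
have u4 := sol_L2_4 (mhl s) (L2S (@measurableT _ R) (mhl s) (@subsetT _ _) g2) su u0 u2.
have p k : (k < 4)%N -> prim (halfline s) (u k) (u k.+1).
  by move=> k4; exact: primS (su.1 k k4).
have [v0 v1] := vanl_L2 (p 0%N isT) (p 1%N isT) u0 u2.
have [v2 v3] := vanl_L2 (p 2%N isT) (p 3%N isT) u2 u4.
by move=> [|[|[|[|//]]]].
Qed.

(** By parts, the integral of [f1 ^ 2] equals boundary terms minus the integral of [f f2]; the
    boundary terms are bounded because [f] and [f1] vanish at -oo. *)
Lemma L2_interp (s : R) f f1 f2 : prim setT f f1 -> prim setT f1 f2 ->
  L2 (halfline s) f -> L2 (halfline s) f2 -> L2 (halfline s) f1.
Proof.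
move=> p1 p2 l0 l2.
have c0 := prim_continuous p1; have c1 := prim_continuous p2.
have pI (G g : R -> R) : prim setT G g -> prim (halfline s) G g by exact: primS.
have [v0 v1] := vanl_L2 (pI _ _ p1) (pI _ _ p2) l0 l2.
have mf1 : measurable_fun (halfline s) f1.
  by apply: measurable_funS (continuous_measurable_fun c1).
have v01 := vanlM v0 v1.
have i02 := L2M (mhl s) l0 l2.
split => //.
have [A hA] := vanl_bdd v01.
pose s' := Num.min A s.
have As' : s' <= A by rewrite ge_min lexx.
have ss' : s' <= s by rewrite ge_min lexx orbT.
have sub : halfline s' `<=` halfline s by move=> x; rewrite /halfline/=; lra.
pose C := 2 + integ (halfline s) (fun x => `|f x * f2 x|).
have f1sq (a b : R) : itg `[a, b] (fun x => f1 x ^+ 2) by apply: (continuous_L2 a b c1).2.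
have [i _] : itg (halfline s') (fun x => f1 x ^+ 2) /\ integ (halfline s') (fun x => f1 x ^+ 2) <= C.
  apply: itg_hl_bdd.
  - by apply: measurable_funX; apply: (measurable_funS (mhl s)) mf1.
  - by move=> x _; exact: sqr_ge0.
  move=> x xs; split => //.
  have pp := primM (@cvxT R) p1 p2.
  have [gi e] := pp x s' I I xs.
  have i2 : itg `[x, s'] (fun t => f t * f2 t).
    by apply: itgS i02 => //; apply: subset_trans sub; exact: seg_hl.
  have -> : integ `[x, s'] (fun t => f1 t ^+ 2) =
      (f s' * f1 s' - f x * f1 x) - integ `[x, s'] (fun t => f t * f2 t).
    by rewrite e -integB//; apply: eq_integ => t _; ring.
  have h1 : `|f s' * f1 s'| <= 1 by exact: hA.
  have h2 : `|f x * f1 x| <= 1 by apply: hA; exact: le_trans As'.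
  have h3 : `|integ `[x, s'] (fun t => f t * f2 t)| <= integ (halfline s) (fun x => `|f x * f2 x|).
    apply: le_trans (le_abs_integ _ i2) _ => //; apply: le_integS => //.
      by apply: subset_trans sub; exact: seg_hl.
    exact: itg_abs.
  rewrite /C; move: h1 h2 h3; rewrite !ler_norml => /andP[? ?] /andP[? ?] /andP[? ?]; lra.
rewrite (_ : halfline s = halfline s' `|` `[s', s]%classic); first exact: itgU.
apply/seteqP; split => x; rewrite /halfline/= ?in_itv/=.
  by move=> xs; have [h|h] := leP x s'; [left|right; lra].
by move=> []; lra.
Qed.

Lemma sol_cont4 u : fsol W (fun=> 0) u -> continuous (u 4%N).
Proof.
move=> su; rewrite (_ : u 4%N = fun x => - 2 * u 2%N x - (1 + W x) * u 0%N x); last first.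
  by apply/funext => x; rewrite su.2 subr0.
have c2 := fsol_cont (k := 2) su isT; have c0 := fsol_cont (k := 0) su isT.
move=> x; apply: cvgB; first by apply: cvgM; [exact: cvg_cst|exact: c2].
by apply: cvgM; [apply: cvgD; [exact: cvg_cst|exact: cW]|exact: c0].
Qed.

Lemma L2_hl_extend (s s' : R) f : continuous f -> L2 (halfline s) f -> L2 (halfline s') f.
Proof.
move=> cf [mf f2]; split.
  by apply: measurable_funS (continuous_measurable_fun cf).
have i : itg (halfline s `|` `[s, s']) (fun x => f x ^+ 2).
  by apply: itgU => //; exact: (continuous_L2 s s' cf).2.
apply: (itgS _ _ _ i) => //.
  exact: (measurableU _ _ (mhl s) (mseg s s')).
move=> x; rewrite /halfline/= in_itv/= => xs.
by have [h|h] := leP x s; [left|right; lra].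
Qed.

Variables (K delta : R).
Hypothesis d0 : 0 < delta.
Hypothesis Wd : forall x, x <= K -> delta <= W x.

(** Left of [K] the energy density dominates both [(u'' + u) ^ 2] and [delta u ^ 2]. *)
Lemma energy_L2 u (s C : R) : s <= K -> continuous (u 0%N) -> continuous (u 2%N) ->
  (forall x, x <= s -> bf `[x, s] u u <= C) ->
  L2 (halfline s) (u 0%N) /\ L2 (halfline s) (u 2%N).
Proof.
move=> sK c0 c2 b.
pose e x := (u 2%N x + u 0%N x) * (u 2%N x + u 0%N x) + W x * (u 0%N x * u 0%N x).
have ce : continuous e.
  move=> x; apply: cvgD; first by apply: cvgM; apply: cvgD; [exact: c2|exact: c0|exact: c2|exact: c0].
  by apply: cvgM; [exact: cW|apply: cvgM; exact: c0].
have e0 x : x <= s -> (u 2%N x + u 0%N x) ^+ 2 + delta * u 0%N x ^+ 2 <= e x.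
  by move=> xs; rewrite /e; have := Wd (le_trans xs sK); have := sqr_ge0 (u 0%N x); nra.
have ege x : x <= s -> 0 <= e x.
  move=> xs; apply: le_trans (e0 x xs).
  by rewrite addr_ge0 ?sqr_ge0// mulr_ge0 ?sqr_ge0// ltW.
have me : measurable_fun (halfline s) e by apply: measurable_funS (continuous_measurable_fun ce).
have [ie _] : itg (halfline s) e /\ integ (halfline s) e <= C.
  by apply: itg_hl_bdd => // x xs; split; [exact: continuous_itg|exact: b].
have m0 : measurable_fun (halfline s) (u 0%N) by apply: measurable_funS (continuous_measurable_fun c0).
have m2 : measurable_fun (halfline s) (u 2%N) by apply: measurable_funS (continuous_measurable_fun c2).
have l0 : L2 (halfline s) (u 0%N).
  split=> //; apply: (itg_le _ _ _ (itgZ delta^-1 _ ie)) => //; first exact: measurable_funX.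
  move=> x xs; rewrite ger0_norm ?sqr_ge0// mulrC ler_pdivlMr// mulrC.
  by apply: le_trans (e0 x xs); rewrite lerDr sqr_ge0.
have lw : L2 (halfline s) (fun x => u 2%N x + u 0%N x).
  split; first exact: measurable_funD.
  apply: (itg_le _ _ _ ie) => //; first by apply: measurable_funX; exact: measurable_funD.
  move=> x xs; rewrite ger0_norm ?sqr_ge0//.
  by apply: le_trans (e0 x xs); rewrite lerDl mulr_ge0 ?sqr_ge0// ltW.
split=> //; apply: (eq_L2 _ _ (L2B _ lw l0)) => // x _; ring.
Qed.

(** Decay comes without a rate, yet it suffices: by parts, the energy on [[x, s']] is a difference
    of two boundary terms, which are bounded near -oo. With [L2_dec] this identifies decaying
    solutions with those of finite energy. *)
Lemma dec_L2 u (s : R) : fsol W (fun=> 0) u -> dec u ->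
  forall k, (k < 5)%N -> L2 (halfline s) (u k).
Proof.
move=> su du.
have c k : (k < 5)%N -> continuous (u k).
  by rewrite ltnS leq_eqVlt => /predU1P[->|/(fsol_cont su)//]; exact: sol_cont4.
have [A hA] := vanl_bdd (vanl_Bd du (du 0%N isT) (du 1%N isT)).
pose s' := Num.min A K.
have As' : s' <= A by rewrite ge_min lexx.
have Ks' : s' <= K by rewrite ge_min lexx orbT.
have [l0 l2] : L2 (halfline s') (u 0%N) /\ L2 (halfline s') (u 2%N).
  apply: (@energy_L2 u s' 2) => //; [exact: c|exact: c|].
  move=> x xs; have := ibp_seg xs (L20 (@measurableT _ R)) su (fsol_H2seg x s' su).
  rewrite (@eq_integ _ _ _ (fun=> 0)) ?integ0 ?addr0//; last by move=> t _; rewrite mul0r.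
  move=> ->; have := hA s' As'; have := hA x (le_trans xs As').
  by rewrite !ler_norml => /andP[? ?] /andP[? ?]; lra.
have l4 := sol_L2_4 (mhl s') (L20 (mhl s')) su l0 l2.
have l1 := L2_interp (su.1 0%N isT) (su.1 1%N isT) l0 l2.
have l3 := L2_interp (su.1 2%N isT) (su.1 3%N isT) l2 l4.
by move=> [|[|[|[|[|//]]]]] _; apply: (@L2_hl_extend s') => //; exact: c.
Qed.

Lemma dec_H2 u (s : R) : fsol W (fun=> 0) u -> dec u -> H2on (halfline s) u.
Proof.
move=> su du; split => k k3; first by apply: dec_L2 => //; exact: leq_trans k3 _.
by apply: primS (su.1 k _) => //; exact: leq_trans k3 _.
Qed.

Lemma ibp_hl u v (s : R) : fsol W (fun=> 0) u -> dec u -> H2on (halfline s) v ->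
  bf (halfline s) u v = Bd u v s.
Proof.
move=> su du hv; have hu := dec_H2 s su du.
have [v0 v1] := H2on_vanl hv.
have p := @Bd_prim (halfline s) u v (@cvx_hl _ s) (fun k k4 => primS (@subsetT _ _) (su.1 k k4)) hv.2.
have e x : halfline s x -> (u 2%N x + u 0%N x) * v 2%N x - (u 4%N x + u 2%N x) * v 0%N x =
  (u 2%N x + u 0%N x) * (v 2%N x + v 0%N x) + W x * (u 0%N x * v 0%N x).
  by move=> _; rewrite (fsol_bf_integrand _ _ su) mul0r addr0.
have i := bf_itg (mhl s) hu hv.
rewrite -(integ_hl_prim p); last exact: vanl_Bd.
  by apply: eq_integ => x xs; rewrite e.
by apply: eq_itg i => // x xs; rewrite e.
Qed.

End Form.

(** * Gluing functions of class H^2 *)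

Section Glue.
Variable R : realType.
Local Notation mu := (@lebesgue_measure R).
Implicit Types (D I : set R) (f g h : R -> R) (u v w : nat -> R -> R).

Hint Resolve mseg mhl mhr : core.

Lemma itg_off1 D (s : R) f g : measurable D ->
  (forall x, D x -> x != s -> f x = g x) -> itg D f -> itg D g /\ integ D f = integ D g.
Proof.
move=> mD fg fi; have mf := itg_meas fi.
have mg : measurable_fun D g.
  apply/(measurable_restrictT _ mD).
  pose c := (g \_ D) s - (f \_ D) s.
  rewrite (_ : g \_ D = fun x => (f \_ D) x + c * \1_[set s] x).
    apply: measurable_funD; first exact/(measurable_restrictT _ mD).
    by apply: measurable_funM => //; exact: measurable_indic.
  apply/funext => x; rewrite indicE; have [->|xs] := eqVneq x s.
    by rewrite mem_set// mulr1 /c; ring.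
  rewrite memNset ?mulr0 ?addr0; last by move=> /= e; rewrite e eqxx in xs.
  by rewrite /patch; case: ifPn => // /set_mem Dx; rewrite fg.
have ae : {ae mu, forall x, D x -> f x = g x}.
  exists [set s]; split; [exact: measurable_set1|exact: lebesgue_measure_set1|].
  move=> x /= h; apply/eqP/negP => /negP xs; apply: h => Dx; exact: fg.
by split; [exact: ae_itg ae fi|exact: ae_integ].
Qed.

Lemma L2_off1 D (s : R) f g : measurable D ->
  (forall x, D x -> x != s -> f x = g x) -> L2 D f -> L2 D g.
Proof.
move=> mD fg [mf f2].
have mg : measurable_fun D g.
  apply/(measurable_restrictT _ mD).
  pose c := (g \_ D) s - (f \_ D) s.
  rewrite (_ : g \_ D = fun x => (f \_ D) x + c * \1_[set s] x).
    apply: measurable_funD; first exact/(measurable_restrictT _ mD).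
    by apply: measurable_funM => //; exact: measurable_indic.
  apply/funext => x; rewrite indicE; have [->|xs] := eqVneq x s.
    by rewrite mem_set// mulr1 /c; ring.
  rewrite memNset ?mulr0 ?addr0; last by move=> /= e; rewrite e eqxx in xs.
  by rewrite /patch; case: ifPn => // /set_mem Dx; rewrite fg.
split => //; apply: (itg_off1 (s := s) mD _ f2).1 => x Dx xs.
by rewrite fg.
Qed.

Lemma prim_off1 I (s : R) G g h : cvx I ->
  (forall x, I x -> x != s -> g x = h x) -> prim I G g -> prim I G h.
Proof.
move=> cI gh p x y Ix Iy xy; have [gi e] := p x y Ix Iy xy.
have [|hi eh] := itg_off1 (s := s) (g := h) (mseg x y) _ gi.
  by move=> z /(seg_sub cI Ix Iy); exact: gh.
by rewrite e eh.
Qed.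

Lemma L2U D E f : measurable D -> measurable E -> L2 D f -> L2 E f -> L2 (D `|` E) f.
Proof.
move=> mD mE [mf f2] [mg g2]; split; last exact: itgU.
by apply/measurable_funU.
Qed.

Definition glue (s : R) u v : nat -> R -> R := fun k x => if x <= s then u k x else v k x.

Lemma glue_le (s : R) u v k x : x <= s -> glue s u v k x = u k x.
Proof. by rewrite /glue => ->. Qed.

Lemma glue_gt (s : R) u v k x : s < x -> glue s u v k x = v k x.
Proof. by rewrite /glue leNgt => ->. Qed.

Lemma glue_ge (s : R) u v k x : u k s = v k s -> s <= x -> glue s u v k x = v k x.
Proof.
by move=> e; rewrite le_eqVlt => /predU1P[<-|/glue_gt->//]; rewrite glue_le.
Qed.

(** Only value and slope have to match at [s]: the second derivative may jump, and the value that
    [glue] takes from [u] at the point [s] itself is invisible to integrals. *)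
Lemma H2on_glue I (s : R) u v : measurable I -> cvx I -> I s ->
  H2on (I `&` halfline s) u -> H2on (I `&` [set x | s <= x]) v ->
  u 0%N s = v 0%N s -> u 1%N s = v 1%N s -> H2on I (glue s u v).
Proof.
move=> mI cI Is [lu pu] [lv pv] e0 e1.
have m1 : measurable (I `&` halfline s) by exact: measurableI.
have m2 : measurable (I `&` [set x | s <= x]) by exact: measurableI.
have c2 : cvx (I `&` [set x | s <= x]).
  move=> x y z [Ix /= sx] [Iz /= _] xyz; split; first exact: (cI x y z).
  by case/andP: xyz => xy _; exact: le_trans xy.
have c1 : cvx (I `&` halfline s).
  move=> x y z [Ix _] [Iz]; rewrite /halfline/= => zs xyz; split; first exact: (cI x y z).
  by rewrite /halfline/=; case/andP: xyz => _ yz; exact: le_trans zs.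
have e k : (k < 2)%N -> u k s = v k s by move: k => [|[|]].
split => k kk.
  have -> : I = (I `&` halfline s) `|` (I `&` [set x | s <= x]).
    rewrite -setIUr; apply/seteqP; split => x; last by case.
    move=> Ix; split => //; rewrite /halfline/=; have [|/ltW] := leP x s; [by left|by right].
  apply: L2U => //.
    by apply: eq_L2 (lu k kk) => // x [_]; rewrite /halfline/= => xs; rewrite glue_le.
  apply: (L2_off1 (s := s) _ _ (lv k kk)) => // x [_ /= sx] xs.
  by rewrite glue_gt// lt_neqAle sx eq_sym xs.
apply: (prim_glue cI Is).
  by apply: (eq_prim c1 _ _ (pu k kk)) => x [_ /=]; rewrite /halfline/= => xs; rewrite glue_le.
apply: (prim_off1 (s := s) c2 (g := v k.+1)).
  by move=> x [_ /= sx] xs; rewrite glue_gt// lt_neqAle sx eq_sym xs.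
apply: (eq_prim c2 _ _ (pv k kk)) => // x [_ /= sx].
by rewrite glue_ge// e.
Qed.

Lemma H2on0 I : measurable I -> H2on I (fun=> fun=> 0).
Proof. by move=> mI; split => k _; [exact: L20|exact: prim_cst]. Qed.

Variables (W : R -> R) (M : R).
Hypothesis cW : continuous W.
Hypothesis WM : forall x, `|W x| <= M.

Lemma bf_split I (s : R) u v : measurable I -> H2on I u -> H2on I v ->
  bf W I u v = bf W (I `&` halfline s) u v + bf W (I `&` [set x | s <= x]) u v.
Proof. by move=> mI hu hv; apply: integ_split => //; exact: (bf_itg cW WM mI hu hv). Qed.

Lemma ip_split I (s : R) u v : measurable I -> H2on I u -> H2on I v ->
  ip I u v = ip (I `&` halfline s) u v + ip (I `&` [set x | s <= x]) u v.
Proof. by move=> mI hu hv; apply: integ_split => //; exact: ip_itg. Qed.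

Lemma bf_off1 I (s : R) u u' v v' : measurable I -> H2on I u -> H2on I v ->
  (forall k x, (k < 3)%N -> I x -> x != s -> u k x = u' k x) ->
  (forall k x, (k < 3)%N -> I x -> x != s -> v k x = v' k x) ->
  bf W I u v = bf W I u' v'.
Proof.
move=> mI hu hv eu ev; apply: (itg_off1 (s := s) mI _ (bf_itg cW WM mI hu hv)).2.
by move=> x Ix xs; rewrite !eu// !ev.
Qed.

Lemma ip_off1 I (s : R) u u' v v' : measurable I -> H2on I u -> H2on I v ->
  (forall x, I x -> x != s -> u 0%N x = u' 0%N x) ->
  (forall x, I x -> x != s -> v 0%N x = v' 0%N x) ->
  ip I u v = ip I u' v'.
Proof.
move=> mI hu hv eu ev; apply: (itg_off1 (s := s) mI _ (ip_itg mI hu hv)).2.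
by move=> x Ix xs; rewrite !eu// !ev.
Qed.

End Glue.

(** * Boundary value problems on segments and half-lines *)

Section BVP.
Variable R : realType.
Local Notation mu := (@lebesgue_measure R).
Implicit Types (D I : set R) (f g h : R -> R) (u v w : nat -> R -> R).

Hint Resolve mseg mhl : core.

Lemma bolzano_weierstrass2 (a b : nat -> R) (B : R) :
  (forall n, `|a n| <= B) -> (forall n, `|b n| <= B) ->
  exists y z, forall (e : R) (n : nat), 0 < e ->
    exists m : nat, [/\ (n <= m)%N, `|a m - y| <= e & `|b m - z| <= e].
Proof.
move=> ha hb; pose A := `[- B, B]%classic `*` `[- B, B]%classic : set (R * R).
have cA : compact A by apply: compact_setX; exact: segment_compact.
pose F := (fun n => (a n, b n)) @ \oo.
have FA : F A.
  by exists 0%N => // n _; split => /=; rewrite in_itv/= -ler_norml.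
have [[y z] [_ cl]] := cA F _ FA.
exists y, z => e n e0.
have [] := cl [set p | exists2 m : nat, (n <= m)%N & p = (a m, b m)] (ball (y, z) e).
- by exists n => // m /= nm; exists m.
- exact: nbhsx_ballx.
move=> p [[m nm ->] [/= ya zb]]; exists m; split => //.
  by rewrite distrC ltW.
by rewrite distrC ltW.
Qed.

Variables (W : R -> R) (M : R).
Hypothesis cW : continuous W.
Hypothesis WM : forall x, `|W x| <= M.

Definition sol := fsol W (fun=> 0).

Lemma sol_lin (a b : R) u v : sol u -> sol v -> sol (lin2 a b u v).
Proof.
move=> su sv; apply: eq_fsol (fsol_lin a b su sv) => x.
by rewrite !mulr0 addr0.
Qed.

Lemma sol0 : sol (fun=> fun=> 0).
Proof.
split; last by move=> x; rewrite !mulr0 !subr0.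
by move=> k _; exact: prim_cst.
Qed.

Lemma sol_ext u v : (forall k x, (k < 5)%N -> u k x = v k x) -> sol u -> sol v.
Proof.
move=> uv [p e]; split; last by move=> x; rewrite -!uv.
move=> k k4; apply: eq_prim (p k k4); first exact: cvxT.
  by move=> x _; apply: uv; exact: leq_trans k4 _.
by move=> x _; exact: uv.
Qed.

Lemma sol_comb n (c : 'I_n -> R) (u : 'I_n -> nat -> R -> R) :
  (forall i, sol (u i)) -> sol (comb c u).
Proof.
move=> su; split.
  move=> k k4; apply: (@prim_sum _ _ _ _ (fun i x => c i * u i k x)) => i.
  by apply: primZ; apply: (su i).1.
move=> x; rewrite /comb subr0 !mulr_sumr -sumrB; apply: eq_bigr => i _.
by rewrite (su i).2; ring.
Qed.

Lemma sol_eq u v x0 : sol u -> sol v -> (forall k, (k < 4)%N -> u k x0 = v k x0) ->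
  forall k x, (k < 5)%N -> u k x = v k x.
Proof.
move=> su sv uv k x k5.
have s := sol_lin 1 (-1) su sv.
have /(_ _ k x k5) := fsol_unique WM (x0 := x0) s; rewrite /lin2 => h.
have : 1 * u k x + -1 * v k x = 0 by apply: h => j j4; rewrite uv//; ring.
by move=> e; apply/eqP; rewrite -subr_eq0; apply/eqP; rewrite -e; ring.
Qed.

Lemma fsol_sub g u v : fsol W g u -> fsol W g v -> sol (lin2 1 (-1) u v).
Proof.
by move=> su sv; apply: eq_fsol (fsol_lin 1 (-1) su sv) => x; ring.
Qed.

Lemma fsol_add g u v : fsol W g u -> sol v -> fsol W g (lin2 1 1 u v).
Proof.
by move=> su sv; apply: eq_fsol (fsol_lin 1 1 su sv) => x; rewrite mulr0 addr0 mul1r.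
Qed.

Lemma sol_exists x0 (a : nat -> R) :
  exists u, sol u /\ forall k, (k < 4)%N -> u k x0 = a k.
Proof. exact: (fsol_exists cW WM x0 a (L20 (@measurableT _ R))). Qed.

(** Unique continuation: all derivatives up to order three vanish on the open segment, so the Cauchy
    data at its midpoint are zero. *)
Lemma sol_zero_seg u (a b : R) : a < b -> sol u ->
  (forall x, a <= x <= b -> u 0%N x = 0) -> forall k x, (k < 5)%N -> u k x = 0.
Proof.
move=> ab su u0.
have cu k : (k < 5)%N -> continuous (u k).
  by rewrite ltnS leq_eqVlt => /predU1P[->|/(fsol_cont su)//]; exact: (sol_cont4 cW su).
have step k : (k < 4)%N -> (forall x, a < x < b -> u k x = 0) ->
    forall x, a < x < b -> u k.+1 x = 0.
  move=> k4 uk x xab; have d := prim_derive (su.1 k k4) (cu k.+1 k4) x.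
  have d0 : is_derive x (1 : R) (u k) 0.
    apply: (near_eq_is_derive (f := cst (0 : R))).
    near=> y; rewrite /= uk//; apply/andP; split; near: y.
      by apply: lt_nbhsr; case/andP: xab.
    by apply: lt_nbhsl; case/andP: xab.
  by case: d => _ <-; case: d0.
have k0 x : a < x < b -> u 0%N x = 0 by move=> /andP[/ltW ? /ltW ?]; apply: u0; apply/andP.
have k1 := step 0%N isT k0; have k2 := step 1%N isT k1; have k3 := step 2%N isT k2.
apply: (@fsol_unique _ W M WM u ((a + b) / 2)) => //.
have m : a < (a + b) / 2 < b by rewrite midf_lt// midf_lt.
by move=> [|[|[|[|//]]]] _; [exact: k0|exact: k1|exact: k2|exact: k3].
Unshelve. all: by end_near. Qed.

(** Solutions are parametrized by four data at [a] and are subject to four boundary conditions; the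
    square matrix between them is invertible once it is injective. *)
Lemma bvp (a b : R) :
  (forall u, sol u -> u 0%N a = 0 -> u 1%N a = 0 -> u 0%N b = 0 -> u 1%N b = 0 ->
     forall k x, (k < 4)%N -> u k x = 0) ->
  forall p0 p1 q0 q1 : R, exists u, [/\ sol u, u 0%N a = p0, u 1%N a = p1, u 0%N b = q0 &
    u 1%N b = q1].
Proof.
move=> inj p0 p1 q0 q1.
have [B hB] : {B : 'I_4 -> nat -> R -> R | forall j, sol (B j) /\ forall k, (k < 4)%N -> B j k a = (k == j)%:R}.
  have ex (j : 'I_4) := sol_exists a (fun k => (k == j)%:R).
  by exists (fun j => sval (cid (ex j))) => j; case: cid.
pose ev (u : nat -> R -> R) (i : 'I_4) : R :=
  nth 0 [:: u 0%N a; u 1%N a; u 0%N b; u 1%N b] i.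
pose A : 'M[R]_4 := \matrix_(j, i) ev (B j) i.
have evc (c : 'rV[R]_4) i : ev (comb (fun j => c 0 j) B) i = (c *m A) 0 i.
  rewrite mxE /ev; move: i => [[|[|[|[|//]]]] hi] /=;
    by apply: eq_bigr => j _; rewrite mxE.
have Au : A \in unitmx.
  rewrite -row_free_unit; apply: inj_row_free => c cA.
  have s := sol_comb (fun j => c 0 j) (fun j => (hB j).1).
  have z i : ev (comb (fun j => c 0 j) B) i = 0 by rewrite evc cA mxE.
  have := inj _ s (z (@Ordinal 4 0 isT)) (z (@Ordinal 4 1 isT)) (z (@Ordinal 4 2 isT)) (z (@Ordinal 4 3 isT)).
  move=> h; apply/rowP => j; rewrite mxE -(h j a (ltn_ord j)) /comb (bigD1 j)//=.
  rewrite (hB j).2// eqxx mulr1 big1 ?addr0// => i ij.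
  by rewrite (hB i).2// eq_sym (negbTE ij : (val i == val j) = false) mulr0.
pose d : 'rV[R]_4 := \row_i nth 0 [:: p0; p1; q0; q1] i.
pose c := d *m invmx A.
have e i : ev (comb (fun j => c 0 j) B) i = nth 0 [:: p0; p1; q0; q1] i.
  by rewrite evc /c mulmxKV// mxE.
exists (comb (fun j => c 0 j) B); split.
- by apply: sol_comb => j; case: (hB j).
- exact: (e (@Ordinal 4 0 isT)).
- exact: (e (@Ordinal 4 1 isT)).
- exact: (e (@Ordinal 4 2 isT)).
- exact: (e (@Ordinal 4 3 isT)).
Qed.

Lemma ibp_sol u v (a b : R) : a <= b -> sol u -> H2on `[a, b] v ->
  bf W `[a, b] u v = Bd u v b - Bd u v a.
Proof.
move=> ab su hv; rewrite -(ibp_seg cW WM ab (L20 (@measurableT _ R)) su hv).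
rewrite (@eq_integ _ _ _ (fun=> 0)) ?integ0 ?addr0// => x _.
by rewrite mul0r.
Qed.

(** By parts, a solution with zero boundary data has zero form, so coercivity leaves only the zero
    solution. *)
Lemma coercive_bvp (a b c : R) : a < b -> 0 < c ->
  (forall v, H2on `[a, b] v -> v 0%N a = 0 -> v 1%N a = 0 -> v 0%N b = 0 -> v 1%N b = 0 ->
     c * ip `[a, b] v v <= bf W `[a, b] v v) ->
  forall p0 p1 q0 q1 : R, exists u, [/\ sol u, u 0%N a = p0, u 1%N a = p1, u 0%N b = q0 &
    u 1%N b = q1].
Proof.
move=> ab c0 co; apply: bvp => u su a0 a1 b0 b1 k x k4.
have hu := fsol_H2seg a b su.
have := co u hu a0 a1 b0 b1; rewrite (ibp_sol (ltW ab) su hu) /Bd a0 a1 b0 b1 !mulr0 !subr0.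
move=> le0.
have ip0 : ip `[a, b] u u = 0.
  apply/eqP; rewrite eq_le ip_ge0 andbT.
  by rewrite -(ler_pM2l c0) mulr0.
apply: (sol_zero_seg ab su) => [y yab|]; last exact: leq_trans k4 _.
by apply: (ip_eq0 _ (fat_seg ab) hu ip0) => //; apply/segP.
Qed.

Variables (K delta : R).
Hypothesis d0 : 0 < delta.
Hypothesis Wd : forall x, x <= K -> delta <= W x.

Lemma bf_left_ge I v : measurable I -> I `<=` halfline K -> H2on I v ->
  delta * ip I v v <= bf W I v v.
Proof.
move=> mI IK hv; rewrite /ip -integZ//; last exact: ip_itg.
apply: le_integ => //; first by apply: itgZ => //; exact: ip_itg.
  exact: (bf_itg cW WM mI hv hv).
move=> x /IK; rewrite /halfline/= => xK; have := Wd xK.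
have := sqr_ge0 (v 2%N x + v 0%N x); have := sqr_ge0 (v 0%N x); nra.
Qed.

Lemma bf_left_sub I J v : measurable I -> measurable J -> J `<=` I -> I `<=` halfline K ->
  H2on I v -> bf W J v v <= bf W I v v.
Proof.
move=> mI mJ JI IK hv; apply: le_integS => //; first exact: (bf_itg cW WM mI hv hv).
move=> x /IK; rewrite /halfline/= => xK.
rewrite -!expr2 addr_ge0 ?sqr_ge0// mulr_ge0 ?sqr_ge0//.
by apply: le_trans (Wd xK); exact: ltW.
Qed.

(** The solutions clamped at [a], with prescribed data at [s], have bounded
    energy as [a --> -oo], by comparison with the one for [a = s - 1]; hence so
    have their Cauchy data at [s], and a cluster point of the latter gives a
    solution of finite energy. *)
Lemma halfline_exists g (s p0 p1 : R) : s <= K -> L2 setT g ->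
  exists u, [/\ fsol W g u, u 0%N s = p0, u 1%N s = p1,
    L2 (halfline s) (u 0%N) & L2 (halfline s) (u 2%N)].
Proof.
move=> sK g2; have M0 := M_ge0 WM.
have sub I : I `<=` halfline s -> I `<=` halfline K.
  by move=> h x /h; rewrite /halfline/=; lra.
have exa (a : R) : a < s -> exists u, [/\ fsol W g u, u 0%N a = 0, u 1%N a = 0, u 0%N s = p0 & u 1%N s = p1].
  move=> as_; have [ug [sg _]] := fsol_exists cW WM s (fun=> 0) g2.
  have [|v [sv a0 a1 b0 b1]] := @coercive_bvp a s delta as_ d0 _ (- ug 0%N a) (- ug 1%N a) (p0 - ug 0%N s) (p1 - ug 1%N s).
    by move=> v hv _ _ _ _; apply: bf_left_ge => //; apply: sub; exact: seg_hl.
  exists (lin2 1 1 ug v); split; first exact: fsol_add.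
  - by rewrite /lin2 a0; ring.
  - by rewrite /lin2 a1; ring.
  - by rewrite /lin2 b0; ring.
  - by rewrite /lin2 b1; ring.
have s1 : s - 1 < s by lra.
have [tau [st ta0 ta1 ts0 ts1]] := exa _ s1.
pose Q := 2 * bf W `[s - 1, s] tau tau + 2 * ip `[s - 1, s] tau tau +
  (4 / delta + 2) * integ setT (fun x => g x ^+ 2).
have bd (a : R) u : a <= s - 1 -> fsol W g u -> u 0%N a = 0 -> u 1%N a = 0 -> u 0%N s = p0 ->
    u 1%N s = p1 -> bf W `[a, s] u u <= Q.
  move=> aa su a0 a1 b0 b1.
  have as_ : a <= s by lra.
  pose t := glue (s - 1) (fun=> fun=> 0) tau.
  have eL : `[a, s]%classic `&` halfline (s - 1) = `[a, s - 1]%classic.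
    by apply/seteqP; split => x; rewrite /halfline/= !in_itv/=; [case|]; move=> *; try split; lra.
  have eR : `[a, s]%classic `&` [set x | s - 1 <= x] = `[s - 1, s]%classic.
    by apply/seteqP; split => x; rewrite /= !in_itv/=; [case|]; move=> *; try split; lra.
  have htau : H2on `[s - 1, s] tau by exact: fsol_H2seg st.
  have ht : H2on `[a, s] t.
    apply: H2on_glue => //; [exact: cvx_seg|by apply/segP; lra| |by rewrite eR].
    by rewrite eL; exact: H2on0.
  have hu := fsol_H2seg a s su.
  have bt : bf W `[a, s] t t = bf W `[s - 1, s] tau tau.
    rewrite (bf_split cW WM (s - 1) (mseg a s) ht ht) eL eR.
    rewrite (@eq_bf _ _ _ _ (fun=> fun=> 0) _ (fun=> fun=> 0)); last 2 first.
    - by move=> k x _ /segP h; rewrite /t glue_le//; lra.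
    - by move=> k x _ /segP h; rewrite /t glue_le//; lra.
    rewrite {1}/bf (@eq_integ _ _ _ (fun=> 0)) ?integ0 ?add0r//; last by move=> x _; ring.
    apply: (bf_off1 cW WM (s := s - 1)) => //.
    - by apply: (H2onS (mseg a s)) => // x /segP h; apply/segP; lra.
    - by apply: (H2onS (mseg a s)) => // x /segP h; apply/segP; lra.
    - move=> k x _ /segP h xs; rewrite /t glue_gt// lt_neqAle eq_sym xs; lra.
    - move=> k x _ /segP h xs; rewrite /t glue_gt// lt_neqAle eq_sym xs; lra.
  have it : ip `[a, s] t t = ip `[s - 1, s] tau tau.
    rewrite (ip_split (s - 1) (mseg a s) ht ht) eL eR.
    rewrite (@eq_ip _ _ _ (fun=> fun=> 0) _ (fun=> fun=> 0)); last 2 first.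
    - by move=> x /segP h; rewrite /t glue_le//; lra.
    - by move=> x /segP h; rewrite /t glue_le//; lra.
    rewrite {1}/ip (@eq_integ _ _ _ (fun=> 0)) ?integ0 ?add0r//; last by move=> x _; ring.
    apply: (ip_off1 (s := s - 1)) => //.
    - by apply: (H2onS (mseg a s)) => // x /segP h; apply/segP; lra.
    - by apply: (H2onS (mseg a s)) => // x /segP h; apply/segP; lra.
    - move=> x /segP h xs; rewrite /t glue_gt// lt_neqAle eq_sym xs; lra.
    - move=> x /segP h xs; rewrite /t glue_gt// lt_neqAle eq_sym xs; lra.
  pose d := lin2 1 (-1) u t.
  have hd : H2on `[a, s] d by exact: H2on_lin.
  have := ibp_seg cW WM as_ g2 su hd.
  have ta k : (k < 2)%N -> t k a = 0 by rewrite /t glue_le//; lra.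
  have ts k : (k < 2)%N -> t k s = tau k s by rewrite /t glue_gt//; lra.
  rewrite /Bd {3 4 5 6}/d /lin2 !ta// !ts// a0 a1 b0 b1 ts0 ts1.
  rewrite (_ : _ - _ = 0); last by ring.
  move=> e.
  have gs : L2 `[a, s] g by apply: L2S g2.
  have i1 := bf_itg cW WM (mseg a s) hu hd.
  have i2 : itg `[a, s] (fun x => g x * d 0%N x) by apply: L2M => //; apply: hd.1.
  have iu := bf_itg cW WM (mseg a s) hu hu.
  have itt := bf_itg cW WM (mseg a s) ht ht.
  have it2 := ip_itg (mseg a s) ht ht.
  have ig := gs.2.
  (* The difference [d] vanishes to first order at both ends, so the form of [u] against [d] plus
     the forcing integral is zero. Pointwise, the mixed term costs half of the energy densities of
     [u] and of [t], and the forcing a quarter of that of [u], by Young's inequality with weight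
     [delta / 4]. A quarter of the energy of [u] is left; multiplication by 4 gives the constants of
     [Q]. *)
  have : integ `[a, s] (fun x => 4^-1 * ((u 2%N x + u 0%N x) * (u 2%N x + u 0%N x) + W x * (u 0%N x * u 0%N x)))
     <= integ `[a, s] (fun x => ((u 2%N x + u 0%N x) * (d 2%N x + d 0%N x) + W x * (u 0%N x * d 0%N x)) + g x * d 0%N x) +
     integ `[a, s] (fun x => 2^-1 * ((t 2%N x + t 0%N x) * (t 2%N x + t 0%N x) + W x * (t 0%N x * t 0%N x)) +
        ((delta^-1 + 2^-1) * g x ^+ 2 + 2^-1 * (t 0%N x * t 0%N x))).
    rewrite -integD//; last 2 first.
    - exact: itgD.
    - by do 2?apply: itgD => //; exact: itgZ.
    apply: le_integ => //; first exact: itgZ.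
      by apply: itgD => //; do 2?apply: itgD => //; exact: itgZ.
    move=> x /segP ax; have xK : x <= K by lra.
    have := Wd xK; rewrite /d /lin2; move: (u 2%N x) (u 0%N x) (t 2%N x) (t 0%N x) (g x) (W x).
    move=> u2 u0 t2 t0 gx wx h.
    have wx0 : 0 <= wx by exact: le_trans (ltW d0) h.
    have wxd : 0 <= wx - delta by rewrite subr_ge0.
    have q1 : 0 <= (u2 + u0 - (t2 + t0)) ^+ 2 by exact: sqr_ge0.
    have q2 : 0 <= wx * (u0 - t0) ^+ 2 by rewrite mulr_ge0 ?sqr_ge0.
    have q3 : 0 <= (gx + t0) ^+ 2 by exact: sqr_ge0.
    have q5 : 0 <= (wx - delta) * u0 ^+ 2 by rewrite mulr_ge0 ?sqr_ge0.
    have q6 : 0 <= (u2 + u0) ^+ 2 by exact: sqr_ge0.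
    have q4 : 0 <= delta / 4 * u0 ^+ 2 + gx * u0 + delta^-1 * gx ^+ 2.
      have -> : delta / 4 * u0 ^+ 2 + gx * u0 + delta^-1 * gx ^+ 2 =
        delta^-1 * (delta / 2 * u0 + gx) ^+ 2 by field; rewrite gt_eqF.
      by rewrite mulr_ge0 ?sqr_ge0// invr_ge0 ltW.
    have q7 : 0 <= wx * t0 ^+ 2 by rewrite mulr_ge0 ?sqr_ge0.
    have q8 : 0 <= (gx - t0) ^+ 2 by exact: sqr_ge0.
    nra.
  rewrite integD//.
  move: e; rewrite /bf => ->; rewrite add0r.
  rewrite integD//; [|exact: itgZ|by apply: itgD; rewrite //; exact: itgZ].
  rewrite integD//; [|exact: itgZ|exact: itgZ].
  rewrite !integZ// -/(bf W _ u u) -/(bf W _ t t) bt -/(ip _ t t) it.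
  have : integ `[a, s] (fun x => g x ^+ 2) <= integ setT (fun x => g x ^+ 2).
    by apply: le_integS => //; [case: g2|move=> x _; exact: sqr_ge0].
  have dd : 0 <= delta^-1 + 2^-1 by rewrite addr_ge0 ?invr_ge0// ltW.
  move=> /(ler_wpM2l dd); rewrite /Q.
  move: (bf _ _ _ _) (bf _ _ _ _) (ip _ _ _) (integ _ _) (integ _ _) => A1 A2 A3 A4 A5.
  by lra.
have ipbf (a : R) u : a <= s -> H2on `[a, s] u -> bf W `[a, s] u u <= Q ->
    ip `[a, s] u u <= Q / delta.
  move=> as_ hu le; rewrite ler_pdivlMr// mulrC; apply: le_trans le.
  by apply: bf_left_ge => //; apply: sub; exact: seg_hl.
(* [local_estimate] applied to [u''] bounds the remaining data at [s] by the integrals of [u'' ^ 2]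
   and [u'''' ^ 2]; the equation bounds the second by 12 times the first plus terms in [u] and [g],
   whence [13 = 1 + 12]. *)
pose B2 := 144 * (13 * (2 * Q + 2 * (Q / delta)) + 3 * (1 + M) ^+ 2 * (Q / delta) +
  3 * integ setT (fun x => g x ^+ 2)).
have datab (a : R) u : a <= s - 1 -> fsol W g u -> bf W `[a, s] u u <= Q ->
    u 2%N s ^+ 2 + u 3%N s ^+ 2 <= B2.
  move=> aa su bQ.
  have hu := fsol_H2seg a s su; have hJ := fsol_H2seg (s - 1) s su.
  have s1' : s - 1 <= s by lra.
  have bJ : bf W `[s - 1, s] u u <= Q.
    apply: le_trans bQ; apply: bf_left_sub => //; first by move=> x /segP h; apply/segP; lra.
    by apply: sub; exact: seg_hl.
  have iJ := ipbf _ _ s1' hJ bJ.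
  have gs : L2 `[s - 1, s] g by apply: L2S g2.
  have u0J := hJ.1 0%N isT; have u2J := hJ.1 2%N isT.
  have u4J := sol_L2_4 cW WM (mseg (s - 1) s) gs su u0J u2J.
  have := local_estimate (primS (@subsetT _ _) (su.1 2%N isT)) (primS (@subsetT _ _) (su.1 3%N isT)) u2J u4J.
  move/le_trans; apply; rewrite /B2 ler_pM2l//.
  have e2 : integ `[s - 1, s] (fun t => u 2%N t ^+ 2) <= 2 * Q + 2 * (Q / delta).
    apply: (@le_trans _ _ (2 * bf W `[s - 1, s] u u + 2 * ip `[s - 1, s] u u)); last lra.
    have i1 := bf_itg cW WM (mseg (s - 1) s) hJ hJ.
    have i2 := ip_itg (mseg (s - 1) s) hJ hJ.
    rewrite /bf /ip -!integZ// -integD//; [|exact: itgZ|exact: itgZ].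
    apply: le_integ => //; [by case: u2J|by apply: itgD => //; exact: itgZ|].
    move=> x /segP ax; have xK : x <= K by lra.
    have wx := Wd xK; have q : 0 <= W x * u 0%N x ^+ 2.
      by rewrite mulr_ge0 ?sqr_ge0//; exact: le_trans (ltW d0) wx.
    have := sqr_ge0 (u 2%N x + 2 * u 0%N x); nra.
  have e4 : integ `[s - 1, s] (fun t => u 4%N t ^+ 2) <=
      12 * integ `[s - 1, s] (fun t => u 2%N t ^+ 2) + 3 * (1 + M) ^+ 2 * ip `[s - 1, s] u u +
      3 * integ `[s - 1, s] (fun x => g x ^+ 2).
    have i2 := ip_itg (mseg (s - 1) s) hJ hJ.
    have u2i := u2J.2; have u4i := u4J.2; have gi := gs.2.
    rewrite /ip -!integZ// -integD//; [|exact: itgZ|exact: itgZ].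
    rewrite -integD//; [|by apply: itgD => //; exact: itgZ|exact: itgZ].
    apply: le_integ => //; first by do 2?apply: itgD => //; exact: itgZ.
    move=> x _; rewrite su.2.
    have h : ((1 + W x) * u 0%N x) ^+ 2 <= (1 + M) ^+ 2 * u 0%N x ^+ 2.
      rewrite exprMn ler_wpM2r ?sqr_ge0//.
      by have := WM x; rewrite ler_norml => /andP[? ?]; nra.
    move: h; move: (u 2%N x) ((1 + W x) * u 0%N x) (g x) => p q r h.
    have := sqr_ge0 (2 * p - q); have := sqr_ge0 (2 * p - r); have := sqr_ge0 (q - r).
    by rewrite -expr2; nra.
  have gT : integ `[s - 1, s] (fun x => g x ^+ 2) <= integ setT (fun x => g x ^+ 2).
    by apply: le_integS => //; [case: g2|move=> x _; exact: sqr_ge0].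
  have mm : 0 <= (1 + M) ^+ 2 by exact: sqr_ge0.
  have := ler_wpM2l mm iJ; nra.
have an (n : nat) : s - 1 - n%:R <= s - 1 by rewrite gerBl.
have exn (n : nat) : exists u, [/\ fsol W g u, u 0%N s = p0, u 1%N s = p1 & bf W `[s - 1 - n%:R, s] u u <= Q].
  have [u [su a0 a1 b0 b1]] := exa _ (le_lt_trans (an n) s1).
  by exists u; split => //; apply: bd.
pose sg n := sval (cid (exn n)).
have hsg n : [/\ fsol W g (sg n), sg n 0%N s = p0, sg n 1%N s = p1 & bf W `[s - 1 - n%:R, s] (sg n) (sg n) <= Q].
  by rewrite /sg; case: cid.
have sqle (y z : R) : y ^+ 2 + z ^+ 2 <= B2 -> `|y| <= B2 + 1.
  by move=> h; rewrite ler_norml; have := sqr_ge0 (y - 1); have := sqr_ge0 (y + 1); have := sqr_ge0 z; nra.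
have [|z|y [z hyz]] := @bolzano_weierstrass2 (fun n => sg n 2%N s) (fun n => sg n 3%N s) (B2 + 1).
- by move=> n; have [? _ _ ?] := hsg n; apply: sqle (datab _ _ (an n) _ _).
- by have [? _ _ ?] := hsg z; apply: sqle; rewrite addrC; apply: (datab _ _ (an z)).
have [u [su hu]] := fsol_exists cW WM s (fun k => nth 0 [:: p0; p1; y; z] k) g2.
have [r2 [sr2 hr2]] := sol_exists s (fun k => (k == 2)%:R).
have [r3 [sr3 hr3]] := sol_exists s (fun k => (k == 3)%:R).
have u0 : u 0%N s = p0 by rewrite hu.
have u1 : u 1%N s = p1 by rewrite hu.
have dec_sg n : forall k x, (k < 5)%N -> sg n k x = lin2 1 1 u (lin2 (sg n 2%N s - y) (sg n 3%N s - z) r2 r3) k x.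
  move=> k x k5; have [sn n0 n1 _] := hsg n.
  have h1 := fsol_sub sn su.
  have h2 := sol_lin (sg n 2%N s - y) (sg n 3%N s - z) sr2 sr3.
  have -> : sg n k x = lin2 1 (-1) (sg n) u k x + u k x by rewrite /lin2; ring.
  rewrite (sol_eq h1 h2 (x0 := s) _ x k5); first by rewrite /lin2; ring.
  move=> [|[|[|[|//]]]] _; rewrite /lin2 hu// hr2// hr3//= ?n0 ?n1; ring.
have fin (b : R) : b <= s -> bf W `[b, s] u u <= Q.
  move=> bs; apply/ler_addgt0Pl => eps eps0.
  have hus := fsol_H2seg b s su; have h2 := fsol_H2seg b s sr2; have h3 := fsol_H2seg b s sr3.
  pose K1 : R := 2 * `|bf W `[b, s] u r2| + 2 * `|bf W `[b, s] u r3| + 2 * `|bf W `[b, s] r2 r3| + 1.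
  have K1p : 0 < K1 by rewrite /K1; have := normr_ge0 (bf W `[b, s] u r2); have := normr_ge0 (bf W `[b, s] u r3); have := normr_ge0 (bf W `[b, s] r2 r3); lra.
  pose e : R := Num.min 1 (eps / K1).
  have e0 : 0 < e by rewrite lt_min ltr01 divr_gt0.
  have e1 : e <= 1 by rewrite ge_min lexx.
  have eK : e * K1 <= eps by rewrite -ler_pdivlMr// ge_min lexx orbT.
  have [n hn] := nat_above (s - 1 - b).
  have [m [nm ym zm]] := hyz e n e0.
  have [sm _ _ bm] := hsg m.
  have am : s - 1 - m%:R <= b.
    by have : (n%:R <= m%:R :> R) by [rewrite ler_nat]; lra.
  have bb : bf W `[b, s] (sg m) (sg m) <= Q.
    apply: le_trans bm; apply: bf_left_sub => //.
    - by move=> x /segP h; apply/segP; lra.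
    - by apply: sub; exact: seg_hl.
    - exact: fsol_H2seg sm.
  move: bb; set al := sg m 2%N s - y in ym; set be := sg m 3%N s - z in zm.
  have hr := H2on_lin al be (mseg b s) h2 h3.
  have htot := H2on_lin 1 1 (mseg b s) hus hr.
  rewrite (@eq_bf _ _ _ _ (lin2 1 1 u (lin2 al be r2 r3)) _ (lin2 1 1 u (lin2 al be r2 r3))); last 2 first.
  - by move=> k x k3 _; apply: dec_sg; exact: leq_trans k3 _.
  - by move=> k x k3 _; apply: dec_sg; exact: leq_trans k3 _.
  rewrite (bf_lin cW WM 1 1 (mseg b s) hus hr htot) !(bfC _ _ _ (lin2 1 1 _ _)).
  rewrite !(bf_lin cW WM 1 1 (mseg b s) hus hr) // !(bfC _ _ _ (lin2 _ _ r2 r3)).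
  rewrite !(bf_lin cW WM al be (mseg b s) h2 h3)// !(bfC _ _ _ (lin2 _ _ r2 r3)).
  rewrite !(bf_lin cW WM al be (mseg b s) h2 h3)// (bfC _ _ r2 u) (bfC _ _ r3 u) (bfC _ _ r3 r2).
  have p2 : 0 <= bf W `[b, s] r2 r2.
    apply: le_trans (bf_left_ge (mseg b s) _ h2); first by rewrite mulr_ge0 ?ip_ge0// ltW.
    by apply: sub; exact: seg_hl.
  have p3 : 0 <= bf W `[b, s] r3 r3.
    apply: le_trans (bf_left_ge (mseg b s) _ h3); first by rewrite mulr_ge0 ?ip_ge0// ltW.
    by apply: sub; exact: seg_hl.
  rewrite /K1 in eK; move: p2 p3 eK.
  have nb (c X : R) : `|c| <= e -> - (e * `|X|) <= c * X.
    move=> ce; rewrite lerNl; apply: le_trans (ler_norm _) _.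
    by rewrite normrN normrM ler_wpM2r.
  have n1 := nb _ (bf W `[b, s] u r2) ym; have n2 := nb _ (bf W `[b, s] u r3) zm.
  have abe : `|al * be| <= e.
    rewrite normrM; apply: (@le_trans _ _ (e * 1)); last by rewrite mulr1.
    by apply: ler_pM => //; exact: le_trans zm e1.
  have n3 := nb _ (bf W `[b, s] r2 r3) abe.
  move: n1 n2 n3 (sqr_ge0 al) (sqr_ge0 be).
  move: (bf _ _ u r2) (bf _ _ u r3) (bf _ _ r2 r3) (bf _ _ r2 r2) (bf _ _ r3 r3) (bf _ _ u u) => A1 A2 A3 A4 A5 A6.
  move=> n1 n2 n3 s1_ s2_ p2 p3 eK.
  have := mulr_ge0 s1_ p2; have := mulr_ge0 s2_ p3; nra.
have [l0 l2] := @energy_L2 _ W cW K delta d0 Wd u s Q sK (fsol_cont (k := 0) su isT) (fsol_cont (k := 2) su isT) fin.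
by exists u; split.
Qed.

Lemma dec_exists (s p0 p1 : R) : s <= K ->
  exists u, [/\ sol u, dec u, u 0%N s = p0 & u 1%N s = p1].
Proof.
move=> sK; have [u [su u0 u1 l0 l2]] := halfline_exists p0 p1 sK (L20 (@measurableT _ R)).
by exists u; split => //; apply: (L2_dec cW WM (L20 (@measurableT _ R)) su l0 l2).
Qed.

End BVP.

(** * Reflection: from -oo to +oo *)

Section Reflect.
Variable R : realType.
Local Notation mu := (@lebesgue_measure R).
Implicit Types (D I : set R) (f g h : R -> R) (u v w : nat -> R -> R).

Hint Resolve mseg mhl mhr : core.

Let moppr : measurable_fun [set: measurableTypeR R] (-%R : measurableTypeR R -> measurableTypeR R).
Proof. by []. Qed.

Lemma meas_reflect D f : measurable D -> measurable_fun D f ->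
  measurable_fun [set x | D (- x)] (fun x => f (- x)).
Proof.
move=> mD mf; have mD' : measurable [set x : R | D (- x)].
  by rewrite -[X in measurable X]setTI; exact: moppr.
apply: (measurable_comp (F := D)) => //; by move=> _ [x /= Dx <-].
Qed.

Lemma mreflect D : measurable D -> measurable [set x : R | D (- x)].
Proof. by move=> mD; rewrite -[X in measurable X]setTI; exact: moppr. Qed.

Lemma reflect_itg D f : measurable D -> itg D f ->
  itg [set x | D (- x)] (fun x => f (- x)) /\
  integ [set x | D (- x)] (fun x => f (- x)) = integ D f.
Proof.
move=> mD fi; have mD' := mreflect mD.
have eD : [set x : R | [set y | D (- y)] (- x)] = D.
  by apply/seteqP; split => x /=; rewrite opprK.
have [] := @integ_reflect R _ (fun x => f (- x)) mD' _ (meas_reflect mD (itg_meas fi)).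
  by rewrite eD; apply: eq_itg fi => // x _; rewrite opprK.
rewrite eD => i ->; split => //.
by apply: eq_integ => x _; rewrite opprK.
Qed.

Lemma reflect_L2 D f : measurable D -> L2 D f -> L2 [set x | D (- x)] (fun x => f (- x)).
Proof.
by move=> mD [mf f2]; split; [exact: meas_reflect|exact: (reflect_itg mD f2).1].
Qed.

Lemma reflect_prim I G g : prim I G g ->
  prim [set x | I (- x)] (fun x => G (- x)) (fun x => - g (- x)).
Proof.
move=> p x y Ix Iy xy; have [|gi e] := p (- y) (- x) Iy Ix; first by rewrite lerN2.
have eD : [set z : R | `[- y, - x]%classic (- z)] = `[x, y]%classic.
  by apply/seteqP; split => z /=; rewrite !in_itv/=; lra.
have [] := reflect_itg (mseg _ _) gi; rewrite eD => i e2.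
split; first exact: itgN.
rewrite (@eq_integ _ _ _ (fun z => -1 * g (- z))); last first.
  by move=> z _; rewrite mulN1r.
by rewrite integZ// e2 -e; ring.
Qed.

(** The sign makes component [k] the [k]-th derivative of the reflected function. *)
Definition refl u : nat -> R -> R := fun k x => (-1) ^+ k * u k (- x).

Lemma refl_refl u k x : refl (refl u) k x = u k x.
Proof. by rewrite /refl opprK mulrA -exprMn mulN1r opprK expr1n mul1r. Qed.

Lemma refl_prim I u k : prim I (u k) (u k.+1) ->
  prim [set x | I (- x)] (refl u k) (refl u k.+1).
Proof.
move=> p; rewrite /refl => x y Ix Iy xy.
have [i e] := primZ ((-1) ^+ k) (reflect_prim p) Ix Iy xy.
rewrite e; split; first by apply: eq_itg i => // z _; rewrite exprS; ring.
by apply: eq_integ => z _; rewrite exprS; ring.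
Qed.

Lemma refl_H2 I u : measurable I -> H2on I u -> H2on [set x | I (- x)] (refl u).
Proof.
move=> mI [lu pu]; split => k k3; last exact/refl_prim/pu.
by apply: L2Z; [exact: mreflect|exact: reflect_L2 (lu k k3)].
Qed.

Variables (W : R -> R) (M : R).
Hypothesis cW : continuous W.
Hypothesis WM : forall x, `|W x| <= M.

Let W' x := W (- x).
Let cW' : continuous W'.
Proof.
by move=> x; apply: (@continuous_comp _ _ _ (-%R : R -> R) W); [exact: opp_continuous|exact: cW].
Qed.
Let WM' x : `|W' x| <= M. Proof. exact: WM. Qed.

Lemma refl_sol u : sol W u -> sol W' (refl u).
Proof.
move=> [p e]; split => [k k4|x].
  by have := refl_prim (p k k4); exact: primS.
by rewrite /refl e /W' !exprS expr0; ring.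
Qed.

Lemma refl_sol' u : sol W' u -> sol W (refl u).
Proof.
move=> [p e]; split => [k k4|x].
  by have := refl_prim (p k k4); exact: primS.
by rewrite /refl e /W' !exprS expr0 opprK; ring.
Qed.

Definition decr u := dec (refl u).

Variables (K delta : R).
Hypothesis d0 : 0 < delta.
Hypothesis Wd : forall x, K <= x -> delta <= W x.

Let Wd' x : x <= - K -> delta <= W' x.
Proof. by move=> xK; apply: Wd; lra. Qed.

Lemma decr_exists (s p0 p1 : R) : K <= s ->
  exists u, [/\ sol W u, decr u, u 0%N s = p0 & u 1%N s = p1].
Proof.
move=> Ks; have sK : - s <= - K by lra.
have [u [su du u0 u1]] := dec_exists cW' WM' d0 Wd' p0 (- p1) sK.
exists (refl u); split; first exact: refl_sol'.
- move=> k k4; apply: (eq_vanl _ (du k k4)); exists 0 => x _.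
  by rewrite refl_refl.
- by rewrite /refl u0 expr0 mul1r.
- by rewrite /refl u1 expr1 mulN1r opprK.
Qed.

Lemma hl_refl (s : R) : [set x : R | halfline (- s) (- x)] = [set x | s <= x].
Proof. by apply/seteqP; split => x; rewrite /halfline/=; lra. Qed.

Lemma hr_refl (s : R) : [set x : R | s <= - x] = halfline (- s).
Proof. by apply/seteqP; split => x; rewrite /halfline/=; lra. Qed.

Lemma decr_H2 u (s : R) : sol W u -> decr u -> H2on [set x | s <= x] u.
Proof.
move=> su du.
have h := dec_H2 cW' WM' d0 Wd' (- s) (refl_sol su) du.
have := refl_H2 (mhl _) h; rewrite hl_refl; apply: eq_H2on => //; first exact: cvx_hr.
by move=> k x _ _; rewrite refl_refl.
Qed.

Lemma bf_refl (s : R) u v : H2on [set x | s <= x] u -> H2on [set x | s <= x] v ->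
  bf W [set x | s <= x] u v = bf W' (halfline (- s)) (refl u) (refl v).
Proof.
move=> hu hv; have i := bf_itg cW WM (mhr s) hu hv.
have [_] := reflect_itg (mhr s) i; rewrite /= hr_refl /bf => <-.
by apply: eq_integ => x _; rewrite /refl /W' !exprS expr0; ring.
Qed.

Lemma ibp_hr u v (s : R) : sol W u -> decr u -> H2on [set x | s <= x] v ->
  bf W [set x | s <= x] u v = - Bd u v s.
Proof.
move=> su du hv; rewrite bf_refl//; last exact: decr_H2.
have hv' := refl_H2 (mhr s) hv; rewrite /= hr_refl in hv'.
rewrite (ibp_hl cW' WM' d0 Wd' (refl_sol su) du hv').
by rewrite /Bd /refl opprK !exprS expr0; ring.
Qed.

Lemma bf_right_ge (s : R) v : K <= s -> H2on [set x | s <= x] v ->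
  delta * ip [set x | s <= x] v v <= bf W [set x | s <= x] v v.
Proof.
move=> Ks hv; rewrite /ip -integZ//; last exact: ip_itg.
apply: le_integ => //; first by apply: itgZ => //; exact: ip_itg.
  exact: (bf_itg cW WM (mhr s) hv hv).
move=> x /= sx; have := Wd (le_trans Ks sx).
have := sqr_ge0 (v 2%N x + v 0%N x); have := sqr_ge0 (v 0%N x); nra.
Qed.

End Reflect.

(** * Reduction to finite dimension *)

Section Broken.
Variable R : realType.
Local Notation mu := (@lebesgue_measure R).
Implicit Types (D I : set R) (f g h : R -> R) (u v w : nat -> R -> R).

Hint Resolve mseg mhl mhr : core.

(** Poincare's inequality, by Cauchy-Schwarz, with a condition at the left end only; it is applied
    once to the slope and once to the value. *)
Lemma prim_sq_le (a b : R) G g : a <= b -> prim `[a, b] G g -> G a = 0 -> L2 `[a, b] g ->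
  L2 `[a, b] G /\ integ `[a, b] (fun x => G x ^+ 2) <= (b - a) ^+ 2 * integ `[a, b] (fun x => g x ^+ 2).
Proof.
move=> ab p Ga l; set S := integ _ (fun x => g x ^+ 2).
have S0 : 0 <= S by apply: integ_ge0 => *; exact: sqr_ge0.
have pt x : a <= x <= b -> G x ^+ 2 <= (b - a) * S.
  move=> xab; have /andP[ax xb] := xab.
  have [gi e] := p a x (iffRL (segP _ _ _) (introT andP (conj (lexx a) ab))) (iffRL (segP _ _ _) xab) ax.
  have sub : `[a, x]%classic `<=` `[a, b]%classic by move=> y /segP ?; apply/segP; lra.
  have lx : L2 `[a, x] g by apply: L2S l.
  have l1 : L2 `[a, x] (fun=> 1) by apply: continuous_L2; exact: cst_continuous.
  have := cauchy_schwarz (mseg a x) lx l1.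
  rewrite (_ : integ _ (fun t => g t * 1) = G x); last first.
    have -> : G x = integ `[a, x] g by rewrite -e Ga subr0.
    by apply: eq_integ => t _; rewrite mulr1.
  rewrite (@eq_integ _ _ (fun=> 1 ^+ 2) (fun=> 1)); last by move=> t _; rewrite expr1n.
  rewrite integ_cst// mul1r mulrC => /le_trans; apply.
  have h : integ `[a, x] (fun t => g t ^+ 2) <= S.
    by apply: le_integS => //; [case: l|move=> *; exact: sqr_ge0].
  have h0 : 0 <= integ `[a, x] (fun t => g t ^+ 2) by apply: integ_ge0 => *; exact: sqr_ge0.
  by apply: ler_pM => //; lra.
have cG := prim_cont_seg ab p.
have mG := prim_meas_seg ab p.
have i2 : itg `[a, b] (fun x => G x ^+ 2).
  apply: (itg_le _ _ (g := fun=> (b - a) * S)) => //; first exact: measurable_funX.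
    by move=> x /segP xab; rewrite ger0_norm ?sqr_ge0// pt.
  by apply: continuous_itg; exact: cst_continuous.
split => //.
apply: (@le_trans _ _ (integ `[a, b] (fun=> (b - a) * S))).
  apply: le_integ => //.
  by apply: continuous_itg; exact: cst_continuous.
by rewrite integ_cst// le_eqVlt; apply/orP; left; apply/eqP; ring.
Qed.

Variables (W : R -> R) (M : R).
Hypothesis cW : continuous W.
Hypothesis WM : forall x, `|W x| <= M.

Let M0 := M_ge0 WM.

(** Applying Poincare twice on a segment of length [h <= 1] bounds the squared norm by [h] times the
    integral [S] of [v'' ^ 2], while the form is at least [S / 2] minus [1 + M] squared norms. With
    this length [S] is at least [2 (2 + M)] squared norms, so one squared norm is left over. *)
Definition hstep : R := (2 * (2 + M))^-1.

Lemma hstep_gt0 : 0 < hstep. Proof. by rewrite invr_gt0 mulr_gt0//; have := M0; lra. Qed.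

Lemma short_coercive (a b : R) v : a <= b -> b - a <= hstep -> H2on `[a, b] v ->
  v 0%N a = 0 -> v 1%N a = 0 -> ip `[a, b] v v <= bf W `[a, b] v v.
Proof.
move=> ab bah hv a0 a1.
have [l1 q1] := prim_sq_le ab (hv.2 1%N isT) a1 (hv.1 2%N isT).
have [l0 q0] := prim_sq_le ab (hv.2 0%N isT) a0 l1.
set S := integ _ (fun x => v 2%N x ^+ 2) in q1.
set S1 := integ _ (fun x => v 1%N x ^+ 2) in q1 q0.
have e0 : integ `[a, b] (fun x => v 0%N x ^+ 2) = ip `[a, b] v v.
  by apply: eq_integ => x _; rewrite expr2.
rewrite e0 in q0.
have S0 : 0 <= S by apply: integ_ge0 => *; exact: sqr_ge0.
have h1 : hstep <= 1 by rewrite /hstep invf_le1; have := M0; lra.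
have bl : 2^-1 * S - (1 + M) * ip `[a, b] v v <= bf W `[a, b] v v.
  have i1 := bf_itg cW WM (mseg a b) hv hv.
  have i2 := ip_itg (mseg a b) hv hv.
  have i3 := (hv.1 2%N isT).2.
  rewrite /S /ip /bf -!integZ// -integB//; [|exact: itgZ|exact: itgZ].
  apply: le_integ => //; first by apply: itgB => //; exact: itgZ.
  move=> x _; have := WM x; rewrite ler_norml => /andP[w1 w2].
  have := sqr_ge0 (v 2%N x + 2 * v 0%N x).
  have : 0 <= (W x + M) * (v 0%N x) ^+ 2 by rewrite mulr_ge0 ?sqr_ge0//; lra.
  by nra.
apply: le_trans bl.
have ba : 0 <= b - a by rewrite subr_ge0.
have b2 : (b - a) ^+ 2 <= hstep.
  rewrite expr2; apply: le_trans (_ : hstep * 1 <= _); last by rewrite mulr1.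
  by apply: ler_pM => //; apply: le_trans h1.
have b2' : (b - a) ^+ 2 <= 1 by apply: le_trans h1.
have b20 : 0 <= (b - a) ^+ 2 by exact: sqr_ge0.
have q : ip `[a, b] v v <= hstep * S.
  apply: le_trans q0 _; apply: ler_pM => //; first by apply: integ_ge0 => *; exact: sqr_ge0.
  by apply: le_trans q1 _; rewrite -[leRHS]mul1r ler_wpM2r.
have : 2 * (2 + M) * ip `[a, b] v v <= S.
  by rewrite -ler_pdivlMl ?mulr_gt0//; have := M0; lra.
by lra.
Qed.

Lemma seg_solution (a b : R) (p0 p1 q0 q1 : R) : a < b -> b - a <= hstep ->
  exists u, [/\ sol W u, u 0%N a = p0, u 1%N a = p1, u 0%N b = q0 & u 1%N b = q1].
Proof.
move=> ab h; apply: (coercive_bvp cW WM ab ltr01) => v hv a0 a1 _ _.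
by rewrite mul1r; apply: short_coercive => //; exact: ltW.
Qed.

Definition clamped (s : R) u : Prop := forall k, (k < 2)%N -> u k s = 0.

Definition unitdata (s : R) (j : bool) u : Prop := forall k, (k < 2)%N -> u k s = (k == j)%:R.

Lemma Bd_clamped (s : R) u v : clamped s v -> Bd u v s = 0.
Proof. by move=> c; rewrite /Bd !c// !mulr0 subr0. Qed.

(** If the momenta of two solutions pair equally with unit data at a point where
    the solutions agree to first order, the solutions coincide. *)
Lemma sol_match (s : R) u v (e r : bool -> nat -> R -> R) :
  sol W u -> sol W v -> (forall k, (k < 2)%N -> u k s = v k s) ->
  (forall j, unitdata s j (e j)) -> (forall j, unitdata s j (r j)) ->
  (forall j, Bd u (e j) s = Bd v (r j) s) ->
  forall k x, (k < 5)%N -> u k x = v k x.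
Proof.
move=> su sv uv he hr h; apply: (sol_eq WM (x0 := s) su sv).
have := h true; have := h false; rewrite /Bd !he// !hr//= !mulr0 !mulr1 !sub0r !subr0.
have u0 := uv 0%N isT; have u1 := uv 1%N isT.
rewrite u0 u1 => /oppr_inj /addIr e3 /addIr e2.
by move=> [|[|[|[|//]]]].
Qed.

Lemma bf_glue I (s : R) u v w : measurable I -> cvx I -> I s ->
  H2on (I `&` halfline s) u -> H2on (I `&` [set x | s <= x]) v ->
  (forall k, (k < 2)%N -> u k s = v k s) -> H2on I w ->
  bf W I (glue s u v) w = bf W (I `&` halfline s) u w + bf W (I `&` [set x | s <= x]) v w.
Proof.
move=> mI cI Is hu hv uv hw.
have m1 : measurable (I `&` halfline s) by exact: measurableI.
have m2 : measurable (I `&` [set x | s <= x]) by exact: measurableI.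
have hg : H2on I (glue s u v) by apply: H2on_glue => //; exact: uv.
rewrite (bf_split cW WM s mI hg hw); congr (_ + _).
  apply: eq_bf => // k x _ [_]; rewrite /halfline/= => xs; exact: glue_le.
apply/esym/(bf_off1 cW WM (s := s)) => //.
  by apply: (H2onS mI) => // x [].
by move=> k x _ [_ /= sx] xs; rewrite glue_gt// lt_neqAle eq_sym xs.
Qed.

(** The nodes [nd] are pairs (order of derivative, abscissa); [b t] is dual to the node
    [t], the [e j] carry the Cauchy data at the endpoint, and all of them solve the
    equation between the nodes. [red_crit]: a combination whose momentum is continuous
    at every node solves the equation throughout. *)
Record red (s : R) (T : finType) (nd : T -> nat * R) (b : T -> nat -> R -> R)
    (e : bool -> nat -> R -> R) (c : R) : Prop := Red {
  red_c : 0 < c;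
  red_nd : forall t, ((nd t).1 < 2)%N /\ (nd t).2 <= s;
  red_b : forall t, H2on (halfline s) (b t) /\ clamped s (b t);
  red_e : forall j, H2on (halfline s) (e j) /\ unitdata s j (e j);
  red_ndb : forall t t', b t' (nd t).1 (nd t).2 = (t == t')%:R;
  red_nde : forall t j, e j (nd t).1 (nd t).2 = 0;
  red_orth : forall u, H2on (halfline s) u -> clamped s u ->
    (forall t, u (nd t).1 (nd t).2 = 0) ->
    [/\ forall t, bf W (halfline s) (b t) u = 0,
        forall j, bf W (halfline s) (e j) u = 0 &
        c * ip (halfline s) u u <= bf W (halfline s) u u];
  red_crit : forall (y : T -> R) (z : bool -> R)
      (v := fun k x => \sum_t y t * b t k x + \sum_j z j * e j k x),
    (forall t, bf W (halfline s) v (b t) = 0) ->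
    exists u, [/\ sol W u, dec u & forall k x, (k < 3)%N -> x <= s -> v k x = u k x] }.

Variables (K delta : R).
Hypothesis d0 : 0 < delta.
Hypothesis Wd : forall x, x <= - K -> delta <= W x.

Lemma choose_bool (P : bool -> (nat -> R -> R) -> Prop) :
  (forall j, exists u, P j u) -> exists e : bool -> nat -> R -> R, forall j, P j (e j).
Proof. by move=> h; exists (fun j => sval (cid (h j))) => j; case: cid. Qed.

Lemma sol_sumb (z : bool -> R) (e : bool -> nat -> R -> R) : (forall j, sol W (e j)) ->
  sol W (fun k x => \sum_j z j * e j k x).
Proof.
move=> se; have h := sol_lin (z true) (z false) (se true) (se false).
by apply: sol_ext h => k x _; rewrite big_bool.
Qed.

(** Where [W >= delta] the form is coercive as it stands, so there are no nodes, and every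
    combination of the two decaying solutions [e j] is already a solution. *)
Lemma red_base (s : R) : s <= - K -> exists (T : finType) nd b e c, @red s T nd b e c.
Proof.
move=> sK.
have [e he] : exists e : bool -> nat -> R -> R, forall j, sol W (e j) /\ dec (e j) /\ unitdata s j (e j).
  apply: (@choose_bool (fun j u => sol W u /\ dec u /\ unitdata s j u)) => j.
  have [u [su du u0 u1]] := dec_exists cW WM d0 Wd (~~ j)%:R j%:R sK.
  exists u; split => //; split => // -[|[|//]] _; first by rewrite u0; case: j {u0 u1}.
  by rewrite u1; case: j {u0 u1}.
exists (void : finType), (fun t : void => match t with end), (fun t : void => match t with end), e, delta.
have sub : halfline s `<=` halfline (- K) by move=> x; rewrite /halfline/=; lra.
split => //; try by case.
- by move=> j; have [se [de ue]] := he j; split => //; exact: (dec_H2 cW WM d0 Wd).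
- move=> u hu cu _; split; first by case.
  + move=> j; have [se [de ue]] := he j.
    by rewrite (ibp_hl cW WM d0 Wd se de hu) Bd_clamped.
  + exact: (bf_left_ge cW WM Wd (mhl s) sub hu).
- move=> y z v _.
  have ve k x : v k x = \sum_j z j * e j k x by rewrite /v [X in X + _]big1 ?add0r// => -[].
  exists v; split => //.
    apply: (sol_ext _ (sol_sumb z (fun j => (he j).1))) => k x _.
    by rewrite ve.
  move=> k k4; apply: (@eq_vanl _ (fun x => \sum_j z j * e j k x)).
    by exists 0 => x _; rewrite ve.
  by apply: (@vanl_sum _ _ _ (fun j x => z j * e j k x)) => j; apply: vanlZ; apply: (he j).2.1.
Qed.

Lemma hl_cap (s s' : R) : s <= s' -> halfline s' `&` halfline s = halfline s.
Proof. by move=> ss; apply/seteqP; split => x; rewrite /halfline/=; [case|move=> ?; split; lra]. Qed.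

Lemma hl_hr_cap (s s' : R) : halfline s' `&` [set x | s <= x] = `[s, s']%classic.
Proof.
by apply/seteqP; split => x; rewrite /halfline/= in_itv/=; [case=> ? ?; lra|move=> ?; split; lra].
Qed.

Lemma H2on_sumT I (T : finType) (z : T -> R) (e : T -> nat -> R -> R) : measurable I ->
  (forall j, H2on I (e j)) -> H2on I (fun k x => \sum_j z j * e j k x).
Proof.
move=> mI h; split => k k3; first by apply: L2_sum => // j; apply: L2Z => //; exact: (h j).1.
by apply: (@prim_sum _ _ _ _ (fun j x => z j * e j k x)) => j; apply: primZ; exact: (h j).2.
Qed.

Lemma unitdata_sum (s : R) (z : bool -> R) (e : bool -> nat -> R -> R) (k : nat) : (k < 2)%N ->
  (forall j, unitdata s j (e j)) -> \sum_j z j * e j k s = z (k == 1).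
Proof.
move=> k2 h; rewrite big_bool !h//; move: k k2 => [|[|//]] _ /=.
  by rewrite mulr0 mulr1 add0r.
by rewrite mulr0 mulr1 addr0.
Qed.

(** The new nodes are the value and the slope at [s]. Their dual functions continue the old [e j] by
    the solution on [[s, s']] that is clamped at [s']; the old duals are extended by zero, and the
    new [e' j] vanish left of [s]. Orthogonality is inherited left of [s] and holds by parts on the
    new segment, where the test function is clamped at both ends. *)
Lemma red_step (s s' : R) (T : finType) nd b e c : @red s T nd b e c ->
  s < s' -> s' - s <= hstep -> exists (T : finType) nd b e c, @red s' T nd b e c.
Proof.
move=> [c0 hnd hb he hndb hnde horth hcrit] ss h.
have ss' := ltW ss.
have [r hr] : exists r : bool -> nat -> R -> R, forall j, sol W (r j) /\ unitdata s j (r j) /\ clamped s' (r j).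
  apply: (@choose_bool (fun j u => sol W u /\ unitdata s j u /\ clamped s' u)) => j.
  have [u [su a0 a1 b0 b1]] := seg_solution (~~ j)%:R j%:R 0 0 ss h.
  exists u; split => //; split; last by move=> [|[|//]].
  by move=> [|[|//]] _; [rewrite a0|rewrite a1]; case: j {a0 a1}.
have [om hom] : exists r : bool -> nat -> R -> R, forall j, sol W (r j) /\ clamped s (r j) /\ unitdata s' j (r j).
  apply: (@choose_bool (fun j u => sol W u /\ clamped s u /\ unitdata s' j u)) => j.
  have [u [su a0 a1 b0 b1]] := seg_solution 0 0 (~~ j)%:R j%:R ss h.
  exists u; split => //; split; first by move=> [|[|//]].
  by move=> [|[|//]] _; [rewrite b0|rewrite b1]; case: j {b0 b1}.
pose zero : nat -> R -> R := fun=> fun=> 0.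
pose T' : finType := (T + bool)%type.
pose nd' (t : T') := match t with inl t => nd t | inr j => (nat_of_bool j, s) end.
pose b' (t : T') := match t with inl t => glue s (b t) zero | inr j => glue s (e j) (r j) end.
pose e' j := glue s zero (om j).
have cL := hl_cap ss'; have cR := hl_hr_cap s s'.
have Is : halfline s' s by [].
have hglue u v : H2on (halfline s) u -> sol W v -> (forall k, (k < 2)%N -> u k s = v k s) ->
    H2on (halfline s') (glue s u v).
  move=> hu sv uv; apply: H2on_glue => //; [exact: cvx_hl|by rewrite cL| |exact: uv|exact: uv].
  by rewrite cR; exact: (fsol_H2seg s s' sv).
have z0 := sol0 W.
have bglue u v w : H2on (halfline s) u -> sol W v -> (forall k, (k < 2)%N -> u k s = v k s) ->
    H2on (halfline s') w ->
    bf W (halfline s') (glue s u v) w = bf W (halfline s) u w + (Bd v w s' - Bd v w s).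
  move=> hu sv uv hw; rewrite bf_glue//; last 3 first.
  - exact: cvx_hl.
  - by rewrite cL.
  - by rewrite cR; exact: (fsol_H2seg s s' sv).
  rewrite cL cR (ibp_sol cW WM ss' sv)//; apply: (H2onS (mhl s')) => //; exact: seg_hl.
have H0 I : measurable I -> H2on I zero by exact: H2on0.
have gs' u v k : glue s u v k s' = v k s' by rewrite glue_gt.
have gnd t u v : glue s u v (nd t).1 (nd t).2 = u (nd t).1 (nd t).2.
  by rewrite glue_le//; case: (hnd t).
have bz t k : (k < 2)%N -> b t k s = zero k s by move=> k2; rewrite (hb t).2.
have erj j k : (k < 2)%N -> e j k s = r j k s by move=> k2; rewrite (he j).2// (hr j).2.1.
have zo j k : (k < 2)%N -> zero k s = om j k s by move=> k2; rewrite (hom j).2.1.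
have hb' t : H2on (halfline s') (b' t) /\ clamped s' (b' t).
  case: t => [t|j] /=; split.
  - by apply: hglue => //; [case: (hb t)|exact: bz].
  - by move=> k _; rewrite gs'.
  - by apply: hglue => //; [case: (he j)|case: (hr j)|exact: erj].
  - by move=> k k2; rewrite gs' (hr j).2.2.
have he' j : H2on (halfline s') (e' j) /\ unitdata s' j (e' j).
  split; first by apply: hglue => //; [exact: H0|case: (hom j)|exact: zo].
  by move=> k k2; rewrite /e' gs' (hom j).2.2.
exists T', nd', b', e', (Num.min c 1); split.
- by rewrite lt_min c0 ltr01.
- move=> [t|j] /=; last by split => //; case: j.
  by have [? ?] := hnd t; split => //; lra.
- exact: hb'.
- exact: he'.
- move=> [t|j] [t'|j'] /=.
  + by rewrite gnd hndb.
  + by rewrite gnd hnde.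
  + by rewrite glue_le// (hb t').2//; case: j.
  + by rewrite glue_le// (he j').2//; case: j; case: j'.
- move=> [t|j] j' /=; first by rewrite /e' gnd.
  by rewrite /e' glue_le.
- move=> u hu cu und.
  have cus : clamped s u by move=> [|[|//]] _; [exact: (und (inr false))|exact: (und (inr true))].
  have hus : H2on (halfline s) u by apply: (H2onS (mhl s')) => // x; rewrite /halfline/=; lra.
  have hseg : H2on `[s, s'] u by apply: (H2onS (mhl s')) => //; exact: seg_hl.
  have [w1 w2 w3] := horth u hus cus (fun t => und (inl t)).
  split.
  + case=> [t|j] /=.
      by rewrite bglue//; [rewrite w1 !Bd_clamped// subrr addr0|case: (hb t)|exact: bz].
    by rewrite bglue//; [rewrite w2 !Bd_clamped// subrr addr0|case: (he j)|case: (hr j)|exact: erj].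
  + move=> j; rewrite /e' bglue//; [|exact: H0|by case: (hom j)|exact: zo].
    rewrite !Bd_clamped// subrr addr0 /bf (@eq_integ _ _ _ (fun=> 0)) ?integ0//.
    by move=> x _; rewrite /zero; ring.
  + rewrite (bf_split cW WM s (mhl s') hu hu) (ip_split s (mhl s') hu hu) cL cR.
    have sc := short_coercive ss' h hseg (cus 0%N isT) (cus 1%N isT).
    have i1 := ip_ge0 (halfline s) u; have i2 := ip_ge0 `[s, s'] u.
    have m1 : Num.min c 1 <= c by rewrite ge_min lexx.
    have m2 : Num.min c 1 <= 1 by rewrite ge_min lexx orbT.
    rewrite mulrDr; apply: lerD.
      by apply: le_trans w3; exact: ler_wpM2r.
    by apply: le_trans sc; rewrite -[leRHS]mul1r; exact: ler_wpM2r.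
- move=> y z v hv.
  pose y1 t := y (inl t); pose y2 j := y (inr j).
  pose v1 k x := \sum_t y1 t * b t k x + \sum_j y2 j * e j k x.
  pose sg k x := \sum_j y2 j * r j k x + \sum_j z j * om j k x.
  have ssg : sol W sg.
    apply: (sol_ext _ (sol_lin 1 1 (sol_sumb y2 (fun j => (hr j).1)) (sol_sumb z (fun j => (hom j).1)))).
    by move=> k x _; rewrite /lin2 !mul1r.
  have ve k x : v k x = glue s v1 sg k x.
    rewrite /v big_sumType /= /b' /e'; have [xs|xs] := leP x s.
      rewrite glue_le// /v1; rewrite -[RHS]addr0; congr (_ + _ + _).
      - by apply: eq_bigr => t _; rewrite glue_le.
      - by apply: eq_bigr => t _; rewrite glue_le.
      - by rewrite big1// => j _; rewrite glue_le// mulr0.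
    rewrite glue_gt// /sg [X in X + _ + _]big1 ?add0r; last by move=> t _; rewrite glue_gt// mulr0.
    by congr (_ + _); apply: eq_bigr => t _; rewrite glue_gt.
  have hv1 : H2on (halfline s) v1.
    have q1 := H2on_sumT y1 (mhl s) (fun t => (hb t).1).
    have q2 := H2on_sumT y2 (mhl s) (fun j => (he j).1).
    apply: (eq_H2on _ _ _ (H2on_lin 1 1 (mhl s) q1 q2)) => //; first exact: cvx_hl.
    by move=> k x _ _; rewrite /lin2 !mul1r.
  have v1s k : (k < 2)%N -> v1 k s = y2 (k == 1).
    move=> k2; rewrite /v1 (unitdata_sum _ k2 (fun j => (he j).2)).
    by rewrite big1 ?add0r// => t _; rewrite (hb t).2// mulr0.
  have sgs k : (k < 2)%N -> sg k s = y2 (k == 1).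
    move=> k2; rewrite /sg (unitdata_sum _ k2 (fun j => (hr j).2.1)).
    by rewrite big1 ?addr0// => j _; rewrite (hom j).2.1// mulr0.
  have vsg k : (k < 2)%N -> v1 k s = sg k s by move=> k2; rewrite v1s// sgs.
  have hbf w : H2on (halfline s') w -> bf W (halfline s') v w =
      bf W (halfline s) v1 w + (Bd sg w s' - Bd sg w s).
    move=> hw; rewrite -bglue//; apply: eq_bf => // k x _ _; exact: ve.
  (* The old test functions see only the part left of [s], where the hypothesis on the shorter
     half-line yields a solution [tau]. *)
  have [tau [st dt tv]] : exists u, [/\ sol W u, dec u & forall k x, (k < 3)%N -> x <= s -> v1 k x = u k x].
    apply: hcrit => t; have := hv (inl t); rewrite hbf; last exact: (hb' _).1.
    rewrite /= !Bd_clamped; [|by move=> k k2; rewrite glue_le// (hb t).2|by move=> k _; rewrite gs'].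
    rewrite subrr addr0 => hh; rewrite -[RHS]hh; apply: eq_bf => // k x _ xs.
    by rewrite /b' glue_le.
  (* The tests at the new node say that [tau] and [sg] have equal momenta at [s]; with equal value
     and slope they are one solution. *)
  have tsg : forall k x, (k < 5)%N -> tau k x = sg k x.
    apply: (sol_match st ssg _ (fun j => (he j).2) (fun j => (hr j).2.1)).
      by move=> k k2; rewrite -tv ?vsg//; exact: ltn_trans k2 _.
    move=> j; have := hv (inr j); rewrite hbf; last exact: (hb' _).1.
    rewrite [X in X + _](_ : _ = Bd tau (e j) s); last first.
      rewrite -(ibp_hl cW WM d0 Wd st dt (he j).1); apply: eq_bf => k x k3 xs; first exact: tv.
      by rewrite /= glue_le.
    rewrite [X in X - _]Bd_clamped; last by move=> k k2; rewrite /= gs' (hr j).2.2.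
    rewrite sub0r => /eqP; rewrite subr_eq0 => /eqP ->.
    by rewrite /Bd /= !glue_le// (erj j 0%N)// (erj j 1%N).
  exists tau; split => // k x k3 xs; rewrite ve.
  have [xs2|xs2] := leP x s; first by rewrite glue_le// tv.
  by rewrite glue_gt// tsg//; exact: ltn_trans k3 _.
Qed.

Lemma red_exists (s : R) : exists (T : finType) nd b e c, @red s T nd b e c.
Proof.
have [sK|Ks] := leP s (- K); first exact: red_base.
have [n hn] := nat_above ((s + K) / hstep).
have st0 := hstep_gt0.
have n0 : 0 < n%:R :> R.
  by apply: lt_le_trans hn; rewrite divr_gt0//; lra.
pose d := (s + K) / n%:R.
have dd : 0 < d by rewrite divr_gt0//; lra.
have dh : d <= hstep by rewrite ler_pdivrMr// mulrC -ler_pdivrMr.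
have key i : exists (T : finType) nd b e c, @red (- K + i%:R * d) T nd b e c.
  elim: i => [|i [T [nd [b [e [c r]]]]]].
    by apply: red_base; rewrite mul0r addr0.
  apply: (red_step r); first by rewrite -natr1 mulrDl mul1r; lra.
  by rewrite -natr1 mulrDl mul1r; lra.
have -> : s = - K + n%:R * d by rewrite /d mulrC divfK ?gt_eqF//; ring.
exact: key.
Qed.

End Broken.

(** * Diagonalization of symmetric matrices by congruence *)

Section Sylvester.
Variable R : realType.

(** When the diagonal vanishes, polarization helps: if [A i j != 0], the vector [e_i + e_j] has
    value [2 A i j]. *)
Lemma pivot n (A : 'M[R]_n.+1) : A^T = A -> A != 0 ->
  exists2 P : 'M[R]_n.+1, P \in unitmx & (P *m A *m P^T) 0 0 != 0.
Proof.
move=> sA A0.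
have rowv (P : 'M[R]_n.+1) : (P *m A *m P^T) 0 0 = (row 0 P *m A *m (row 0 P)^T) 0 0.
  by rewrite -row_mul !mxE; apply: eq_bigr => j _; rewrite !mxE.
have ev i j : ((delta_mx 0 i : 'rV[R]_n.+1) *m A *m (delta_mx 0 j)^T) 0 0 = A i j.
  rewrite -rowE mxE (bigD1 j)//= big1 ?addr0 => [|k kj]; rewrite !mxE ?eqxx /= ?mulr1//.
  by rewrite (negbTE kj) mulr0.
have Aij i j : A i j = A j i by rewrite -{1}sA mxE.
have rt i : row 0 (tperm_mx 0 i) = delta_mx 0 i :> 'rV[R]_n.+1.
  by apply/rowP => j; rewrite !mxE tpermL eqxx eq_sym.
have [/existsP[i Aii]|] := boolP [exists i, A i i != 0].
  exists (tperm_mx 0 i); first exact: unitmx_perm.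
  by rewrite rowv rt ev.
rewrite negb_exists => /forallP dz.
have {}dz i : A i i = 0 by apply/eqP; rewrite -[_ == _]negbK dz.
have [i [j Aij0]] : exists i j, A i j != 0.
  apply: contrapT => h; case/eqP: A0; apply/matrixP => i j; rewrite mxE.
  by apply/eqP/negP => /negP Aij0; apply: h; exists i, j.
have ij : i != j by apply/eqP => e; rewrite e dz eqxx in Aij0.
pose E : 'M[R]_n.+1 := 1%:M + delta_mx i j.
have Eu : E \in unitmx.
  have : E *m (1%:M - delta_mx i j) = 1%:M.
    rewrite /E mulmxBr mulmxDl mul1mx mulmx1 mulmxDl mul1mx.
    rewrite mul_delta_mx_cond eq_sym (negbTE ij) mulr0n addr0.
    by rewrite -addrA subrr addr0.
  by case/mulmx1_unit.
exists (tperm_mx 0 i *m E); first by rewrite unitmx_mul unitmx_perm.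
rewrite rowv row_mul rt /E mulmxDr mulmx1 mul_delta_mx mulmxDl linearD /= mulmxDr !mulmxDl.
have e2 (M1 M2 : 'M[R]_1) : (M1 + M2) 0 0 = M1 0 0 + M2 0 0 by rewrite mxE.
rewrite !e2 !ev.
by rewrite !dz add0r addr0 (Aij j i) -mulr2n mulrn_eq0 negb_or Aij0.
Qed.

Lemma sylvester n (A : 'M[R]_n) : A^T = A ->
  exists2 P : 'M[R]_n, P \in unitmx & forall i j, i != j -> (P *m A *m P^T) i j = 0.
Proof.
elim: n A => [|n IH] A sA.
  by exists 1%:M; [exact: unitmx1|case].
have [->|A0] := eqVneq A 0.
  by exists 1%:M; [exact: unitmx1|move=> i j _; rewrite mulmx0 mul0mx mxE].
have [P Pu a0] := pivot sA A0.
set B := P *m A *m P^T in a0.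
have sB : B^T = B by rewrite /B !trmx_mul trmxK sA mulmxA.
pose B' : 'M[R]_(1 + n) := B.
pose a := B 0 0.
pose u : 'rV[R]_n := ursubmx B'.
have e1 : ulsubmx B' = a%:M.
  apply/matrixP => i j; rewrite !ord1 [LHS]mxE [LHS]mxE [RHS]mxE eqxx mulr1n /a /B'.
  by congr (fun_of_matrix _ _ _); apply: val_inj.
have e2 : dlsubmx B' = u^T by rewrite /u trmx_ursub (sB : B'^T = B').
pose C := drsubmx B' - a^-1 *: (u^T *m u).
have sC : C^T = C.
  rewrite /C linearB /= linearZ /= trmx_mul trmxK; congr (_ - _).
  by rewrite trmx_drsub (sB : B'^T = B').
have [Q Qu hQ] := IH C sC.
(* Block elimination: [L] clears the first row and column and leaves the Schur complement [C], again
   symmetric. *)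
pose L : 'M[R]_(1 + n) := block_mx 1%:M 0 (- a^-1 *: u^T) 1%:M.
have Lu : L \in unitmx by rewrite unitmxE det_lblock !det1 mulr1 unitr1.
have LB : L *m B' *m L^T = block_mx a%:M 0 0 C.
  rewrite -[B']submxK e1 e2 -/u /L tr_block_mx !mulmx_block !trmx1 trmx0 !mul1mx !mulmx1 !mul0mx !mulmx0.
  rewrite !addr0 !linearZ /= trmxK.
  have z1 : - a^-1 *: (a%:M *m u) + u = 0.
    by rewrite mul_scalar_mx scalerA mulNr mulVf// scaleN1r addNr.
  have z2 : (- a^-1 *: u^T) *m a%:M + u^T = 0.
    by rewrite mul_mx_scalar scalerA mulrN mulfV// scaleN1r addNr.
  rewrite z1 z2 mul0mx scaler0 add0r; congr block_mx.
  by rewrite /C addrC scaleNr mulNmx -scalemxAl.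
pose Q' : 'M[R]_(1 + n) := block_mx 1%:M 0 0 Q.
have Q'u : Q' \in unitmx by rewrite unitmxE det_ublock det1 mul1r -unitmxE.
exists (Q' *m L *m P : 'M[R]_(1 + n)).
  by rewrite !unitmx_mul Q'u Lu.
have -> : (Q' *m L *m P : 'M[R]_(1 + n)) *m A *m (Q' *m L *m P : 'M[R]_(1 + n))^T = block_mx a%:M 0 0 (Q *m C *m Q^T).
  rewrite !trmx_mul -!mulmxA; rewrite (mulmxA P) (mulmxA (P *m A)) -/B (mulmxA B) (mulmxA L).
  rewrite (mulmxA L B') LB /Q' tr_block_mx !mulmx_block !trmx1 !trmx0 !mul1mx !mulmx1 !mul0mx !mulmx0.
  by rewrite !addr0 mulmx0 !add0r mulmxA.
move=> i j; case: (@split_ordP 1 n i) => i' ->; case: (@split_ordP 1 n j) => j' ->.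
- by rewrite !ord1 eqxx.
- by move=> _; apply: etrans (block_mxEur _ _ _ _ _ _) _; rewrite mxE.
- by move=> _; apply: etrans (block_mxEdl _ _ _ _ _ _) _; rewrite mxE.
- move=> h; apply: etrans (block_mxEdr _ _ _ _ _ _) _; apply: hQ; apply: contraNneq h => ->; exact: eqxx.
Qed.

End Sylvester.

(** * Counting directions of the diagonalized form *)

Section Spec.
Variable R : realType.
Local Notation mu := (@lebesgue_measure R).
Implicit Types (D I : set R) (f g h : R -> R) (u v w : nat -> R -> R).

Hint Resolve mseg mhl mhr : core.

Lemma kernel_vector (n m : nat) (Y : 'I_n -> 'I_m -> R) : (m < n)%N ->
  exists2 C : 'I_n -> R, exists i, C i != 0 & forall j, \sum_i C i * Y i j = 0.
Proof.
move=> mn; pose A : 'M[R]_(n, m) := \matrix_(i, j) Y i j.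
have : kermx A != 0.
  rewrite kermx_eq0 /row_free; apply: contraTneq mn => e.
  by rewrite -leqNgt -e rank_leq_col.
move=> /rowV0Pn[v /sub_kermxP vA v0].
exists (fun i => v 0 i).
  apply: contrapT => h; case/eqP: v0; apply/rowP => i; rewrite mxE.
  by apply/eqP/negP => /negP vi; apply: h; exists i.
move=> j; have := congr1 (fun B : 'rV_m => B 0 j) vA; rewrite !mxE => e.
by rewrite -[RHS]e; apply: eq_bigr => i _; rewrite mxE.
Qed.

Lemma kernel_vector_on (n N : nat) (A : {set 'I_N}) (Y : 'I_n -> 'I_N -> R) : (#|A| < n)%N ->
  exists2 C : 'I_n -> R, exists i, C i != 0 & forall j, j \in A -> \sum_i C i * Y i j = 0.
Proof.
move=> h; have [C C0 hC] := @kernel_vector _ _ (fun i (j : 'I_#|A|) => Y i (enum_val j)) h.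
exists C => // j jA; have := hC (enum_rank_in jA j).
by under eq_bigr do rewrite enum_rankK_in//.
Qed.

Variables (I : set R) (F KK : (nat -> R -> R) -> Prop).
Hypothesis mI : measurable I.
Hypothesis fI : fat I.
Hypothesis FH : forall u, F u -> H2on I u.
Hypothesis Fcomb : forall n (c : 'I_n -> R) (u : 'I_n -> nat -> R -> R), (forall i, F (u i)) -> F (comb c u).
Hypothesis Flin : forall a b u v, F u -> F v -> F (lin2 a b u v).
Variables (W : R -> R) (M : R).
Hypothesis cW : continuous W.
Hypothesis WM : forall x, `|W x| <= M.

Lemma bf_combr n (c : 'I_n -> R) (u : 'I_n -> nat -> R -> R) w : (forall i, F (u i)) -> F w ->
  bf W I w (comb c u) = \sum_(i < n) c i * bf W I w (u i).
Proof.
move=> hu hw; rewrite bfC (bf_comb cW WM)//; [|by move=> i; exact: FH|exact: FH].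
by apply: eq_bigr => i _; rewrite bfC.
Qed.

Lemma bf_combl n (c : 'I_n -> R) (u : 'I_n -> nat -> R -> R) w : (forall i, F (u i)) -> F w ->
  bf W I (comb c u) w = \sum_(i < n) c i * bf W I (u i) w.
Proof. by move=> hu hw; rewrite (bf_comb cW WM)// => *; exact: FH. Qed.

Lemma bf_lin2 a b u v w : F u -> F v -> F w ->
  bf W I (lin2 a b u v) w = a * bf W I u w + b * bf W I v w.
Proof. by move=> hu hv hw; rewrite (bf_lin cW WM)//; exact: FH. Qed.

Lemma bf_lin2r a b u v w : F u -> F v -> F w ->
  bf W I w (lin2 a b u v) = a * bf W I w u + b * bf W I w v.
Proof. by move=> hu hv hw; rewrite bfC bf_lin2// !(bfC _ _ _ w). Qed.

Lemma ip_lin2 a b u v w : F u -> F v -> F w ->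
  ip I (lin2 a b u v) w = a * ip I u w + b * ip I v w.
Proof. by move=> hu hv hw; rewrite (ip_lin)//; exact: FH. Qed.

Lemma ip_lin2r a b u v w : F u -> F v -> F w ->
  ip I w (lin2 a b u v) = a * ip I w u + b * ip I w v.
Proof. by move=> hu hv hw; rewrite ipC ip_lin2// !(ipC _ w). Qed.

Lemma ip_lin2_le u v : F u -> F v ->
  ip I (lin2 1 1 u v) (lin2 1 1 u v) <= 2 * ip I u u + 2 * ip I v v.
Proof.
move=> hu hv; have := ip_ge0 I (lin2 1 (-1) u v).
by rewrite !(ip_lin2, ip_lin2r)//; [lra|exact: Flin|exact: Flin].
Qed.

Lemma ip_comb_bound n (u : 'I_n -> nat -> R -> R) : (forall i, F (u i)) ->
  exists2 B, 0 < B & forall c : 'I_n -> R, ip I (comb c u) (comb c u) <= B * \sum_i c i ^+ 2.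
Proof.
move=> hu; have hc c := Fcomb c hu.
exists (1 + \sum_i \sum_j `|ip I (u i) (u j)|).
  by rewrite ltr_wpDr// sumr_ge0// => i _; exact: sumr_ge0.
move=> c; set S := \sum_i c i ^+ 2.
have S0 : 0 <= S by apply: sumr_ge0 => i _; exact: sqr_ge0.
have cS i : c i ^+ 2 <= S.
  by rewrite /S (bigD1 i)//= lerDl sumr_ge0// => j _; exact: sqr_ge0.
have cc i j : `|c i * c j| <= S.
  have h1 := cS i; have h2 := cS j; rewrite ler_norml.
  have h3 := sqr_ge0 (c i + c j); have h4 := sqr_ge0 (c i - c j).
  by apply/andP; split; nra.
rewrite mulrDl mul1r -[leLHS]add0r; apply: lerD => //.
rewrite (ip_comb _ mI); [|by move=> i; exact: FH|exact: FH].
rewrite mulr_suml; apply: ler_sum => i _.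
rewrite ipC (ip_comb _ mI); [|by move=> j; exact: FH|exact: FH].
rewrite mulr_sumr mulr_suml; apply: ler_sum => j _.
rewrite mulrA [ip I (u j) _]ipC [leRHS]mulrC; apply: le_trans (ler_norm _) _.
by rewrite normrM ler_wpM2r.
Qed.

(** The [b i] diagonalize the form, with values [d i], and the [y i] are their dual
    coordinates; the form is coercive on the common kernel of the [y i]. *)
Record spec (N : nat) (d : 'I_N -> R) (b : 'I_N -> nat -> R -> R)
    (y : 'I_N -> (nat -> R -> R) -> R) (c : R) : Prop := Spec {
  sp_c : 0 < c;
  sp_b : forall i, F (b i);
  sp_d : forall i j, bf W I (b i) (b j) = (i == j)%:R * d i;
  sp_y : forall i j, y i (b j) = (i == j)%:R;
  sp_lin : forall i a1 a2 u v, y i (lin2 a1 a2 u v) = a1 * y i u + a2 * y i v;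
  sp_comb : forall i n (a : 'I_n -> R) (u : 'I_n -> nat -> R -> R), y i (comb a u) = \sum_j a j * y i (u j);
  sp_0 : forall i u, F u -> (forall x, I x -> u 0%N x = 0) -> y i u = 0;
  sp_orth : forall u, F u -> (forall i, y i u = 0) ->
    (forall i, bf W I (b i) u = 0) /\ c * ip I u u <= bf W I u u;
  sp_crit : forall i, d i = 0 ->
    exists2 t, KK t & forall k x, (k < 3)%N -> I x -> b i k x = t k x }.

(** The form is below [- e] times the squared norm on some [n]-dimensional subspace. *)
Definition negf (n : nat) (e : R) : Prop := exists u : 'I_n -> nat -> R -> R,
  (forall i, F (u i)) /\ forall c : 'I_n -> R, (exists i, c i != 0) ->
  bf W I (comb c u) (comb c u) + e * ip I (comb c u) (comb c u) < 0.

Lemma sum_sqr_gt0 n (C : 'I_n -> R) : (exists i, C i != 0) -> 0 < \sum_i C i ^+ 2.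
Proof.
case=> i Ci; rewrite (bigD1 i)//= ltr_pwDl ?sumr_ge0//; last by move=> j _; exact: sqr_ge0.
by rewrite lt_neqAle sqr_ge0 eq_sym sqrf_eq0 Ci.
Qed.

Lemma min_pos (m : nat) (P : pred 'I_m) (g : 'I_m -> R) : (forall i, P i -> 0 < g i) ->
  exists2 e, 0 < e & forall i, P i -> e <= g i.
Proof.
move=> h; exists (\big[Num.min/1]_(i | P i) g i).
  by elim/big_ind: _ => // x z x0 z0; rewrite lt_min x0.
by move=> i Pi; rewrite (bigD1 i)//= ge_min lexx.
Qed.

Section WithSpec.
Variables (N : nat) (d : 'I_N -> R) (b : 'I_N -> nat -> R -> R)
    (y : 'I_N -> (nat -> R -> R) -> R) (c : R).
Hypothesis sp : spec d b y c.

Definition sp_part u := comb (fun i => y i u) b.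
Definition sp_rest u := lin2 1 (-1) u (sp_part u).

Lemma sp_part_F u : F (sp_part u). Proof. by apply: Fcomb; case: sp. Qed.

Lemma sp_rest_F u : F u -> F (sp_rest u).
Proof. by move=> hu; apply: Flin => //; exact: sp_part_F. Qed.

Lemma sp_part_y u i : y i (sp_part u) = y i u.
Proof.
rewrite (sp_comb sp) (bigD1 i)//= (sp_y sp) eqxx mulr1 big1 ?addr0// => j ji.
by rewrite (sp_y sp) eq_sym (negbTE ji) mulr0.
Qed.

Lemma sp_rest_y u i : y i (sp_rest u) = 0.
Proof. by rewrite (sp_lin sp) sp_part_y; ring. Qed.

Lemma sp_bfb i v : F v -> bf W I (b i) v = d i * y i v.
Proof.
move=> hv; have [h _] := sp_orth sp (sp_rest_F hv) (sp_rest_y v).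
have hb := sp_b sp.
have := h i; rewrite bf_lin2r//; last exact: sp_part_F.
rewrite bf_combr// (bigD1 i)//= big1 => [|j ji].
  by rewrite (sp_d sp) eqxx /= => e; lra.
by rewrite (sp_d sp) eq_sym (negbTE ji) mul0r mulr0.
Qed.

(** The two parts are form-orthogonal, so the form is a coercive part plus a diagonal one; all
    counting takes place in the diagonal part. *)
Lemma sp_bf u v : F u -> F v ->
  bf W I u v = bf W I (sp_rest u) (sp_rest v) + \sum_i d i * (y i u * y i v).
Proof.
move=> hu hv; have pu := sp_part_F u; have pv := sp_part_F v.
rewrite bf_lin2//; last exact: sp_rest_F.
rewrite {1}/sp_part bf_combl//; [|by case: sp|exact: sp_rest_F].
rewrite big1 => [|i _]; last by rewrite sp_bfb ?sp_rest_y ?mulr0//; exact: sp_rest_F.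
rewrite /sp_rest mulr0 addr0 mul1r bf_lin2r// [in X in _ + -1 * X]/sp_part bf_combr//; last by case: sp.
rewrite (eq_bigr (fun i => d i * (y i u * y i v))); last first.
  by move=> i _; rewrite bfC sp_bfb//; ring.
by ring.
Qed.

Lemma sp_ip_bound : exists2 B, 0 < B & forall u, F u ->
  ip I u u <= B * (ip I (sp_rest u) (sp_rest u) + \sum_i y i u ^+ 2).
Proof.
have [B B0 hB] := ip_comb_bound (sp_b sp).
exists (2 * (1 + B)); first by lra.
move=> u hu; have pu := sp_part_F u; have ru := sp_rest_F hu.
have := ip_lin2_le ru pu.
rewrite (@eq_ip _ _ _ u _ u); last 2 first.
  by move=> x _; rewrite /lin2 /sp_rest /lin2; ring.
  by move=> x _; rewrite /lin2 /sp_rest /lin2; ring.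
have := hB (fun i => y i u); rewrite -/(sp_part u).
set S := \sum_i _; set p := ip _ (sp_rest u) _; set q := ip _ (sp_part u) _.
have S0 : 0 <= S by apply: sumr_ge0 => i _; exact: sqr_ge0.
have p0 : 0 <= p by exact: ip_ge0.
move=> h1 h2; apply: le_trans h2 _.
have : 0 <= B * p by rewrite mulr_ge0 // ltW.
by lra.
Qed.

Lemma sp_bf_sub (A : {set 'I_N}) (C : 'I_#|A| -> R) (w := comb C (fun i => b (enum_val i))) :
  F w /\ bf W I w w = \sum_i C i ^+ 2 * d (enum_val i).
Proof.
have hb (i : 'I_#|A|) : F (b (enum_val i)) by exact: sp_b sp _.
have hw : F w by exact: Fcomb.
split => //; rewrite {1}/w bf_combl//; apply: eq_bigr => i _.
rewrite sp_bfb// (sp_comb sp) (bigD1 i)//= big1 => [|j ji].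
  by rewrite (sp_y sp) eqxx /=; ring.
by rewrite (sp_y sp) (inj_eq enum_val_inj) eq_sym (negbTE ji) mulr0.
Qed.

Definition nneg := #|finset (fun i => d i < 0)|.
Definition nnul := #|finset (fun i => d i == 0)|.
Definition nnp := #|finset (fun i => d i <= 0)|.

Lemma nnpE : nnp = (nneg + nnul)%N.
Proof.
rewrite /nnp /nneg /nnul -cardsUI.
have -> : finset (fun i => d i < 0) :&: finset (fun i => d i == 0) = finset.set0.
  by apply/setP => i; rewrite !inE; apply/negP => /andP[h /eqP e]; rewrite e ltxx in h.
rewrite cards0 addn0; apply: eq_card => i.
by rewrite !inE le_eqVlt orbC.
Qed.

Lemma negf_spec : exists2 e, 0 < e & negf nneg e.
Proof.
have hb (i : 'I_nneg) : F (b (enum_val i)) by exact: sp_b sp _.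
have [B B0 hB] := ip_comb_bound hb.
have [e e0 he] : exists2 e, 0 < e & forall i, i \in finset (fun i => d i < 0) -> e <= - d i.
  by apply: min_pos => i; rewrite inE; lra.
exists (e / B / 2); first by rewrite !divr_gt0.
exists (fun i => b (enum_val i)); split => // C C0.
have [hw ->] := sp_bf_sub C.
have S0 := sum_sqr_gt0 C0.
have h1 : \sum_i C i ^+ 2 * d (enum_val i) <= - e * \sum_i C i ^+ 2.
  rewrite mulr_sumr; apply: ler_sum => i _; rewrite mulrC ler_wpM2r ?sqr_ge0//.
  by have := he _ (enum_valP i); lra.
have h2 : e / B / 2 * ip I (comb C (fun i => b (enum_val i))) (comb C (fun i => b (enum_val i))) <=
    e / 2 * \sum_i C i ^+ 2.
  have -> : e / 2 * \sum_i C i ^+ 2 = e / B / 2 * (B * \sum_i C i ^+ 2) by field; lra.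
  by rewrite ler_pM2l ?divr_gt0.
have : 0 < e * \sum_i C i ^+ 2 by exact: mulr_gt0.
by lra.
Qed.

Lemma ip_gt0_sub (A : {set 'I_N}) (C : 'I_#|A| -> R) (w := comb C (fun i => b (enum_val i))) :
  (exists i, C i != 0) -> 0 < ip I w w.
Proof.
have [hw _] := sp_bf_sub C.
case=> i Ci; rewrite lt_neqAle ip_ge0 andbT eq_sym; apply: contraNneq Ci => e.
have z := ip_eq0 mI fI (FH hw) e.
have := sp_0 sp (enum_val i) hw z; rewrite (sp_comb sp) (bigD1 i)//= big1 => [|j ji].
  by rewrite (sp_y sp) eqxx /= => h; apply/eqP; lra.
by rewrite (sp_y sp) (inj_eq enum_val_inj) eq_sym (negbTE ji) mulr0.
Qed.

Lemma npf_spec e : 0 < e -> negf (nneg + nnul) (- e).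
Proof.
move=> e0; rewrite -nnpE; exists (fun i => b (enum_val i)); split; first by move=> i; exact: sp_b sp _.
move=> C C0; have := ip_gt0_sub C0; rewrite (sp_bf_sub C).2 => p0.
have h1 : \sum_i C i ^+ 2 * d (enum_val i) <= 0.
  apply: sumr_le0 => i _; rewrite mulr_ge0_le0 ?sqr_ge0//.
  by have := enum_valP i; rewrite inE.
by have := mulr_gt0 e0 p0; lra.
Qed.

(** A larger family would contain a nontrivial combination whose coordinates along all negative
    [d i] vanish, and there the form is nonnegative. *)
Lemma negf_le n : negf n 0 -> (n <= nneg)%N.
Proof.
move=> [u [hu hn]]; rewrite leqNgt; apply/negP => lt.
have [C C0 hC] := @kernel_vector_on _ _ _ (fun i j => y j (u i)) lt.
have hw := Fcomb C hu.
have := hn C C0; rewrite mul0r addr0 sp_bf//.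
have [_ h] := sp_orth sp (sp_rest_F hw) (sp_rest_y _).
have : 0 <= \sum_i d i * (y i (comb C u) * y i (comb C u)).
  apply: sumr_ge0 => i _; have [di|di] := ltP (d i) 0.
    by rewrite (sp_comb sp) hC ?inE// mul0r mulr0.
  by rewrite mulr_ge0// -expr2 sqr_ge0.
have := mulr_ge0 (ltW (sp_c sp)) (ip_ge0 I (sp_rest (comb C u))).
by lra.
Qed.

(** The positive [d i] and the coercivity constant have a common positive lower bound. Below that
    threshold, transferred to the squared norm by [sp_ip_bound], no further direction can appear:
    this is the half of semicontinuity that limits the index after a perturbation. *)
Lemma npf_le : exists2 e, 0 < e & forall n, negf n (- e) -> (n <= nneg + nnul)%N.
Proof.
have [B B0 hB] := sp_ip_bound.
have [e e0 he] : exists2 e, 0 < e & forall i, 0 < d i -> e <= d i by exact: min_pos.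
pose e1 := Num.min c e.
have e10 : 0 < e1 by rewrite lt_min (sp_c sp) e0.
have e1c : e1 <= c by rewrite ge_min lexx.
have e1e : e1 <= e by rewrite ge_min lexx orbT.
exists (e1 / B); first exact: divr_gt0.
move=> n [u [hu hn]]; rewrite -nnpE leqNgt; apply/negP => lt.
have [C C0 hC] := @kernel_vector_on _ _ _ (fun i j => y j (u i)) lt.
have hw := Fcomb C hu.
have := hn C C0; rewrite sp_bf//.
have [_ h] := sp_orth sp (sp_rest_F hw) (sp_rest_y _).
have : e1 * \sum_i y i (comb C u) ^+ 2 <= \sum_i d i * (y i (comb C u) * y i (comb C u)).
  rewrite mulr_sumr; apply: ler_sum => i _; have [di|di] := leP (d i) 0.
    by rewrite (sp_comb sp) hC ?inE// mul0r expr0n !mulr0.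
  by rewrite -expr2 ler_wpM2r ?sqr_ge0//; have := he i di; lra.
have h3 : e1 * ip I (sp_rest (comb C u)) (sp_rest (comb C u)) <=
    c * ip I (sp_rest (comb C u)) (sp_rest (comb C u)) by rewrite ler_wpM2r ?ip_ge0.
have : e1 / B * ip I (comb C u) (comb C u) <=
    e1 * (ip I (sp_rest (comb C u)) (sp_rest (comb C u)) + \sum_i y i (comb C u) ^+ 2).
  by rewrite -mulrA ler_pM2l// ler_pdivrMl//; exact: hB.
by lra.
Qed.

Lemma np0_spec : exists u : 'I_(nneg + nnul) -> nat -> R -> R, (forall i, F (u i)) /\
  forall C : 'I_(nneg + nnul) -> R, bf W I (comb C u) (comb C u) <= 0 /\
    ((exists i, C i != 0) -> 0 < ip I (comb C u) (comb C u)).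
Proof.
rewrite -nnpE; exists (fun i => b (enum_val i)); split; first by move=> i; exact: sp_b sp _.
move=> C; split; last exact: ip_gt0_sub.
rewrite (sp_bf_sub C).2; apply: sumr_le0 => i _; rewrite mulr_ge0_le0 ?sqr_ge0//.
by have := enum_valP i; rewrite inE.
Qed.

(** The margin is measured in the coefficients instead of the squared norm, because the error of
    cutting off on the right is estimated through the coefficients. *)
Lemma negq_spec : exists2 e, 0 < e & exists u : 'I_nneg -> nat -> R -> R, (forall i, F (u i)) /\
  forall C : 'I_nneg -> R, bf W I (comb C u) (comb C u) <= - e * \sum_i C i ^+ 2.
Proof.
have [e e0 he] : exists2 e, 0 < e & forall i, i \in finset (fun i => d i < 0) -> e <= - d i.
  by apply: min_pos => i; rewrite inE; lra.
exists e => //; exists (fun i => b (enum_val i)); split; first by move=> i; exact: sp_b sp _.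
move=> C; rewrite (sp_bf_sub C).2 mulr_sumr; apply: ler_sum => i _; rewrite mulrC ler_wpM2r ?sqr_ge0//.
by have := he _ (enum_valP i); lra.
Qed.

(** The equality case of the count: a combination without negative coordinates has nonpositive form
    only if its coercive part and its positive coordinates vanish, hence only if it lies in the
    kernel, which the last hypothesis excludes. *)
Lemma np0_le n (u : 'I_n -> nat -> R -> R) :
  (forall m (C : 'I_m -> R) (t : 'I_m -> nat -> R -> R), (forall i, KK (t i)) -> KK (comb C t)) ->
  (forall i, F (u i)) -> (forall C, bf W I (comb C u) (comb C u) <= 0) ->
  (forall C t, KK t -> (forall x, I x -> comb C u 0%N x = t 0%N x) -> forall i, C i = 0) ->
  (n <= nneg)%N.
Proof.
move=> Kc hu hn hz; rewrite leqNgt; apply/negP => lt.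
have [C [i0 C0] hC] := @kernel_vector_on _ _ _ (fun i j => y j (u i)) lt.
have hw := Fcomb C hu; set w := comb C u in hw.
have := hn C; rewrite sp_bf// -/w.
have [_ h] := sp_orth sp (sp_rest_F hw) (sp_rest_y _).
have dy i : 0 <= d i * (y i w * y i w).
  have [di|di] := ltP (d i) 0.
    by rewrite (sp_comb sp) hC ?inE// mul0r mulr0.
  by rewrite mulr_ge0// -expr2 sqr_ge0.
have s0 : 0 <= \sum_i d i * (y i w * y i w) by apply: sumr_ge0 => i _; exact: dy.
have p0 := mulr_ge0 (ltW (sp_c sp)) (ip_ge0 I (sp_rest w)).
move=> hle; have b0 : c * ip I (sp_rest w) (sp_rest w) = 0 by lra.
have {}s0 : \sum_i d i * (y i w * y i w) = 0 by lra.
have y0 i : d i != 0 -> y i w = 0.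
  move=> di; move/eqP: s0; rewrite psumr_eq0 => [/allP/(_ i)|j _]; last exact: dy.
  by rewrite mem_index_enum => /(_ isT); rewrite !mulf_eq0 (negbTE di) /= orbb => /eqP.
have r0 := ip_eq0 mI fI (FH (sp_rest_F hw)).
have {}r0 : forall x, I x -> sp_rest w 0%N x = 0.
  by apply: r0; apply/eqP; move/eqP: b0; rewrite mulf_eq0 gt_eqF//; case: sp.
have [t ht] : exists t : 'I_N -> nat -> R -> R, forall i, KK (t i) /\
    (d i = 0 -> forall k x, (k < 3)%N -> I x -> b i k x = t i k x).
  have ex i : exists t, KK t /\ (d i = 0 -> forall k x, (k < 3)%N -> I x -> b i k x = t k x).
    have [di|di] := eqVneq (d i) 0; first by have [t kt e] := sp_crit sp di; exists t.
    (* The zero function, as an empty combination, is a mere placeholder at indices with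
       [d i != 0]. *)
    exists (comb (fun i : 'I_0 => 0) (fun _ => fun=> fun=> 0)); split; first by apply: Kc; case.
    by move=> e; rewrite e eqxx in di.
  by exists (fun i => sval (cid (ex i))) => i; case: cid.
move/eqP: C0; apply; apply: (hz C (comb (fun i => y i w) t)).
  by apply: Kc => i; case: (ht i).
move=> x Ix; have := r0 x Ix; rewrite /sp_rest /lin2 mul1r mulN1r => /eqP.
rewrite subr_eq0 => /eqP; rewrite -/w => ->; apply: eq_bigr => i _.
have [di|di] := eqVneq (d i) 0; last by rewrite y0// !mul0r.
by rewrite (ht i).2.
Qed.

(** Testing against [v], obtained from [u] by flipping the sign of its components
    along the negative directions, turns the form into a coercive one. *)
Lemma spec_inverse_bound : nnul = 0%N -> exists2 C, 0 <= C & forall u g, F u -> L2 I g ->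
  (forall v, F v -> bf W I u v + integ I (fun x => g x * v 0%N x) = 0) ->
  ip I u u <= C * integ I (fun x => g x ^+ 2).
Proof.
move=> nn0; have d0 i : d i != 0.
  apply/negP => di; have : i \in finset (fun i => d i == 0) by rewrite inE.
  by move/eqP: nn0; rewrite cards_eq0 => /eqP ->; rewrite inE.
have [B B0 hB] := sp_ip_bound.
have [e e0 he] : exists2 e, 0 < e & forall i, xpredT i -> e <= `|d i|.
  by apply: min_pos => i _; rewrite normr_gt0.
pose e1 := Num.min c e.
have e10 : 0 < e1 by rewrite lt_min (sp_c sp) e0.
have e1c : e1 <= c by rewrite ge_min lexx.
have e1e : e1 <= e by rewrite ge_min lexx orbT.
(* From [e1 * E <= |int g v|] and [ip v v <= B * E], Cauchy-Schwarz gives [E <= B / e1 ^ 2] times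
   the integral of [g ^ 2]; the other factor [B] bounds [ip u u] by [B * E]. *)
exists (B ^+ 2 / e1 ^+ 2); first by rewrite divr_ge0 ?sqr_ge0.
move=> u g hu lg weak.
have hr := sp_rest_F hu.
have hF : F (comb (fun i => Num.sg (d i) * y i u) b) by apply: Fcomb; case: sp.
pose v := lin2 1 1 (sp_rest u) (comb (fun i => Num.sg (d i) * y i u) b).
have hv : F v by exact: Flin.
have yv i : y i v = Num.sg (d i) * y i u.
  rewrite (sp_lin sp) sp_rest_y (sp_comb sp) (bigD1 i)//= (sp_y sp) eqxx big1 => [|j ji].
    by rewrite /=; ring.
  by rewrite (sp_y sp) eq_sym (negbTE ji) mulr0.
have rv k x : sp_rest v k x = sp_rest u k x.
  rewrite {1}/sp_rest /lin2 /v /lin2 /sp_part /comb.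
  by under [in X in _ + _ * X]eq_bigr do rewrite yv; rewrite /sp_rest /lin2; ring.
set E := ip I (sp_rest u) (sp_rest u) + \sum_i y i u ^+ 2.
have S0 : 0 <= \sum_i y i u ^+ 2 by apply: sumr_ge0 => i _; exact: sqr_ge0.
have E0 : 0 <= E by rewrite addr_ge0 ?ip_ge0.
have pv : ip I v v <= B * E.
  apply: le_trans (hB v hv) _; rewrite (@eq_ip _ _ _ (sp_rest u) _ (sp_rest u))//.
  rewrite ler_pM2l// lerD2l; apply: ler_sum => i _.
  by rewrite yv exprMn sqr_sg d0 mul1r.
have bE : e1 * E <= bf W I u v.
  rewrite sp_bf// (@eq_bf _ _ _ _ (sp_rest u) _ (sp_rest u))//.
  have [_ h] := sp_orth sp hr (sp_rest_y u).
  rewrite mulrDr; apply: lerD.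
    by apply: le_trans h; rewrite ler_wpM2r ?ip_ge0.
  rewrite mulr_sumr; apply: ler_sum => i _.
  rewrite yv (_ : d i * (y i u * (Num.sg (d i) * y i u)) = Num.sg (d i) * d i * y i u ^+ 2); last by ring.
  rewrite -normrEsg ler_wpM2r ?sqr_ge0//; exact: le_trans e1e (he i isT).
set G := integ I (fun x => g x ^+ 2).
have G0 : 0 <= G by apply: integ_ge0 => x _; exact: sqr_ge0.
have cs : (e1 * E) ^+ 2 <= G * (B * E).
  have bN : bf W I u v = - integ I (fun x => g x * v 0%N x).
    by apply/eqP; rewrite -addr_eq0 weak.
  rewrite bN in bE; have lv := (FH hv).1 0%N isT.
  have := cauchy_schwarz mI lg lv; rewrite -/G.
  rewrite (@eq_integ _ _ (fun x => v 0%N x ^+ 2) (fun x => v 0%N x * v 0%N x)) -/(ip I v v); last by [].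
  move: (integ I (fun x => g x * v 0%N x)) bE => J bE h.
  have h1 : (e1 * E) ^+ 2 <= J ^+ 2.
    have eE : 0 <= e1 * E by rewrite mulr_ge0// ltW.
    by rewrite -[leRHS]sqrrN; apply: lerXn2r; rewrite ?nnegrE//; lra.
  by apply: le_trans h1 _; apply: le_trans h _; exact: ler_wpM2l.
apply: le_trans (hB u hu) _; rewrite -/E.
have EG : E <= B / e1 ^+ 2 * G.
  have [E1|E1] := eqVneq E 0; first by rewrite E1 mulr_ge0// divr_ge0 ?sqr_ge0// ltW.
  have Ep : 0 < E by rewrite lt_neqAle eq_sym E1.
  have e2 : 0 < e1 ^+ 2 by rewrite exprn_gt0.
  rewrite mulrAC ler_pdivlMr// -(ler_pM2r Ep).
  by move: cs; rewrite exprMn; lra.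
apply: le_trans (ler_wpM2l (ltW B0) EG) _.
by rewrite le_eqVlt; apply/orP; left; apply/eqP; rewrite expr2; ring.
Qed.

Hypothesis KF : forall t, KK t -> F t.
Hypothesis Kbf : forall t v, KK t -> F v -> bf W I t v = 0.

Lemma spec_ker : exists t : 'I_nnul -> nat -> R -> R,
  (forall i, KK (t i)) /\ lin_indep_on I (fun i => t i 0%N).
Proof.
have h (i : 'I_nnul) : exists t, KK t /\ forall k x, (k < 3)%N -> I x -> b (enum_val i) k x = t k x.
  by have := enum_valP i; rewrite inE => /eqP /(sp_crit sp)[t kt ht]; exists t.
exists (fun i => sval (cid (h i))); split; first by move=> i; case: cid => t [].
move=> C hC i; apply: contrapT => /eqP Ci.
suff : 0 < ip I (comb C (fun i => b (enum_val i))) (comb C (fun i => b (enum_val i))).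
  rewrite (@eq_ip _ _ _ (fun=> fun=> 0) _ (fun=> fun=> 0)) => [|x Ix|x Ix].
  - by rewrite /ip (@eq_integ _ _ _ (fun=> 0)) ?integ0 ?ltxx// => x _; rewrite mulr0.
  - by apply: etrans (hC x Ix); apply: eq_bigr => j _; case: cid => t /= [_ ->].
  - by apply: etrans (hC x Ix); apply: eq_bigr => j _; case: cid => t /= [_ ->].
by apply: ip_gt0_sub; exists i.
Qed.

(** A kernel element is form-orthogonal to every [b i], so its coordinates with [d i != 0] vanish;
    if the others vanish as well, coercivity kills it. *)
Lemma spec_ker_le n (t : 'I_n -> nat -> R -> R) : (forall i, KK (t i)) ->
  lin_indep_on I (fun i => t i 0%N) -> (n <= nnul)%N.
Proof.
move=> kt ti; rewrite leqNgt; apply/negP => lt.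
have [C [i0 C0] hC] := @kernel_vector_on _ _ _ (fun i j => y j (t i)) lt.
have ht i := KF (kt i); have hw := Fcomb C ht.
have bw v : F v -> bf W I (comb C t) v = 0.
  by move=> hv; rewrite bf_combl// big1// => i _; rewrite Kbf// mulr0.
have yw i : y i (comb C t) = 0.
  have [di|di] := eqVneq (d i) 0; first by rewrite (sp_comb sp) hC// inE di.
  have := bw _ (sp_b sp i); rewrite bfC sp_bfb// => /eqP.
  by rewrite mulf_eq0 (negbTE di) => /eqP.
have [_] := sp_orth sp hw yw; rewrite bw// => h.
have p0 : ip I (comb C t) (comb C t) = 0.
  by apply/eqP; rewrite eq_le ip_ge0 andbT -(pmulr_rle0 _ (sp_c sp)).
have := ti C (ip_eq0 mI fI (FH hw) p0) i0.
by move/eqP; rewrite (negbTE C0).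
Qed.

End WithSpec.
End Spec.

(** * Diagonalizing the form on half-lines and on the line *)

Section SpecBuild.
Variable R : realType.
Local Notation mu := (@lebesgue_measure R).
Implicit Types (D I : set R) (f g h : R -> R) (u v w : nat -> R -> R).

Hint Resolve mseg mhl mhr : core.

(** By parts, the integral of [f1 ^ 2] over a segment consists of boundary terms and the integral of
    [f f2], all zero. It makes the slope coordinates at the nodes depend on the function alone,
    although the components of [u] are separate data. *)
Lemma prim_zero I f f1 f2 : fat I -> prim I f f1 -> prim I f1 f2 -> (forall x, I x -> f x = 0) ->
  forall x, I x -> f1 x = 0.
Proof.
move=> fI p p1 z x Ix; have [a [b [ab [sub xab]]]] := fI x Ix.
have q := primS sub p; have q1 := primS sub p1.
have zs t : `[a, b]%classic t -> f t = 0 by move=> /sub; exact: z.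
have Ia : `[a, b]%classic a by apply/segP; rewrite lexx ltW.
have Ib : `[a, b]%classic b by apply/segP; rewrite lexx ltW.
have cc : cvx `[a, b]%classic by exact: cvx_seg.
have [_ e] := primM cc q q1 Ia Ib (ltW ab).
have {}e : integ `[a, b] (fun t => f1 t ^+ 2) = 0.
  rewrite !zs// !mul0r subrr in e; rewrite [RHS]e.
  by apply: eq_integ => t /zs ->; rewrite mul0r addr0 expr2.
exact: (integ_sq_eq0 ab (prim_cont_seg (ltW ab) q1) e).
Qed.

Lemma spec_of_broken (I : set R) (F KK : (nat -> R -> R) -> Prop) (W : R -> R) (M : R)
    (T : finType) (nd : T -> nat * R) (b0 : T -> nat -> R -> R) (c : R) :
  measurable I -> fat I -> (forall u, F u -> H2on I u) ->
  (forall n (c : 'I_n -> R) (u : 'I_n -> nat -> R -> R), (forall i, F (u i)) -> F (comb c u)) ->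
  continuous W -> (forall x, `|W x| <= M) -> 0 < c ->
  (forall t, ((nd t).1 < 2)%N /\ I (nd t).2) -> (forall t, F (b0 t)) ->
  (forall t t', b0 t' (nd t).1 (nd t).2 = (t == t')%:R) ->
  (forall u, F u -> (forall t, u (nd t).1 (nd t).2 = 0) ->
    (forall t, bf W I (b0 t) u = 0) /\ c * ip I u u <= bf W I u u) ->
  (forall (y : T -> R) (v := fun k x => \sum_t y t * b0 t k x),
    (forall t, bf W I v (b0 t) = 0) ->
    exists2 u, KK u & forall k x, (k < 3)%N -> I x -> v k x = u k x) ->
  exists N (d : 'I_N -> R) b y c, spec I F KK W d b y c.
Proof.
move=> mI fI FH Fc cW WM c0 hnd hb hndb horth hcrit.
pose N := #|T|; pose b1 (i : 'I_N) := b0 (enum_val i).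
pose G : 'M[R]_N := \matrix_(i, j) bf W I (b1 i) (b1 j).
have sG : G^T = G by apply/matrixP => i j; rewrite !mxE bfC.
have [P Pu hP] := sylvester sG.
pose b i := comb (fun j => P i j) b1.
pose d i := (P *m G *m P^T) i i.
pose nv (u : nat -> R -> R) (j : 'I_N) := u (nd (enum_val j)).1 (nd (enum_val j)).2.
(* The node values of [b i] form the [i]-th row of [P], so multiplication by the inverse of [P]
   gives coordinates dual to the [b i]. *)
pose y (i : 'I_N) u := \sum_j nv u j * invmx P j i.
have Fb1 i : F (b1 i) by exact: hb.
have Fb i : F (b i) by exact: Fc.
have bfP i j : bf W I (b i) (b1 j) = (P *m G) i j.
  rewrite (bf_combl mI FH cW WM)// !mxE; apply: eq_bigr => k _.
  by rewrite /G mxE.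
have nvb i j : nv (b i) j = P i j.
  rewrite /nv /b /comb (bigD1 j)//= /b1 hndb eqxx mulr1 big1 ?addr0// => k kj.
  by rewrite hndb (inj_eq enum_val_inj) eq_sym (negbTE kj) mulr0.
exists N, d, b, y, c; split => //.
- move=> i j; rewrite [LHS](_ : _ = (P *m G *m P^T) i j).
    by have [<-|ij] := eqVneq i j; rewrite ?mul1r// mul0r hP.
  rewrite (bf_combr mI FH cW WM)// [RHS]mxE; apply: eq_bigr => k _.
  by rewrite bfP [P^T _ _]mxE mulrC.
- move=> i j; have := congr1 (fun A : 'M[R]_N => A j i) (mulmxV Pu); rewrite !mxE eq_sym => <-.
  by apply: eq_bigr => k _; rewrite nvb.
- move=> i a1 a2 u v; rewrite /y !mulr_sumr -big_split/=; apply: eq_bigr => j _.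
  by rewrite /nv /lin2; ring.
- move=> i n a u; rewrite /y; under [RHS]eq_bigr do rewrite mulr_sumr.
  rewrite exchange_big/=; apply: eq_bigr => j _; rewrite /nv /comb mulr_suml.
  by apply: eq_bigr => k _; rewrite mulrA.
- move=> i u hu z; rewrite /y big1// => j _; rewrite /nv.
  have [n2 In] := hnd (enum_val j); have [_ p] := FH _ hu.
  suff -> : u (nd (enum_val j)).1 (nd (enum_val j)).2 = 0 by rewrite mul0r.
  move: n2; case: (nd _).1 => [|[|//]] _; first exact: z.
  exact: (prim_zero fI (p 0%N isT) (p 1%N isT) z).
- move=> u hu yu.
  have nz j : nv u j = 0.
    pose r : 'rV[R]_N := \row_j nv u j.
    have rP : r *m invmx P = 0 by apply/rowP => i; rewrite !mxE -[RHS](yu i); apply: eq_bigr => k _; rewrite mxE.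
    have : r *m invmx P *m P = 0 by rewrite rP mul0mx.
    by rewrite mulmxKV// => /rowP /(_ j); rewrite !mxE.
  have [h1 h2] := horth u hu (fun t => etrans (congr1 (fun t => u (nd t).1 (nd t).2) (esym (enum_rankK t))) (nz (enum_rank t))).
  split => // i; rewrite (bf_combl mI FH cW WM)// big1// => j _; by rewrite h1 mulr0.
- move=> i di.
  (* If [d i = 0], the whole row [i] of [P G P^T] vanishes, hence that of [P G]: [b i] is
     form-orthogonal to every node function, and the criterion turns it into a solution. *)
  have row0 j : (P *m G) i j = 0.
    have r0 : row i (P *m G) *m P^T = 0.
      apply/rowP => k; rewrite -row_mul mxE [RHS]mxE.
      by have [<-|ik] := eqVneq i k; [|exact: hP].
    have : row i (P *m G) *m P^T *m invmx P^T = 0 by rewrite r0 mul0mx.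
    by rewrite mulmxK ?unitmx_tr// => /rowP /(_ j); rewrite !mxE.
  have e k x : b i k x = \sum_t P i (enum_rank t) * b0 t k x.
    rewrite /b /comb [RHS](reindex_onto enum_val enum_rank)/=; last by move=> t _; exact: enum_rankK.
    apply: eq_big => [j|j _]; first by rewrite enum_valK eqxx.
    by rewrite enum_valK.
  have [t|tau kt ht] := hcrit (fun t => P i (enum_rank t)).
    rewrite (@eq_bf _ _ _ _ (b i) _ (b1 (enum_rank t))).
    - by rewrite bfP row0.
    - by move=> k x _ _; rewrite e.
    - by move=> k x _ _; rewrite /b1 enum_rankK.
  by exists tau => // k x k3 Ix; rewrite e ht.
Qed.

(** [Some s] stands for the problem on [(-oo, s]], [None] for the one on the line. *)
Definition dset (s : option R) : set R := if s is Some s then halfline s else setT.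

Definition FF (s : option R) u : Prop :=
  H2on (dset s) u /\ (if s is Some s then clamped s u else True).

Definition KK W (s : option R) u : Prop :=
  [/\ sol W u, dec u & if s is Some s then clamped s u else decr u].

Lemma mdset s : measurable (dset s).
Proof. by case: s => [s|]; [exact: mhl|exact: measurableT]. Qed.

Lemma cvx_dset s : cvx (dset s).
Proof. by case: s => [s|]; [exact: cvx_hl|exact: cvxT]. Qed.

Lemma fat_dset s : fat (dset s).
Proof. by case: s => [s|]; [exact: fat_hl|exact: fatT]. Qed.

Lemma FF_H2 s u : FF s u -> H2on (dset s) u. Proof. by case. Qed.

Lemma FF_lin s a b u v : FF s u -> FF s v -> FF s (lin2 a b u v).
Proof.
move=> [hu cu] [hv cv]; split; first exact: H2on_lin (mdset s) hu hv.
by case: s cu cv {hu hv} => // s cu cv k k2; rewrite /lin2 cu// cv// !mulr0 addr0.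
Qed.

Lemma FF_comb s n (c : 'I_n -> R) (u : 'I_n -> nat -> R -> R) :
  (forall i, FF s (u i)) -> FF s (comb c u).
Proof.
move=> hu; split; first by apply: H2on_comb (mdset s) _ => i; case: (hu i).
case: s hu => // s hu k k2; rewrite /comb big1// => i _; by rewrite (hu i).2// mulr0.
Qed.

Lemma KK_comb W s n (c : 'I_n -> R) (t : 'I_n -> nat -> R -> R) :
  (forall i, KK W s (t i)) -> KK W s (comb c t).
Proof.
move=> h; split; first by apply: sol_comb => i; case: (h i).
  move=> k k4; apply: (@vanl_sum _ _ _ (fun i x => c i * t i k x)) => i.
  by apply: vanlZ; case: (h i) => _ + _; apply.
case: s h => [s|] h k k2.
  by rewrite /comb big1// => i _; case: (h i) => _ _ ->; rewrite ?mulr0.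
apply: (@eq_vanl _ (fun x => \sum_i c i * refl (t i) k x)).
  by exists 0 => x _; rewrite /refl /comb mulr_sumr; apply: eq_bigr => j _; ring.
apply: (@vanl_sum _ _ _ (fun i x => c i * refl (t i) k x)) => i.
by apply: vanlZ; case: (h i) => _ _; apply.
Qed.

Variables (W : R -> R) (M : R).
Hypothesis cW : continuous W.
Hypothesis WM : forall x, `|W x| <= M.
Variables (K delta : R).
Hypothesis d0 : 0 < delta.
Hypothesis Wl : forall x, x <= - K -> delta <= W x.
Hypothesis Wr : forall x, K <= x -> delta <= W x.

Lemma H2T_split (s : R) u : H2on (halfline s) u -> H2on [set x | s <= x] u -> H2on setT u.
Proof.
move=> h1 h2; have := H2on_glue (@measurableT _ R) (@cvxT R) (s := s) (u := u) (v := u) I.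
rewrite !setTI => h; apply: (eq_H2on (@measurableT _ R) (@cvxT R) _ (h h1 h2 erefl erefl)).
by move=> k x _ _; rewrite /glue; case: ifP.
Qed.

Lemma KK_FF s u : KK W s u -> FF s u.
Proof.
case: s => [s|] [su du h]; split => //; first exact: (dec_H2 cW WM d0 Wl).
apply: (H2T_split (s := K)); first exact: (dec_H2 cW WM d0 Wl).
exact: (decr_H2 cW WM d0 Wr).
Qed.

(** By parts. On the line, the boundary terms at [K] from the two half-lines cancel. *)
Lemma KK_bf s t v : KK W s t -> FF s v -> bf W (dset s) t v = 0.
Proof.
move=> kt; have ft := KK_FF kt; move: kt ft.
case: s => [s|] [su du h] [ft _] [hv cv].
  by rewrite (ibp_hl cW WM d0 Wl su du hv) Bd_clamped.
rewrite /= (bf_split cW WM K (@measurableT _ R) ft hv) !setTI.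
have h1 : H2on (halfline K) v by apply: H2onS hv => //; exact: measurableT.
have h2 : H2on [set x | K <= x] v by apply: H2onS hv => //; exact: measurableT.
by rewrite (ibp_hl cW WM d0 Wl su du h1) (ibp_hr cW WM d0 Wr su h h2) subrr.
Qed.

Lemma spec_half (s : R) :
  exists N (d : 'I_N -> R) b y c, spec (dset (Some s)) (FF (Some s)) (KK W (Some s)) W d b y c.
Proof.
have [T [nd [b [e [c r]]]]] := red_exists cW WM d0 Wl s.
apply: (@spec_of_broken _ _ _ W M T nd b c) => //.
- exact: mhl.
- exact: fat_hl.
- by move=> u; case.
- exact: (@FF_comb (Some s)).
- by case: r.
- by case: r.
- by case: r.
- by case: r.
- by move=> u [hu cu] hn; have [] := red_orth r hu cu hn.
- move=> y v hv; have ve k x : v k x = \sum_t y t * b t k x + \sum_j 0 * e j k x.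
    by rewrite [X in _ + X]big1 ?addr0// => j _; rewrite mul0r.
  have [t|u [su du hu]] := red_crit r (y := y) (z := fun=> 0).
    rewrite -[RHS](hv t); apply: eq_bf => // k x _ _; by rewrite ve.
  exists u; last by move=> k x k3 Ix; rewrite ve hu.
  split => // k k2; rewrite -hu//; last exact: ltn_trans k2 _.
  rewrite -ve /v big1// => t _; have [_ ct] := red_b r t.
  by rewrite ct// mulr0.
Qed.

(** The half-line [[K, +oo)] takes the place of a last segment: the form is coercive there because
    [W >= delta], and solutions decaying at +oo replace those clamped at the far end. *)
Lemma spec_full :
  exists N (d : 'I_N -> R) b y c, spec (dset None) (FF None) (KK W None) W d b y c.
Proof.
have [T [nd [b [e [c r0]]]]] := red_exists cW WM d0 Wl K.
have [c0 hnd hb he hndb hnde horth hcrit] := r0.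
have [r hr] : exists r : bool -> nat -> R -> R, forall j, sol W (r j) /\ unitdata K j (r j) /\ decr (r j).
  apply: (@choose_bool R (fun j u => sol W u /\ unitdata K j u /\ decr u)) => j.
  have [u [su du u0 u1]] := decr_exists cW WM d0 Wr (~~ j)%:R j%:R (lexx K).
  exists u; split => //; split => //.
  by move=> [|[|//]] _; [rewrite u0|rewrite u1]; case: j {u0 u1}.
pose zero : nat -> R -> R := fun=> fun=> 0.
have mT := @measurableT _ R; have cT := @cvxT R.
pose T' : finType := (T + bool)%type.
pose nd' (t : T') := match t with inl t => nd t | inr j => (nat_of_bool j, K) end.
pose b' (t : T') := match t with inl t => glue K (b t) zero | inr j => glue K (e j) (r j) end.
have hglue u v : H2on (halfline K) u -> H2on [set x | K <= x] v -> (forall k, (k < 2)%N -> u k K = v k K) ->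
    H2on setT (glue K u v).
  by move=> hu hv uv; apply: H2on_glue => //; rewrite ?setTI//; exact: uv.
have H2r u : sol W u -> decr u -> H2on [set x | K <= x] u.
  by move=> su du; exact: (decr_H2 cW WM d0 Wr).
have d00 : decr zero.
  by move=> k k4; apply: (@eq_vanl _ (fun=> 0)); [exists 0 => x _; rewrite /refl mulr0|exact: vanl0].
have z0 := sol0 W.
have bglue u v w : H2on (halfline K) u -> sol W v -> decr v -> (forall k, (k < 2)%N -> u k K = v k K) ->
    H2on setT w -> bf W setT (glue K u v) w = bf W (halfline K) u w - Bd v w K.
  move=> hu sv dv uv hw; rewrite (bf_glue cW WM)// ?setTI//; last exact: H2r.
  rewrite (ibp_hr cW WM d0 Wr sv dv)//; exact: (H2onS mT).
have gnd t u v : glue K u v (nd t).1 (nd t).2 = u (nd t).1 (nd t).2.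
  by rewrite glue_le//; case: (hnd t).
have bz t k : (k < 2)%N -> b t k K = zero k K by move=> k2; rewrite (hb t).2.
have erj j k : (k < 2)%N -> e j k K = r j k K by move=> k2; rewrite (he j).2// (hr j).2.1.
have Hr j : decr (r j) by case: (hr j) => _ [].
have hb' t : H2on setT (b' t).
  case: t => [t|j] /=.
  - by apply: hglue => //; [case: (hb t)|exact: H2on0|exact: bz].
  - by apply: hglue => //; [case: (he j)|apply: H2r => //; case: (hr j)|exact: erj].
apply: (@spec_of_broken _ _ _ W M T' nd' b' (Num.min c delta)) => //.
- exact: fatT.
- by move=> u; case.
- exact: (@FF_comb None).
- by rewrite lt_min c0 d0.
- move=> [t|j] /=; last by split => //; case: j.
  by have [? ?] := hnd t.
- move=> [t|j] [t'|j'] /=.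
  + by rewrite gnd hndb.
  + by rewrite gnd hnde.
  + by rewrite glue_le// (hb t').2//; case: j.
  + by rewrite glue_le// (he j').2//; case: j; case: j'.
- move=> u [hu _] und.
  have cus : clamped K u by move=> [|[|//]] _; [exact: (und (inr false))|exact: (und (inr true))].
  have hus : H2on (halfline K) u by apply: (H2onS mT) hu => //.
  have hur : H2on [set x | K <= x] u by apply: (H2onS mT) hu => //.
  have [w1 w2 w3] := horth u hus cus (fun t => und (inl t)).
  split.
  + case=> [t|j] /=.
      by rewrite bglue//; [rewrite w1 Bd_clamped// subrr|case: (hb t)|exact: bz].
    by rewrite bglue//; [rewrite w2 Bd_clamped// subrr|case: (he j)|case: (hr j)|exact: erj].
  + rewrite (bf_split cW WM K mT hu hu) (ip_split K mT hu hu) !setTI.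
    have sc := bf_right_ge cW WM Wr (lexx K) hur.
    have i1 := ip_ge0 (halfline K) u; have i2 := ip_ge0 [set x | K <= x] u.
    have m1 : Num.min c delta <= c by rewrite ge_min lexx.
    have m2 : Num.min c delta <= delta by rewrite ge_min lexx orbT.
    rewrite mulrDr; apply: lerD.
      by apply: le_trans w3; exact: ler_wpM2r.
    by apply: le_trans sc; exact: ler_wpM2r.
- move=> y v hv.
  pose y1 t := y (inl t); pose y2 j := y (inr j).
  pose v1 k x := \sum_t y1 t * b t k x + \sum_j y2 j * e j k x.
  pose sg k x := \sum_j y2 j * r j k x.
  have ssg : sol W sg by exact: (@sol_sumb R W y2 r (fun j => (hr j).1)).
  have dsg : decr sg.
    move=> k k4; apply: (@eq_vanl _ (fun x => \sum_j y2 j * refl (r j) k x)).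
      by exists 0 => x _; rewrite /refl /sg mulr_sumr; apply: eq_bigr => j _; ring.
    by apply: (@vanl_sum _ _ _ (fun j x => y2 j * refl (r j) k x)) => j; apply: vanlZ; exact: Hr.
  have ve k x : v k x = glue K v1 sg k x.
    rewrite /v big_sumType /= /b'; have [xs|xs] := leP x K.
      rewrite glue_le// /v1; congr (_ + _).
      - by apply: eq_bigr => t _; rewrite glue_le.
      - by apply: eq_bigr => t _; rewrite glue_le.
    rewrite glue_gt// /sg [X in X + _]big1 ?add0r; last by move=> t _; rewrite glue_gt// mulr0.
    by apply: eq_bigr => t _; rewrite glue_gt.
  have hv1 : H2on (halfline K) v1.
    have q1 := H2on_sumT y1 (mhl K) (fun t => (hb t).1).
    have q2 := H2on_sumT y2 (mhl K) (fun j => (he j).1).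
    apply: (eq_H2on _ _ _ (H2on_lin 1 1 (mhl K) q1 q2)) => //; first exact: cvx_hl.
    by move=> k x _ _; rewrite /lin2 !mul1r.
  have v1s k : (k < 2)%N -> v1 k K = y2 (k == 1).
    move=> k2; rewrite /v1 (unitdata_sum _ k2 (fun j => (he j).2)).
    by rewrite big1 ?add0r// => t _; rewrite (hb t).2// mulr0.
  have sgs k : (k < 2)%N -> sg k K = y2 (k == 1).
    by move=> k2; rewrite /sg (unitdata_sum _ k2 (fun j => (hr j).2.1)).
  have vsg k : (k < 2)%N -> v1 k K = sg k K by move=> k2; rewrite v1s// sgs.
  have hbf w : H2on setT w -> bf W setT v w = bf W (halfline K) v1 w - Bd sg w K.
    move=> hw; rewrite -bglue//; apply: eq_bf => // k x _ _; exact: ve.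
  have [t|tau [st dt tv]] := hcrit y1 y2.
    have := hv (inl t); rewrite hbf; last exact: hb'.
    rewrite /= Bd_clamped; last by move=> k k2; rewrite glue_le// (hb t).2.
    rewrite subr0 => hh; rewrite -[RHS]hh; apply: eq_bf => // k x _ xs.
    by rewrite /b' glue_le.
  have tsg : forall k x, (k < 5)%N -> tau k x = sg k x.
    apply: (sol_match WM st ssg _ (fun j => (he j).2) (fun j => (hr j).2.1)).
      by move=> k k2; rewrite -(tv k K (ltn_trans k2 (isT : (2 < 3)%N)) (lexx K)); exact: vsg.
    move=> j; have := hv (inr j); rewrite hbf; last exact: hb'.
    rewrite [X in X - _](_ : _ = Bd tau (e j) K); last first.
      rewrite -(ibp_hl cW WM d0 Wl st dt (he j).1); apply: eq_bf => k x k3 xs; first exact: tv.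
      by rewrite /= glue_le.
    move=> /eqP; rewrite subr_eq0 => /eqP ->.
    by rewrite /Bd /= !glue_le// (erj j 0%N)// (erj j 1%N).
  exists tau.
    split => // k k4; apply: (eq_vanl _ (dsg k k4)); exists 0 => x _.
    by rewrite /refl tsg//; exact: ltn_trans k4 _.
  move=> k x k3 _; rewrite ve.
  have [xs2|xs2] := leP x K; first by rewrite glue_le//; exact: tv.
  by rewrite glue_gt// tsg//; exact: ltn_trans k3 _.
Qed.

Lemma spec_exists s :
  exists N (d : 'I_N -> R) b y c, spec (dset s) (FF s) (KK W s) W d b y c.
Proof. by case: s => [s|]; [exact: spec_half|exact: spec_full]. Qed.

End SpecBuild.

(** * The index as a function of the spectral shift *)

Section Index.
Variable R : realType.
Local Notation mu := (@lebesgue_measure R).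
Implicit Types (D I : set R) (f g h : R -> R) (u v w : nat -> R -> R).

Hint Resolve mseg mhl mhr : core.

(** [g] jumps by [k x] just after [x] and is otherwise locally constant. *)
Lemma jump_list (g k : R -> nat) (B : R) :
  (forall x y, x < y -> y <= B -> (g x + k x <= g y)%N) ->
  (forall x, x <= B -> exists2 e, 0 < e & forall y, x - e < y -> y < x -> g y = g x) ->
  (forall x, x < B -> exists2 e, 0 < e & forall y, x < y -> y < x + e -> y <= B -> g y = (g x + k x)%N) ->
  (exists K, forall x, x <= K -> g x = 0%N) ->
  forall x0, x0 <= B -> exists xs : seq R, [/\ uniq xs,
    forall x, (x < x0 /\ (0 < k x)%N) <-> x \in xs & (\sum_(x <- xs) k x)%N = g x0].
Proof.
move=> mono left right [K low] x0.
have mono' x y : x <= y -> y <= B -> (g x <= g y)%N.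
  rewrite le_eqVlt => /predU1P[->//|xy] yB; exact: leq_trans (leq_addr _ _) (mono _ _ xy yB).
have [j] := ubnP (g x0); elim: j x0 => // j IH x0; rewrite ltnS => gj xB.
have [g0|g0] := posnP (g x0).
  exists [::]; split => //; last by rewrite big_nil.
  move=> x; split => // -[xx0 kx]; have := mono _ _ xx0 xB.
  by rewrite g0 leqn0 addn_eq0 => /andP[_ /eqP kx0]; rewrite kx0 in kx.
(* The supremum [s] is the last point at which [g] increases: [g] equals [g x0] after it and is
   smaller before it. Constancy just left of [s] makes [g s] smaller too, so the jump at [s]
   accounts for the whole difference, and the induction continues from [s]. *)
pose S := [set x : R | x <= x0 /\ (g x < g x0)%N].
have hs : has_sup S.
  split; last by exists x0 => x [].
  exists (Num.min K x0); split; first by rewrite ge_min lexx orbT.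
  by rewrite low ?ge_min ?lexx.
pose s := sup S.
have sx0 : s <= x0 by apply: ge_sup; [case: hs|move=> x []].
have below x : x < s -> (g x < g x0)%N.
  move=> xs; have [|y [yx0 gy] xy] := @sup_adherent _ S (s - x) _ hs; first by rewrite subr_gt0.
  apply: leq_ltn_trans gy; apply: mono'; last by lra.
  by rewrite -/s in xy; lra.
have above x : s < x -> x <= x0 -> g x = g x0.
  move=> sx xx0; apply/eqP; rewrite eqn_leq mono'//= leqNgt; apply/negP => gx.
  have : x <= s by apply: ub_le_sup; [case: hs|split].
  by lra.
have [e e0 he] := left s (le_trans sx0 xB).
have gs : (g s < g x0)%N.
  by rewrite -(he (s - e / 2)); [apply: below|..]; lra.
have slt : s < x0.
  by rewrite lt_neqAle sx0 andbT; apply: contraTneq gs => ->; rewrite ltnn.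
have [e1 e10 he1] := right s (lt_le_trans slt xB).
have jump : (g s + k s)%N = g x0.
  pose y := s + Num.min (e1 / 2) (x0 - s).
  have m1 : Num.min (e1 / 2) (x0 - s) <= e1 / 2 by rewrite ge_min lexx.
  have m2 : Num.min (e1 / 2) (x0 - s) <= x0 - s by rewrite ge_min lexx orbT.
  have m3 : 0 < Num.min (e1 / 2) (x0 - s) by rewrite lt_min; apply/andP; split; lra.
  have yx0 : y <= x0 by rewrite /y; lra.
  by rewrite -(he1 y) ?above// /y; lra.
have [|//|xs [uxs hxs sxs]] := IH s; [by apply: leq_trans gs _|by lra|].
exists (s :: xs); split.
- by rewrite /= uxs andbT; apply/negP => /hxs[]; rewrite ltxx.
- move=> x; rewrite inE; split.
    move=> [xx0 kx]; have [xs'|sx|//] := ltgtP x s; first by apply/hxs.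
    have := mono _ _ xx0 xB; rewrite above//; last exact: ltW.
    by rewrite -{2}[g x0]addn0 leq_add2l leqn0 => /eqP kx0; rewrite kx0 in kx.
  move=> /orP[/eqP ->|/hxs[xs' kx]]; last by split => //; lra.
  split => //; have := gs; rewrite -jump -{1}[g s]addn0 ltn_add2l; exact.
- by rewrite big_cons sxs addnC jump.
Qed.

Definition admissible (W : R -> R) : Prop := continuous W /\ exists M K d : R,
  [/\ 0 < d, forall x, `|W x| <= M & forall x, K <= `|x| -> d <= W x].

Lemma admissibleP W : admissible W -> exists M K d, [/\ continuous W, forall x, `|W x| <= M, 0 < d,
  forall x, x <= - K -> d <= W x & forall x, K <= x -> d <= W x].
Proof.
move=> [cW [M [K [d [d0 WM Wd]]]]]; exists M, K, d; split => // x h; apply: Wd.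
  by rewrite ler_normr; apply/orP; right; lra.
by rewrite ler_normr h.
Qed.

Lemma admissibleD W (l : R) : 0 <= l -> admissible W -> admissible (fun x => W x + l).
Proof.
move=> l0 [cW [M [K [d [d0 WM Wd]]]]]; split.
  by move=> x; apply: cvgD; [exact: cW|exact: cvg_cst].
exists (M + l), K, d; split => // x; last by move=> /Wd; lra.
by apply: le_trans (ler_normD _ _) _; rewrite (ger0_norm l0) lerD2r.
Qed.

(** [n] negative directions and a kernel of dimension [k]. *)
Definition idx W s (n k : nat) : Prop :=
  exists N (d : 'I_N -> R) b y c, [/\ spec (dset s) (FF s) (KK W s) W d b y c, n = nneg d & k = nnul d].

Definition negi W s (n : nat) (e : R) := negf (dset s) (FF s) W n e.

Section Fixed.
Variables (W : R -> R) (s : option R).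
Hypothesis aW : admissible W.

Lemma idx_exists : exists n k, idx W s n k.
Proof.
have [M [K [d0 [cW WM dp Wl Wr]]]] := admissibleP aW.
have [N [d [b [y [c sp]]]]] := spec_exists cW WM dp Wl Wr s.
by exists (nneg d), (nnul d), N, d, b, y, c.
Qed.

Lemma idx_neg n k : idx W s n k -> exists2 e, 0 < e & negi W s n e.
Proof.
have [M [K [d0 [cW WM dp Wl Wr]]]] := admissibleP aW.
move=> [N [d [b [y [c [sp -> _]]]]]].
exact: (negf_spec (mdset s) (@FF_H2 _ s) (@FF_comb _ s) (@FF_lin _ s) cW WM sp).
Qed.

Lemma idx_np n k e : idx W s n k -> 0 < e -> negi W s (n + k) (- e).
Proof.
have [M [K [d0 [cW WM dp Wl Wr]]]] := admissibleP aW.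
move=> [N [d [b [y [c [sp -> ->]]]]]].
exact: (npf_spec (mdset s) (@fat_dset _ s) (@FF_H2 _ s) (@FF_comb _ s) (@FF_lin _ s) cW WM sp).
Qed.

Lemma idx_le n k m : idx W s n k -> negi W s m 0 -> (m <= n)%N.
Proof.
have [M [K [d0 [cW WM dp Wl Wr]]]] := admissibleP aW.
move=> [N [d [b [y [c [sp -> _]]]]]].
exact: (negf_le (mdset s) (@FF_H2 _ s) (@FF_comb _ s) (@FF_lin _ s) cW WM sp).
Qed.

Lemma idx_np_le n k : idx W s n k ->
  exists2 e, 0 < e & forall m, negi W s m (- e) -> (m <= n + k)%N.
Proof.
have [M [K [d0 [cW WM dp Wl Wr]]]] := admissibleP aW.
move=> [N [d [b [y [c [sp -> ->]]]]]].
exact: (npf_le (mdset s) (@FF_H2 _ s) (@FF_comb _ s) (@FF_lin _ s) cW WM sp).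
Qed.

Lemma idx_ker n k : idx W s n k -> exists t : 'I_k -> nat -> R -> R,
  (forall i, KK W s (t i)) /\ lin_indep_on (dset s) (fun i => t i 0%N).
Proof.
have [M [K [d0 [cW WM dp Wl Wr]]]] := admissibleP aW.
move=> [N [d [b [y [c [sp _ ->]]]]]].
exact: (spec_ker (mdset s) (@fat_dset _ s) (@FF_H2 _ s) (@FF_comb _ s) (@FF_lin _ s) cW WM sp).
Qed.

Lemma aKK_FF u : KK W s u -> FF s u.
Proof.
have [M [K [d0 [cW WM dp Wl Wr]]]] := admissibleP aW.
exact: (KK_FF cW WM dp Wl Wr).
Qed.

Lemma aKK_bf u v : KK W s u -> FF s v -> bf W (dset s) u v = 0.
Proof.
have [M [K [d0 [cW WM dp Wl Wr]]]] := admissibleP aW.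
exact: (KK_bf cW WM dp Wl Wr).
Qed.

Lemma idx_ker_le n k m (t : 'I_m -> nat -> R -> R) : idx W s n k ->
  (forall i, KK W s (t i)) -> lin_indep_on (dset s) (fun i => t i 0%N) -> (m <= k)%N.
Proof.
have [M [K [d0 [cW WM dp Wl Wr]]]] := admissibleP aW.
move=> [N [d [b [y [c [sp _ ->]]]]]].
exact: (spec_ker_le (mdset s) (@fat_dset _ s) (@FF_H2 _ s) (@FF_comb _ s) (@FF_lin _ s) cW WM sp aKK_FF aKK_bf).
Qed.

Lemma idx_np0 n k : idx W s n k -> exists u : 'I_(n + k) -> nat -> R -> R, (forall i, FF s (u i)) /\
  forall C : 'I_(n + k) -> R, bf W (dset s) (comb C u) (comb C u) <= 0 /\
    ((exists i, C i != 0) -> 0 < ip (dset s) (comb C u) (comb C u)).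
Proof.
have [M [K [d0 [cW WM dp Wl Wr]]]] := admissibleP aW.
move=> [N [d [b [y [c [sp -> ->]]]]]].
exact: (np0_spec (mdset s) (@fat_dset _ s) (@FF_H2 _ s) (@FF_comb _ s) (@FF_lin _ s) cW WM sp).
Qed.

Lemma idx_negq n k : idx W s n k ->
  exists2 e, 0 < e & exists u : 'I_n -> nat -> R -> R, (forall i, FF s (u i)) /\
  forall C : 'I_n -> R, bf W (dset s) (comb C u) (comb C u) <= - e * \sum_i C i ^+ 2.
Proof.
have [M [K [d0 [cW WM dp Wl Wr]]]] := admissibleP aW.
move=> [N [d [b [y [c [sp -> _]]]]]].
exact: (negq_spec (mdset s) (@FF_H2 _ s) (@FF_comb _ s) (@FF_lin _ s) cW WM sp).
Qed.

Lemma idx_np0_le n k m (u : 'I_m -> nat -> R -> R) : idx W s n k ->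
  (forall i, FF s (u i)) -> (forall C, bf W (dset s) (comb C u) (comb C u) <= 0) ->
  (forall C t, KK W s t -> (forall x, dset s x -> comb C u 0%N x = t 0%N x) -> forall i, C i = 0) ->
  (m <= n)%N.
Proof.
have [M [K [d0 [cW WM dp Wl Wr]]]] := admissibleP aW.
move=> [N [d [b [y [c [sp -> _]]]]]].
exact: (np0_le (mdset s) (@fat_dset _ s) (@FF_H2 _ s) (@FF_comb _ s) (@FF_lin _ s) cW WM sp (@KK_comb _ W s)).
Qed.

Lemma idx_inverse_bound n : idx W s n 0 -> exists2 C, 0 <= C & forall u g, FF s u -> L2 (dset s) g ->
  (forall v, FF s v -> bf W (dset s) u v + integ (dset s) (fun x => g x * v 0%N x) = 0) ->
  ip (dset s) u u <= C * integ (dset s) (fun x => g x ^+ 2).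
Proof.
have [M [K [d0 [cW WM dp Wl Wr]]]] := admissibleP aW.
move=> [N [d [b [y [c [sp _ /esym nn0]]]]]].
exact: (spec_inverse_bound (mdset s) (@FF_H2 _ s) (@FF_comb _ s) (@FF_lin _ s) cW WM sp nn0).
Qed.

Lemma negi_weak n e e' : e' <= e -> negi W s n e -> negi W s n e'.
Proof.
move=> ee [u [hu h]]; exists u; split => // c /h; apply: le_lt_trans.
by rewrite lerD2l ler_wpM2r ?ip_ge0.
Qed.

Lemma bf_shift l u v : FF s u -> FF s v ->
  bf (fun x => W x + l) (dset s) u v = bf W (dset s) u v + l * ip (dset s) u v.
Proof.
have [M [K [d0 [cW WM dp Wl Wr]]]] := admissibleP aW.
move=> [hu _] [hv _]; have ms := mdset s; rewrite /ip /bf -integZ//; last exact: ip_itg (mdset s) hu hv.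
rewrite -integD; [|exact: mdset|exact: (bf_itg cW WM (mdset s) hu hv)|].
  by apply: eq_integ => x _; ring.
by apply: itgZ; [exact: mdset|exact: ip_itg (mdset s) hu hv].
Qed.

Lemma negi_shift n e l : negi (fun x => W x + l) s n e <-> negi W s n (e + l).
Proof.
split => -[u [hu h]]; exists u; split => // c /h;
  have hc := FF_comb c hu; rewrite bf_shift//; lra.
Qed.

End Fixed.

Section Lambda.
Variables (V : R -> R) (s : option R).
Hypothesis aV : admissible V.

Let aVl (l : R) : 0 <= l -> admissible (fun x => V x + l).
Proof. by move=> ?; exact: admissibleD. Qed.

(** At shift [l] the form is below any positive multiple of the squared norm on an
    [n + k]-dimensional space; with the multiple [l - l'] this is negativity at shift [l']. *)
Lemma idx_shift_mono (l l' : R) n k n' k' : 0 <= l' -> l' < l ->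
  idx (fun x => V x + l) s n k -> idx (fun x => V x + l') s n' k' -> (n + k <= n')%N.
Proof.
move=> l0 ll h h'; apply: (idx_le (aVl l0) h').
apply/(negi_shift s aV); rewrite add0r.
have := idx_np (aVl (ltW (le_lt_trans l0 ll))) h (e := l - l').
rewrite subr_gt0 => /(_ ll) /(negi_shift s aV).
by rewrite opprB subrK.
Qed.

(** The diagonalization is not canonical, but [n] is the largest dimension of a negative space and
    [k] the dimension of the kernel. *)
Lemma idx_unique (l : R) n k n' k' : 0 <= l ->
  idx (fun x => V x + l) s n k -> idx (fun x => V x + l) s n' k' -> n = n' /\ k = k'.
Proof.
move=> l0 h h'; have al := aVl l0.
have [e e0 he] := idx_neg al h; have [e' e0' he'] := idx_neg al h'.
have [t [kt it]] := idx_ker al h; have [t' [kt' it']] := idx_ker al h'.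
have nn : n = n'.
  apply/eqP; rewrite eqn_leq (idx_le al h' (negi_weak (ltW e0) he)).
  by rewrite (idx_le al h (negi_weak (ltW e0') he')).
by split => //; apply/eqP; rewrite eqn_leq (idx_ker_le al h' kt it) (idx_ker_le al h kt' it').
Qed.

(** Pairing [u] with [v] in the unshifted form gives [- l] or [- l'] times their inner product,
    according to which of the two is taken as the solution; symmetry does the rest. *)
Lemma KK_orth (l l' : R) u v : 0 <= l -> 0 <= l' -> l != l' ->
  KK (fun x => V x + l) s u -> KK (fun x => V x + l') s v -> ip (dset s) u v = 0.
Proof.
move=> l0 l0' ll ku kv.
have hu := aKK_FF (aVl l0) ku; have hv := aKK_FF (aVl l0') kv.
have := aKK_bf (aVl l0) ku hv; have := aKK_bf (aVl l0') kv hu.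
rewrite !bf_shift// bfC (ipC _ v) => h1 h2.
have : (l - l') * ip (dset s) u v = 0 by lra.
by move=> /eqP; rewrite mulf_eq0 subr_eq0 (negbTE ll) => /eqP.
Qed.

(** Kernels at different shifts are orthogonal in L2, so their bases together stay independent. *)
Lemma eigen_family (ls : seq R) (kf : R -> nat) : uniq ls -> (forall l, l \in ls -> 0 <= l) ->
  (forall l, l \in ls -> exists n, idx (fun x => V x + l) s n (kf l)) ->
  exists (lam : 'I_(\sum_(l <- ls) kf l) -> R) us,
    (forall i, lam i \in ls /\ KK (fun x => V x + lam i) s (us i)) /\
    lin_indep_on (dset s) (fun i => us i 0%N).
Proof.
elim: ls => [|l ls IH] /=.
  move=> _ _ _; rewrite big_nil; exists (fun=> 0), (fun=> fun=> fun=> 0); split; by [case|move=> c _ []].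
move=> /andP[lls uls] ls0 hk; rewrite big_cons.
have [||lam [us [hus ius]]] := IH uls.
- by move=> l' ?; apply: ls0; rewrite inE orbC; apply/orP; left.
- by move=> l' ?; apply: hk; rewrite inE orbC; apply/orP; left.
have l0 : 0 <= l by apply: ls0; rewrite inE eqxx.
have [n hn] : exists n, idx (fun x => V x + l) s n (kf l) by apply: hk; rewrite inE eqxx.
have [t [kt it]] := idx_ker (aVl l0) hn.
set m := (\sum_(j <- ls) kf j)%N in lam us hus ius *.
have lam0 i : 0 <= lam i by apply: ls0; rewrite inE (hus i).1 orbT.
have Ft i : FF s (t i) by apply: aKK_FF (kt i); exact: aVl.
have Fu i : FF s (us i) by apply: aKK_FF (hus i).2; exact: aVl.
exists (fun i => match fintype.split i with inl _ => l | inr j => lam j end).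
exists (fun i => match fintype.split i with inl j => t j | inr j => us j end); split.
  move=> i; case: (fintype.split i) => j; first by split => //; rewrite inE eqxx.
  by have [h1 h2] := hus j; rewrite inE h1 orbT.
move=> c hc; pose A := comb (fun i => c (lshift m i)) t; pose B := comb (fun i => c (rshift (kf l) i)) us.
have AB x : dset s x -> A 0%N x + B 0%N x = 0.
  move=> sx; rewrite -[RHS](hc x sx) big_split_ord/=; congr (_ + _); apply: eq_bigr => i _.
    by rewrite (unsplitK (inl i : 'I_(kf l) + 'I_m)%type).
  by rewrite (unsplitK (inr i : 'I_(kf l) + 'I_m)%type).
have FA : FF s A by exact: FF_comb.
have FB : FF s B by exact: FF_comb.
have ms := mdset s.
have ipAB : ip (dset s) A B = 0.
  rewrite (ip_comb _ ms)//; [|by move=> i; case: (Ft i)|by case: FB].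
  rewrite big1// => i _; rewrite ipC (ip_comb _ ms)//; [|by move=> j; case: (Fu j)|by case: (Ft i)].
  rewrite big1 ?mulr0// => j _; rewrite (KK_orth _ _ _ (hus j).2 (kt i)) ?mulr0//.
  by apply: contraNneq lls => <-; case: (hus j).
have A0 : forall x, dset s x -> A 0%N x = 0.
  apply: (ip_eq0 ms (@fat_dset _ s)); first by case: FA.
  have -> : ip (dset s) A A = 1 * ip (dset s) A A + 1 * ip (dset s) B A.
    by rewrite (ipC _ B) ipAB !mul1r addr0.
  rewrite -(ip_lin 1 1 ms); [|by case: FA|by case: FB|by case: FA].
  rewrite (@eq_ip _ _ _ (fun=> fun=> 0) _ A)//; last by move=> x sx; rewrite /lin2 !mul1r AB.
  by rewrite /ip (@eq_integ _ _ _ (fun=> 0)) ?integ0// => x _; rewrite mul0r.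
have B0 x : dset s x -> B 0%N x = 0 by move=> sx; have := AB x sx; rewrite A0// add0r.
move=> i; case: (split_ordP i) => j ->; [exact: (it _ A0)|exact: (ius _ B0)].
Qed.

(** Raising the potential [V + lam] from [lam = 0] to [lam = M + 1] removes the [n]
    negative directions one kernel at a time. *)
Lemma eigen_count n k : idx V s n k -> exists (lam : 'I_n -> R) us,
    (forall i, 0 < lam i /\ KK (fun x => V x + lam i) s (us i)) /\
    lin_indep_on (dset s) (fun i => us i 0%N).
Proof.
move=> hnk.
have hV : (fun x => V x + 0) = V by apply/funext => x; rewrite addr0.
have hnk0 : idx (fun x => V x + 0) s n k by rewrite hV.
(* [jump_list] concerns nondecreasing functions, so the shift is parametrized by [l = - x]; the
   truncation at 0 keeps the potential admissible for [x > 0]. *)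
pose l_ (x : R) := Num.max 0 (- x).
have l0 x : 0 <= l_ x by rewrite le_max lexx.
have lE x : x <= 0 -> l_ x = - x by move=> x0; rewrite /l_ max_r//; lra.
have [g [kf hg]] : exists (g kf : R -> nat), forall x, idx (fun y => V y + l_ x) s (g x) (kf x).
  have h x : exists nk : nat * nat, idx (fun y => V y + l_ x) s nk.1 nk.2.
    by have [a [b hab]] := idx_exists s (aVl (l0 x)); exists (a, b).
  exists (fun x => (sval (cid (h x))).1), (fun x => (sval (cid (h x))).2) => x.
  by case: cid.
have mono x y : x < y -> y <= 0 -> (g x + kf x <= g y)%N.
  move=> xy y0; apply: (idx_shift_mono (l0 y) _ (hg x) (hg y)).
  by rewrite !lE//; lra.
have [|||xs [uxs hxs sxs]] := @jump_list g kf 0 mono _ _ _ 0 (lexx 0).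
- move=> x x0; have [e e0 he] := idx_neg (aVl (l0 x)) (hg x); exists e => // y xy yx.
  apply/eqP; rewrite eqn_leq (leq_trans (leq_addr _ _) (mono _ _ yx x0))/=.
  apply: (idx_le (aVl (l0 y)) (hg y)); apply/(negi_shift s aV).
  move/(negi_shift s aV): he; apply: negi_weak; rewrite !lE; lra.
- move=> x x0; have [e e0 he] := idx_np_le (aVl (l0 x)) (hg x); exists e => // y xy yx y0.
  apply/eqP; rewrite eqn_leq mono// andbT; apply: he.
  have [e1 e10 h1] := idx_neg (aVl (l0 y)) (hg y).
  apply/(negi_shift s aV); move/(negi_shift s aV): h1; apply: negi_weak; rewrite !lE; lra.
- have [M [K [d0 [cV VM dp Wl Wr]]]] := admissibleP aV.
  (* With a shift above [M] the potential is nonnegative, so the form has no negative direction. *)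
  exists (- (`|M| + 1)) => x xM; have [e e0 [u [hu h]]] := idx_neg (aVl (l0 x)) (hg x).
  have nM := normr_ge0 M; have nM' := ler_norm M.
  case gx : (g x) u hu h => [//|m] u hu h; exfalso.
  have := h (fun=> 1) (ex_intro _ ord0 (oner_neq0 _)).
  have [hc _] := FF_comb (fun=> 1) hu.
  have p0 := ip_ge0 (dset s) (comb (fun=> 1) u).
  suff : 0 <= bf (fun y => V y + l_ x) (dset s) (comb (fun=> 1) u) (comb (fun=> 1) u).
    by have := mulr_ge0 (ltW e0) p0; lra.
  apply: integ_ge0 => y _; rewrite -!expr2 addr_ge0 ?sqr_ge0// mulr_ge0 ?sqr_ge0//.
  by have := VM y; rewrite ler_norml lE; lra.
have [l00 k0] : g 0 = n /\ kf 0 = k.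
  by apply: (idx_unique (lexx 0)) _ hnk0; have := hg 0; rewrite lE// oppr0.
have [|||lam [us [hus ius]]] := @eigen_family (map (fun x => - x) xs) (fun l => kf (- l)).
- by rewrite map_inj_uniq//; exact: oppr_inj.
- by move=> l /mapP[x /hxs[x0 _] ->]; lra.
- move=> l /mapP[x /hxs[x0 _] ->]; exists (g x); rewrite opprK.
  by have := hg x; rewrite lE//; lra.
move: lam us hus ius; rewrite big_map.
rewrite (eq_bigr kf) => [|x _]; last by rewrite opprK.
rewrite sxs l00 => lam us hus ius; exists lam, us; split => // i.
have [/mapP[x /hxs[x0 _] e] h] := hus i; split => //; rewrite e; lra.
Qed.

End Lambda.
End Index.

(** * Eigenfunctions in H^4 and the number of positive eigenvalues *)

Section Strong.
Variable R : realType.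
Local Notation mu := (@lebesgue_measure R).
Implicit Types (D I : set R) (f g h : R -> R) (u v w : nat -> R -> R).

Hint Resolve mseg mhl mhr : core.

Definition H4c I u : Prop :=
  (forall k, (k <= 4)%N -> L2 I (u k)) /\ (forall k, (k < 4)%N -> prim I (u k) (u k.+1)).

Lemma segE (x y : R) : [set t | (x <= t <= y)%R] = `[x, y]%classic.
Proof. by apply/seteqP; split => t /=; rewrite in_itv. Qed.

Lemma H4onP I u : H4on I u <-> H4c I u.
Proof.
split => -[l p]; split => // k k4 x y Ix Iy xy; have := p k k4 x y Ix Iy xy; rewrite segE => -[i e].
  by split => //; apply: EFin_inj; rewrite EFin_integ.
by split => //; rewrite e EFin_integ.
Qed.

Lemma H4_H2 I u : H4c I u -> H2on I u.
Proof.
by move=> [l p]; split => k kk; [apply: l; apply: ltnW|apply: p]; exact: leq_trans kk _.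
Qed.

Lemma integ_hr_prim (s : R) G g : prim [set x | s <= x] G g -> itg [set x | s <= x] g ->
  vanl (fun x => G (- x)) -> integ [set x | s <= x] g = - G s.
Proof.
move=> p gi v; have [gi' e] := reflect_itg (mhr s) gi.
have p' := reflect_prim p; rewrite /= hr_refl in p' gi' e.
have gin : itg (halfline (- s)) (fun x => - g (- x)) by exact: itgN.
have := integ_hl_prim p' gin v; rewrite opprK -e => <-.
rewrite (@eq_integ _ _ (fun x => - g (- x)) (fun x => -1 * g (- x))) => [|x _]; last by rewrite mulN1r.
by rewrite integZ//; ring.
Qed.

Lemma vanr_L2 (s : R) f f1 f2 : prim [set x | s <= x] f f1 -> prim [set x | s <= x] f1 f2 ->
  L2 [set x | s <= x] f -> L2 [set x | s <= x] f2 ->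
  vanl (fun x => f (- x)) /\ vanl (fun x => f1 (- x)).
Proof.
move=> p p1 l l2.
have q := reflect_prim p; have q1 := primZ (-1) (reflect_prim p1).
have m := reflect_L2 (mhr s) l; have m2 := reflect_L2 (mhr s) l2.
rewrite /= hr_refl in q q1 m m2.
have q1' : prim (halfline (- s)) (fun x => - f1 (- x)) (fun x => f2 (- x)).
  by apply: (eq_prim _ _ _ q1); [exact: cvx_hl|move=> x _; ring|move=> x _; ring].
have [v v1] := vanl_L2 q q1' m m2; split => //.
apply: (eq_vanl _ (vanlZ (-1) v1)); exists 0 => x _; ring.
Qed.

Lemma H4_vanl (s : R) u k : H4c (halfline s) u -> (k < 4)%N -> vanl (u k).
Proof.
move=> [l p]; case: k => [|k] k4.
  by have [] := vanl_L2 (p 0%N isT) (p 1%N isT) (l 0%N isT) (l 2%N isT).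
case: k k4 => [|[|[|//]]] _.
- by have [] := vanl_L2 (p 0%N isT) (p 1%N isT) (l 0%N isT) (l 2%N isT).
- by have [] := vanl_L2 (p 1%N isT) (p 2%N isT) (l 1%N isT) (l 3%N isT).
- by have [] := vanl_L2 (p 2%N isT) (p 3%N isT) (l 2%N isT) (l 4%N isT).
Qed.

Lemma H4_vanr (s : R) u k : H4c [set x | s <= x] u -> (k < 4)%N -> vanl (fun x => u k (- x)).
Proof.
move=> [l p]; case: k => [|k] k4.
  by have [] := vanr_L2 (p 0%N isT) (p 1%N isT) (l 0%N isT) (l 2%N isT).
case: k k4 => [|[|[|//]]] _.
- by have [] := vanr_L2 (p 0%N isT) (p 1%N isT) (l 0%N isT) (l 2%N isT).
- by have [] := vanr_L2 (p 1%N isT) (p 2%N isT) (l 1%N isT) (l 3%N isT).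
- by have [] := vanr_L2 (p 2%N isT) (p 3%N isT) (l 2%N isT) (l 4%N isT).
Qed.

Lemma H4S I J u : measurable I -> measurable J -> J `<=` I -> H4c I u -> H4c J u.
Proof.
move=> mI mJ JI [l p]; split => k k4; first exact: (L2S mI mJ JI (l k k4)).
exact: primS JI (p k k4).
Qed.

Variables (V : R -> R).
Hypothesis aV : admissible V.

(** The integrand agrees almost everywhere with the derivative of [Bd u v], and [Bd u v] vanishes at
    every end: by the clamping of [v], or because [u], [v] and the derivatives involved decay. *)
Lemma weak_form s u v g : H4c (dset s) u -> FF s v -> L2 (dset s) g ->
  {ae mu, forall x, dset s x -> - u 4%N x - 2 * u 2%N x - u 0%N x - V x * u 0%N x = g x} ->
  bf V (dset s) u v + integ (dset s) (fun x => g x * v 0%N x) = 0.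
Proof.
move=> hu [hv cv] lg ae; have ms := mdset s.
have [M [K [d0 [cV VM dp Wl Wr]]]] := admissibleP aV.
have hp : prim (dset s) (Bd u v) (fun x => (u 2%N x + u 0%N x) * v 2%N x - (u 4%N x + u 2%N x) * v 0%N x).
  by apply: Bd_prim; [exact: cvx_dset|case: hu|case: hv].
set h := (X in prim _ _ X) in hp.
have lu k : (k <= 4)%N -> L2 (dset s) (u k) by case: hu => + _; exact.
have lv k : (k < 3)%N -> L2 (dset s) (v k) by case: hv => + _; exact.
have hi : itg (dset s) h.
  by apply: itgB => //; apply: L2M => //; [exact: L2D ms (lu 2%N isT) (lu 0%N isT)|exact: lv|
    exact: L2D ms (lu 4%N isT) (lu 2%N isT)|exact: lv].
have bi := bf_itg cV VM ms (H4_H2 hu) hv.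
have gi := L2M ms lg (lv 0%N isT).
rewrite -[LHS]/(integ _ _ + _) -integD//.
have -> : integ (dset s) (fun x => (u 2%N x + u 0%N x) * (v 2%N x + v 0%N x) + V x * (u 0%N x * v 0%N x) +
    g x * v 0%N x) = integ (dset s) h.
  apply: ae_integ => //; [exact: (itg_meas (itgD ms bi gi))|exact: itg_meas hi|].
  apply: aeS ae => x e /e <-; rewrite /h; ring.
case: s hu hv cv lg ae ms hp hi bi gi lu lv => [s|] hu hv cv lg ae ms hp hi bi gi lu lv.
  rewrite (integ_hl_prim hp hi) ?Bd_clamped//.
  by have [v0 v1] := H2on_vanl hv; apply: vanl_Bd => // k k4; exact: H4_vanl hu k4.
have mT := @measurableT _ R.
have uL : H4c (halfline 0) u by apply: (H4S mT) hu.
have uR : H4c [set x | 0 <= x] u by apply: (H4S mT) hu.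
have vL : H2on (halfline 0) v by apply: (H2onS mT) hv.
have vR : H2on [set x | 0 <= x] v by apply: (H2onS mT) hv.
have [v0 v1] := H2on_vanl vL.
have [w0 w1] := vanr_L2 (vR.2 0%N isT) (vR.2 1%N isT) (vR.1 0%N isT) (vR.1 2%N isT).
rewrite (integ_TD 0 hi) (@integ_hl_prim R 0 (Bd u v)); last 3 first.
- exact: primS hp.
- exact: (itgS mT).
- by apply: vanl_Bd => // k k4; exact: H4_vanl uL k4.
rewrite (@integ_hr_prim 0 (Bd u v)) ?subrr//.
- exact: primS hp.
- exact: (itgS mT).
- apply: vanlB; apply: vanlM => //; apply: vanlD; exact: H4_vanr uR _.
Qed.

Lemma KK_H4 (l : R) s u : 0 <= l -> KK (fun x => V x + l) s u -> H4c (dset s) u.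
Proof.
move=> l0 [su du h]; have al := admissibleD l0 aV.
have [M [K [d0 [cW WM dp Wl Wr]]]] := admissibleP al.
split; last by move=> k k4 x y _ _; exact: su.1.
case: s h => [s|] h k k4; first exact: (dec_L2 cW WM dp Wl s su du).
rewrite [dset _](_ : _ = halfline 0 `|` [set x | 0 <= x]); last first.
  by apply/seteqP; split => // x _; have [x0|/ltW x0] := leP x 0; [left|right].
apply: L2U => //; first exact: (dec_L2 cW WM dp Wl 0 su du).
have Wd' x : x <= - K -> d0 <= V (- x) + l by move=> xK; apply: Wr; lra.
have cW' : continuous (fun x => V (- x) + l) by move=> x; apply: (@continuous_comp _ _ _ (fun y : R => - y) (fun y => V y + l)); [exact: opp_continuous|exact: cW].
have := dec_L2 cW' (fun x => WM (- x)) dp Wd' 0 (refl_sol su) h k4.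
move/(reflect_L2 (mhl 0)); have := hl_refl (0 : R); rewrite oppr0 => -> /(L2Z ((-1) ^+ k) (mhr 0)).
apply: eq_L2 => // x _; rewrite -[u k x]refl_refl //.
Qed.

Definition dom s : (nat -> R -> R) -> Prop := if s is Some s then dom_half s else @dom_full R.

Lemma domP s u : dom s u <-> H4c (dset s) u /\ (if s is Some s then clamped s u else True).
Proof.
case: s => [s|] /=; last by split => [/H4onP|[/H4onP]].
split => [[/H4onP h [u0 u1]]|[/H4onP h c]]; first by split => // -[|[|//]] _.
by split => //; rewrite !c.
Qed.

Lemma dom_FF s u : dom s u -> FF s u.
Proof. by move/domP => [/H4_H2 h c]. Qed.

Variables (nu m : R) (phi : R -> R).
Hypothesis VE : forall x, V x = - fnl' nu m (phi x).

Lemma LexprE u x : Lexpr nu m phi u x = - u 4%N x - 2 * u 2%N x - u 0%N x - V x * u 0%N x.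
Proof. by rewrite /Lexpr VE; ring. Qed.

Lemma KK_eigenfun (l : R) s u : 0 <= l -> KK (fun x => V x + l) s u -> (exists x, dset s x /\ u 0%N x <> 0) ->
  eigenfun (dom s) (dset s) nu m phi l u.
Proof.
move=> l0 ku u0; split; first by apply/domP; split; [exact: KK_H4 ku|case: s ku {u0} => // s []].
split => //; apply: aeW => x _; case: ku => -[_ e] _ _.
by rewrite LexprE e; ring.
Qed.

Lemma eigenfun_bf l s u v : eigenfun (dom s) (dset s) nu m phi l u -> FF s v ->
  bf V (dset s) u v = - l * ip (dset s) u v.
Proof.
move=> [/domP[h4 _] [_ ae]] hv; have l0 := h4.1 0%N isT.
have := @weak_form s u v (fun x => l * u 0%N x) h4 hv (L2Z l (mdset s) l0).
have -> : integ (dset s) (fun x => l * u 0%N x * v 0%N x) = l * ip (dset s) u v.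
  rewrite -integZ; first by apply: eq_integ => x _; rewrite mulrA.
    exact: mdset.
  by apply: (ip_itg (mdset s)) (H4_H2 h4) _; case: hv.
move=> h; have : bf V (dset s) u v + l * ip (dset s) u v = 0.
  by apply: h; apply: aeS ae => x e /e; rewrite LexprE.
by move=> e; rewrite mulNr; apply/eqP; rewrite -addr_eq0 e.
Qed.

(** On a combination of eigenfunctions [u i] with coefficients [c i] the form equals
    minus the squared norm of the combination with coefficients [sqrt (lam i) * c i]. *)
Lemma eigs_negi s n : has_pos_eigs (dom s) (dset s) nu m phi n -> negi V s n 0.
Proof.
move=> [lam [us [hus ius]]]; have ms := mdset s.
have Fu i : FF s (us i) by apply: dom_FF; case: (hus i) => _ [].
exists us; split => // c [i0 ci0]; rewrite mul0r addr0.
have Fc := FF_comb c Fu.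
pose w := comb (fun i => Num.sqrt (lam i) * c i) us.
have Fw : FF s w by exact: FF_comb.
have sym i j : (lam i - lam j) * ip (dset s) (us i) (us j) = 0.
  have := eigenfun_bf (hus i).2 (Fu j); have := eigenfun_bf (hus j).2 (Fu i).
  rewrite bfC (ipC _ (us j)) => -> ; lra.
have [M [K [d0 [cV VM dp Wl Wr]]]] := admissibleP aV.
have -> : bf V (dset s) (comb c us) (comb c us) = - ip (dset s) w w.
  rewrite (bf_combl ms (@FF_H2 _ s) cV VM)// (ip_comb _ ms); [|by move=> i; case: (Fu i)|by case: Fw].
  rewrite -sumrN; apply: eq_bigr => i _.
  rewrite (bf_combr ms (@FF_H2 _ s) cV VM)// ipC (ip_comb _ ms); [|by move=> j; case: (Fu j)|by case: (Fu i)].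
  rewrite !mulr_sumr -sumrN; apply: eq_bigr => j _.
  rewrite (eigenfun_bf (hus i).2)// (ipC _ (us j)).
  (* If the eigenvalues differ, the entry vanishes by orthogonality; if they agree, [lam i] is the
     product of the two square roots. Repeated eigenvalues thus need no orthogonalization. *)
  have := sym i j; have [->|ll] := eqVneq (lam i) (lam j).
    move=> _; have := sqr_sqrtr (ltW (hus j).1); move: (Num.sqrt _) => q <-; ring.
  by move=> /eqP; rewrite mulf_eq0 subr_eq0 (negbTE ll) /= => /eqP ->; rewrite !mulr0 oppr0.
rewrite oppr_lt0 lt_neqAle ip_ge0 andbT eq_sym; apply: contraNneq ci0 => e.
have z := ip_eq0 ms (@fat_dset _ s) (FF_H2 Fw) e.
have := ius _ z i0 => /eqP; rewrite mulf_eq0 sqrtr_eq0 leNgt (hus i0).1 /=.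
by [].
Qed.

(** [eigen_count] supplies [n] independent eigenfunctions; one more would, by [eigs_negi], give a
    negative space of dimension [n + 1]. *)
Lemma idx_Mor s n k : idx V s n k -> MorIs (dom s) (dset s) nu m phi n.
Proof.
move=> h; split; last by move=> /eigs_negi /(idx_le aV h); rewrite ltnn.
have [lam [us [hus ius]]] := eigen_count aV h.
exists lam, us; split => // i; have [l0 ku] := hus i; split => //.
apply: KK_eigenfun => //; first exact: ltW.
apply: contrapT => hn; suff /(_ i) : forall j, (j == i)%:R = 0 :> R by rewrite eqxx => /eqP; rewrite oner_eq0.
apply: ius => x sx; rewrite (bigD1 i)//= eqxx mul1r big1 => [|j ji].
  by rewrite addr0; apply: contrapT => nz; apply: hn; exists x.
by rewrite (negbTE ji) mul0r.
Qed.

End Strong.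

(** * The index as a function of the endpoint *)

Section Endpoint.
Variable R : realType.
Local Notation mu := (@lebesgue_measure R).
Implicit Types (D I : set R) (f g h : R -> R) (u v w : nat -> R -> R).

Hint Resolve mseg mhl mhr : core.

Let tr (c : R) (x : measurableTypeR R) : measurableTypeR R := x + c.
Let mtr c : measurable_fun [set: measurableTypeR R] (tr c).
Proof. exact: measurable_funD. Qed.

Lemma mtranslate D c : measurable D -> measurable [set x : R | D (x + c)].
Proof. by move=> mD; rewrite -[X in measurable X]setTI; exact: mtr. Qed.

Lemma meas_translate D f c : measurable D -> measurable_fun D f ->
  measurable_fun [set x | D (x + c)] (fun x => f (x + c)).
Proof.
move=> mD mf; apply: (@measurable_comp _ _ _ _ _ _ D f _ (tr c)) => //; first by move=> _ [x /= Dx <-].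
exact: measurable_funS (mtr c).
Qed.

Lemma translate_itg D f c : measurable D -> itg D f ->
  itg [set x | D (x + c)] (fun x => f (x + c)) /\
  integ [set x | D (x + c)] (fun x => f (x + c)) = integ D f.
Proof.
move=> mD fi; have mD' := mtranslate c mD.
have eD : [set x : R | [set y | D (y + c)] (x + - c)] = D.
  by apply/seteqP; split => x /=; rewrite subrK.
have [] := @integ_translate R _ (fun x => f (x + c)) (- c) mD' _ (@meas_translate D f c mD (itg_meas fi)).
  by rewrite eD; apply: eq_itg fi => // x _; rewrite subrK.
rewrite eD => i ->; split => //.
by apply: eq_integ => x _; rewrite subrK.
Qed.

Lemma translate_L2 D f c : measurable D -> L2 D f -> L2 [set x | D (x + c)] (fun x => f (x + c)).
Proof.
by move=> mD [mf f2]; split; [exact: meas_translate|exact: (translate_itg c mD f2).1].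
Qed.

Lemma translate_prim I G g c : prim I G g ->
  prim [set x | I (x + c)] (fun x => G (x + c)) (fun x => g (x + c)).
Proof.
move=> p x y Ix Iy xy; have [|gi e] := p (x + c) (y + c) Ix Iy; first by rewrite lerD2r.
have eD : [set z : R | `[x + c, y + c]%classic (z + c)] = `[x, y]%classic.
  by apply/seteqP; split => z /=; rewrite !in_itv/=; lra.
by have [] := translate_itg c (mseg _ _) gi; rewrite eD e.
Qed.

Definition shift (c : R) u : nat -> R -> R := fun k x => u k (x + c).

Lemma hl_shift (s c : R) : [set x : R | halfline s (x + c)] = halfline (s - c).
Proof. by apply/seteqP; split => x; rewrite /halfline/=; lra. Qed.

Lemma shift_FF (s c : R) u : FF (Some s) u -> FF (Some (s - c)) (shift c u).
Proof.
move=> [[l p] cu]; split.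
  split => k kk /=; rewrite -hl_shift; first exact: (translate_L2 c (mhl s) (l k kk)).
  exact: (@translate_prim _ _ _ c (p k kk)).
by move=> k k2; rewrite /shift subrK cu.
Qed.

Lemma ip_shift_le (s c : R) u : FF (Some s) u ->
  ip (halfline (s - c)) (shift c u) (shift c u) = ip (halfline s) u u.
Proof.
move=> [hu _]; have [_ h] := translate_itg c (mhl s) (ip_itg (mhl s) hu hu).
by rewrite -[RHS]h hl_shift.
Qed.

Definition zext (s : R) u := glue s u (fun=> fun=> 0).

(** The whole line counts as lying beyond every endpoint, so that larger half-lines and the line are
    treated together. *)
Definition inner (s : R) (o : option R) : Prop := if o is Some s' then s < s' else True.

Section ZeroExtension.
Variables (V : R -> R) (M : R).
Hypothesis cV : continuous V.
Hypothesis VM : forall x, `|V x| <= M.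
Variables (s : R) (o : option R).
Hypothesis so : inner s o.

Lemma inner_in : dset o s. Proof. by case: o so => [s'|] //= /ltW. Qed.

Lemma inner_cap : dset o `&` halfline s = halfline s.
Proof. by case: o so => [s'|] /= h; [apply: hl_cap; exact: ltW|rewrite setTI]. Qed.

Lemma zext_FF u : FF (Some s) u -> FF o (zext s u).
Proof.
move=> [hu cu]; split.
  apply: H2on_glue; [exact: mdset|exact: cvx_dset|exact: inner_in|by rewrite inner_cap| | |].
  - by apply: H2on0; apply: measurableI => //; exact: mdset.
  - exact: cu.
  - exact: cu.
by case: o so => // s' /= ss k k2; rewrite /zext glue_gt.
Qed.

Lemma zext_bf u : FF (Some s) u -> bf V (dset o) (zext s u) (zext s u) = bf V (halfline s) u u.
Proof.
move=> hu; have [hz _] := zext_FF hu; move: hu => [hu cu].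
rewrite (bf_glue cV VM (mdset o) (@cvx_dset _ o) inner_in)//; last 2 first.
- by rewrite inner_cap; exact: hu.
- by apply: H2on0; apply: measurableI => //; exact: mdset.
rewrite inner_cap [X in _ + X](_ : _ = 0) ?addr0.
  by apply: eq_bf => // k x _ xs; rewrite /zext glue_le.
rewrite /bf (@eq_integ _ _ _ (fun=> 0)); first by rewrite integ0//; apply: measurableI => //; exact: mdset.
by move=> x _; ring.
Qed.

Lemma comb_zext n (C : 'I_n -> R) (u : 'I_n -> nat -> R -> R) k x :
  comb C (fun i => zext s (u i)) k x = zext s (comb C u) k x.
Proof.
rewrite /comb /zext /glue; case: ifP => // _.
by rewrite big1// => i _; rewrite mulr0.
Qed.

End ZeroExtension.

Variables (V : R -> R).
Hypothesis aV : admissible V.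

(** Extended by zero, the [n + k] nonpositive directions stay nonpositive and cannot meet the new
    kernel, whose elements would be solutions vanishing on a segment beyond [s]. So all of them
    count as negative on the larger domain. *)
Lemma idx_inner (s : R) o n k n' k' : inner s o -> idx V (Some s) n k -> idx V o n' k' ->
  (n + k <= n')%N.
Proof.
move=> so h h'; have [M [K [d0 [cV VM dp Wl Wr]]]] := admissibleP aV.
have [u [hu hC]] := idx_np0 aV h.
apply: (idx_np0_le aV h' (u := fun i => zext s (u i))).
- by move=> i; exact: zext_FF.
- move=> C; rewrite (@eq_bf _ _ _ _ (zext s (comb C u)) _ (zext s (comb C u))).
  + by rewrite (zext_bf cV VM)//; [exact: (hC C).1|exact: FF_comb].
  + by move=> k0 x _ _; exact: comb_zext.
  + by move=> k0 x _ _; exact: comb_zext.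
move=> C t [st _ _] ht.
have [b [sb bo]] : exists b, s < b /\ forall x, x <= b -> dset o x.
  by case: o so {h' ht} => [s'|] ss; [exists s'|exists (s + 1); split => //; lra].
have t0 : forall k x, (k < 5)%N -> t k x = 0.
  have ab : (s + b) / 2 < b by lra.
  have tz x : (s + b) / 2 <= x <= b -> t 0%N x = 0.
    by move=> xb; rewrite -ht; [rewrite comb_zext /zext glue_gt//; lra|apply: bo; lra].
  by move=> k0 x0 k5; exact: (sol_zero_seg cV VM ab st tz).
have C0 x : x <= s -> comb C u 0%N x = 0.
  by move=> xs; have := ht x (bo x _); rewrite comb_zext /zext glue_le// t0//; apply; lra.
move=> i; apply: contrapT => /eqP Ci; have := (hC C).2 (ex_intro _ i Ci).
rewrite (@eq_ip _ _ _ (fun=> fun=> 0) _ (fun=> fun=> 0)) ?/ip.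
- by rewrite (@eq_integ _ _ _ (fun=> 0)) => [|x _]; rewrite ?mulr0// integ0 ?ltxx//; exact: mdset.
- exact: C0.
- exact: C0.
Qed.

(** Moving a family to the endpoint [s - c] changes only the potential, by at most [w], which is
    what the margin loses. *)
Lemma negi_translate (s c w e : R) m : (forall x, `|V (x - c) - V x| <= w) ->
  negi V (Some s) m e -> negi V (Some (s - c)) m (e - w).
Proof.
have [M [K [d0 [cV VM dp Wl Wr]]]] := admissibleP aV.
move=> Vc [u [hu h]]; exists (fun i => shift c (u i)); split; first by move=> i; exact: shift_FF.
move=> C /h; have hc := FF_comb C hu; set U := comb C u in hc *.
have eU k x : comb C (fun i => shift c (u i)) k x = shift c U k x by [].
have -> : comb C (fun i => shift c (u i)) = shift c U by [].
rewrite /= ip_shift_le//.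
have cV' : continuous (fun x => V (x - c)).
  move=> x; apply: (@continuous_comp _ _ _ (fun y : R => y - c) V); last exact: cV.
  by apply: cvgB; [exact: cvg_id|exact: cvg_cst].
have -> : bf V (halfline (s - c)) (shift c U) (shift c U) = bf (fun x => V (x - c)) (halfline s) U U.
  have [_ hh] := translate_itg c (mhl s) (bf_itg cV' (fun x => VM (x - c)) (mhl s) hc.1 hc.1).
  by rewrite -[RHS]hh hl_shift; apply: eq_integ => x _; rewrite addrK.
have : bf (fun x => V (x - c)) (halfline s) U U <= bf (fun x => V x + w) (halfline s) U U.
  have w0 : 0 <= w by apply: le_trans (Vc 0); exact: normr_ge0.
  have [cW [M' [K' [d' [_ WM' _]]]]] := admissibleD w0 aV.
  apply: le_integ => //.
  - exact: (bf_itg cV' (fun x => VM (x - c)) (mhl s) hc.1 hc.1).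
  - exact: (bf_itg cW WM' (mhl s) hc.1 hc.1).
  move=> x _; rewrite lerD2l ler_wpM2r -?expr2 ?sqr_ge0//.
  by have := Vc x; rewrite ler_norml => /andP[]; lra.
rewrite (bf_shift aV (s := Some s))//=.
by lra.
Qed.

Hypothesis uV : forall e : R, 0 < e -> exists2 h : R, 0 < h & forall x c, `|c| < h -> `|V (x - c) - V x| <= e.

(** The negative directions at [s] have a margin [e], and a translation that costs at most [e] keeps
    them negative; [idx_inner] gives the converse inequality. *)
Lemma idx_left s n k : idx V (Some s) n k -> exists2 e, 0 < e &
  forall y n' k', s - e < y -> y < s -> idx V (Some y) n' k' -> n' = n.
Proof.
move=> h; have [e e0 he] := idx_neg aV h; have [a a0 ha] := uV e0.
exists a => // y n' k' sy ys h'; apply/eqP; rewrite eqn_leq.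
have := idx_inner (s := y) (o := Some s) ys h' h => /(leq_trans (leq_addr _ _)) ->/=.
apply: (idx_le aV h'); have -> : y = s - (s - y) by ring.
rewrite -[0](subrr e); apply: negi_translate he => x; apply: ha.
by rewrite ger0_norm; lra.
Qed.

(** Negative directions at [y], translated back to [s], lie below the threshold of [idx_np_le], so
    there are at most [n + k] of them; [idx_inner] gives the converse inequality. *)
Lemma idx_right s n k : idx V (Some s) n k -> exists2 e, 0 < e &
  forall y n' k', s < y -> y < s + e -> idx V (Some y) n' k' -> n' = (n + k)%N.
Proof.
move=> h; have [e e0 he] := idx_np_le aV h; have [a a0 ha] := uV e0.
exists a => // y n' k' sy ys h'; apply/eqP; rewrite eqn_leq.
have -> := idx_inner (s := s) (o := Some y) sy h h'; rewrite andbT; apply: he.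
have [e1 e10 h1] := idx_neg aV h'.
have -> : s = y - (y - s) by ring.
rewrite -[- e]sub0r; apply: negi_translate (negi_weak (ltW e10) h1) => x; apply: ha.
by rewrite ger0_norm; lra.
Qed.

Lemma idx_low : exists K, forall s n k, s <= K -> idx V (Some s) n k -> n = 0%N.
Proof.
have [M [K [d0 [cV VM dp Wl Wr]]]] := admissibleP aV.
exists (- K) => s n k sK /(idx_neg aV)[e e0 [u [hu h]]].
case: n u hu h => [//|n] u hu h; exfalso.
have := h (fun=> 1) (ex_intro _ ord0 (oner_neq0 _)).
have [hc _] := FF_comb (fun=> 1) hu; set U := comb _ u in hc *.
have p0 := ip_ge0 (dset (Some s)) U.
have sub : halfline s `<=` halfline (- K) by move=> x; rewrite /halfline/=; lra.
have := bf_left_ge cV VM Wl (mhl s) sub hc.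
have := mulr_ge0 (ltW e0) p0; have := mulr_ge0 (ltW dp) p0.
by rewrite /=; lra.
Qed.

Lemma conj_list (k : R -> nat) (g : R -> nat) : (forall s, idx V (Some s) (g s) (k s)) ->
  forall L, exists xs : seq R, [/\ uniq xs,
    forall x, (x < L /\ (0 < k x)%N) <-> x \in xs & (\sum_(x <- xs) k x)%N = g L].
Proof.
move=> hg L; apply: (@jump_list R g k L _ _ _ _ L (lexx L)).
- by move=> x y xy _; exact: (idx_inner (s := x) (o := Some y) xy (hg x) (hg y)).
- by move=> x _; have [e e0 h] := idx_left (hg x); exists e => // y ey ye; exact: h (hg y).
- by move=> x _; have [e e0 h] := idx_right (hg x); exists e => // y ey ye _; exact: h (hg y).
- by have [K h] := idx_low; exists K => s sK; exact: h (hg s).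
Qed.

Lemma vanl_fam n (f : 'I_n -> R -> R) : (forall i, vanl (f i)) ->
  forall e, 0 < e -> exists A, forall x, x <= A -> forall i, `|f i x| <= e.
Proof.
move=> h e e0.
have va i : vanl (fun x => `|f i x|).
  by move=> d dp; have [A hA] := h i d dp; exists A => x xA; rewrite normr_id; exact: hA.
have [A hA] := @vanl_sum R 'I_n (index_enum 'I_n) _ va e e0.
exists A => x /hA hx i; apply: le_trans hx; apply: le_trans (ler_norm _).
by rewrite (bigD1 i)//= lerDl sumr_ge0.
Qed.

(** The cubic on [[L, L + 1]] with data [(a, b)] at [L] and [(0, 0)] at [L + 1], and its
    derivatives. *)
Definition hermite (L a b : R) : nat -> R -> R := fun k x =>
  let t := x - L in
  match k with
  | 0 => a * ((1 - t) ^+ 2 * (1 + 2 * t)) + b * (t * (1 - t) ^+ 2)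
  | 1 => a * (6 * t ^+ 2 - 6 * t) + b * (1 - 4 * t + 3 * t ^+ 2)
  | _ => a * (12 * t - 6) + b * (6 * t - 4)
  end.

Lemma hermite_H2 (L a b : R) : H2on `[L, L + 1] (hermite L a b).
Proof.
set J : set R := `[L, L + 1]%classic.
have cJ : cvx J by exact: cvx_seg.
have LL : L <= L + 1 by lra.
have p : prim J (fun t => t - L) (fun=> 1).
  apply: (eq_prim cJ _ _ (primB (prim_id J) (prim_cst J L))) => // t _.
  by rewrite subr0.
have pX2 : prim J (fun t => (t - L) ^+ 2) (fun t => 2 * (t - L)).
  by apply: (eq_prim cJ _ _ (primM cJ p p)) => t _; ring.
have pX3 : prim J (fun t => (t - L) ^+ 3) (fun t => 3 * (t - L) ^+ 2).
  by apply: (eq_prim cJ _ _ (primM cJ pX2 p)) => t _; ring.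
have p1 := prim_cst J (1 : R).
have q0 : prim J (hermite L a b 0) (hermite L a b 1).
  apply: (eq_prim cJ _ _ (primD (primZ a (primD p1 (primD (primZ (-3) pX2) (primZ 2 pX3))))
    (primZ b (primD p (primD (primZ (-2) pX2) pX3))))) => t _; rewrite /hermite; ring.
have q1 : prim J (hermite L a b 1) (hermite L a b 2).
  apply: (eq_prim cJ _ _ (primD (primZ a (primD (primZ 6 pX2) (primZ (-6) p)))
    (primZ b (primD p1 (primD (primZ (-4) p) (primZ 3 pX2)))))) => t _; rewrite /hermite; ring.
have q2 : prim J (hermite L a b 2) (fun=> a * 12 + b * 6).
  apply: (eq_prim cJ _ _ (primD (primZ a (primD (primZ 12 p) (prim_cst J (-6))))
    (primZ b (primD (primZ 6 p) (prim_cst J (-4)))))) => t _; rewrite /hermite; ring.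
have pl G g : prim J G g -> L2 J G.
  move=> pG; have [B hB] := prim_bdd_seg LL pG.
  have := L2_bdd (mseg _ _) (prim_meas_seg LL pG) (fun x xJ => hB x (iffLR (segP _ _ _) xJ))
    (continuous_L2 L (L + 1) (f := fun=> 1) (@cst_continuous _ _ _)).
  by apply: eq_L2 => // x _; rewrite mulr1.
split; first by move=> [|[|[|//]]] _; [exact: pl q0|exact: pl q1|exact: pl q2].
by move=> [|[|//]] _.
Qed.

Lemma hermite_bf (L a b M : R) : continuous V -> (forall x, `|V x| <= M) ->
  bf V `[L, L + 1] (hermite L a b) (hermite L a b) <= (100 + 2 * M) * (a ^+ 2 + b ^+ 2).
Proof.
move=> cV VM; have hh := hermite_H2 L a b.
have -> : (100 + 2 * M) * (a ^+ 2 + b ^+ 2) = integ `[L, L + 1] (fun=> (100 + 2 * M) * (a ^+ 2 + b ^+ 2)).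
  by rewrite integ_cst; [ring|lra].
apply: le_integ => //; first exact: (bf_itg cV VM).
  by apply: continuous_itg; exact: cst_continuous.
move=> x /segP xL; rewrite /hermite; set t := x - L.
have t01 : 0 <= t <= 1 by rewrite /t; lra.
set A0 := (1 - t) ^+ 2 * _; set B0 := t * _; set A2 := 12 * t - 6; set B2 := 6 * t - 4.
have M0 := M_ge0 VM.
have hA0 : 0 <= A0 <= 1.
  have q1 : 0 <= t ^+ 2 * (3 - 2 * t) by rewrite mulr_ge0 ?sqr_ge0//; lra.
  have q2 : 0 <= A0 by rewrite mulr_ge0 ?sqr_ge0//; lra.
  by rewrite q2 /A0; lra.
have hB0 : 0 <= B0 <= 1.
  have q2 : 0 <= B0 by rewrite mulr_ge0 ?sqr_ge0//; lra.
  have q3 : (1 - t) ^+ 2 <= 1 by nra.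
  by rewrite q2 /B0; have := ler_wpM2l (_ : 0 <= t) q3; lra.
(* These bounds explain the constants of the statement: [2 * 7 ^ 2] and [2 * 5 ^ 2] are at most 100,
   and the potential contributes [2 * M]. *)
have hA2 : `|A2 + A0| <= 7 by rewrite ler_norml /A2; lra.
have hB2 : `|B2 + B0| <= 5 by rewrite ler_norml /B2; lra.
have sq (X Y : R) : (a * X + b * Y) ^+ 2 <= 2 * (a ^+ 2 * X ^+ 2 + b ^+ 2 * Y ^+ 2).
  by have := sqr_ge0 (a * X - b * Y); nra.
have e1 : (a * (A2 + A0) + b * (B2 + B0)) ^+ 2 <= 100 * (a ^+ 2 + b ^+ 2).
  have h1 : (A2 + A0) ^+ 2 <= 49 by move: hA2; rewrite ler_norml => /andP[]; nra.
  have h2 : (B2 + B0) ^+ 2 <= 25 by move: hB2; rewrite ler_norml => /andP[]; nra.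
  apply: le_trans (sq _ _) _; have := ler_wpM2l (sqr_ge0 a) h1; have := ler_wpM2l (sqr_ge0 b) h2.
  by have := sqr_ge0 a; have := sqr_ge0 b; lra.
have e2 : (a * A0 + b * B0) ^+ 2 <= 2 * (a ^+ 2 + b ^+ 2).
  have h1 : A0 ^+ 2 <= 1 by nra.
  have h2 : B0 ^+ 2 <= 1 by nra.
  apply: le_trans (sq _ _) _; have := ler_wpM2l (sqr_ge0 a) h1; have := ler_wpM2l (sqr_ge0 b) h2.
  by lra.
have := VM x; rewrite ler_norml => /andP[_ Vx].
have : V x * (a * A0 + b * B0) ^+ 2 <= M * (2 * (a ^+ 2 + b ^+ 2)).
  apply: (@le_trans _ _ (M * (a * A0 + b * B0) ^+ 2)); first by rewrite ler_wpM2r ?sqr_ge0.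
  by rewrite ler_wpM2l.
rewrite (_ : a * A2 + b * B2 + (a * A0 + b * B0) = a * (A2 + A0) + b * (B2 + B0)); last by ring.
by rewrite -!expr2; lra.
Qed.

End Endpoint.

(** * The index on the line and on a long half-line *)

Section Attach.
Variable R : realType.
Local Notation mu := (@lebesgue_measure R).
Implicit Types (D I : set R) (f g h : R -> R) (u v w : nat -> R -> R).

Hint Resolve mseg mhl mhr : core.

Variables (V : R -> R).
Hypothesis aV : admissible V.

Lemma sum_sq_le n (C a : 'I_n -> R) (e : R) : (forall i, `|a i| <= e) ->
  (\sum_i C i * a i) ^+ 2 <= (n%:R * e) ^+ 2 * \sum_i C i ^+ 2.
Proof.
move=> ha; set S := \sum_i C i ^+ 2.
have cS i : C i ^+ 2 <= S.
  by rewrite /S (bigD1 i)//= lerDl sumr_ge0// => j _; exact: sqr_ge0.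
have cc i j : `|C i * C j| <= S.
  have h1 := cS i; have h2 := cS j; rewrite ler_norml.
  have h3 := sqr_ge0 (C i + C j); have h4 := sqr_ge0 (C i - C j).
  by apply/andP; split; nra.
rewrite expr2 mulr_suml.
have -> : (n%:R * e) ^+ 2 * S = \sum_(i < n) \sum_(j < n) S * (e * e).
  rewrite !sumr_const !card_ord -mulrnA -[RHS]mulr_natl natrM.
  by move: S {cS cc} => S; ring.
apply: ler_sum => i _; rewrite mulr_sumr; apply: ler_sum => j _.
apply: le_trans (ler_norm _) _.
rewrite (_ : C i * a i * (C j * a j) = C i * C j * (a i * a j)); last by ring.
by rewrite normrM; apply: ler_pM => //; rewrite normrM; apply: ler_pM.
Qed.

(** Past [K] the form on the right half-line is nonnegative, so cutting it away does not raise the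
    form; the spline costs a multiple of the squared value and slope at the cut, which tend to zero
    and so fall below the margin. *)
Lemma idx_attach n k : idx V None n k -> exists L1, forall L n' k', L1 < L ->
  idx V (Some L) n' k' -> (n <= n')%N.
Proof.
have [M [K [d0 [cV VM dp Wl Wr]]]] := admissibleP aV.
move=> h; have [e e0 [u [hu hC]]] := idx_negq aV h.
have mT := @measurableT _ R.
have hr i : H2on [set x | 0 <= x] (u i) by apply: (H2onS mT) (hu i).1.
have vv j i : (j < 2)%N -> vanl (fun x => u i j (- x)).
  have [w0 w1] := vanr_L2 ((hr i).2 0%N isT) ((hr i).2 1%N isT) ((hr i).1 0%N isT) ((hr i).1 2%N isT).
  by case: j => [|[|//]].
have M0 := M_ge0 VM.
(* The squared value and slope of a combination at the cut are each at most [(n a) ^ 2] times the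
   sum of its squared coefficients; [Q] collects the constants. As [a <= 1], the choice of [a] gives
   [Q a ^ 2 <= Q a < e]. *)
pose Q := 2 * (100 + 2 * M) * (n%:R ^+ 2).
have Q0 : 0 <= Q by rewrite /Q !mulr_ge0// ?ler0n//; lra.
pose a := Num.min 1 (e / (2 * (Q + 1))).
have a0 : 0 < a by rewrite lt_min ltr01 divr_gt0//; lra.
have a1 : a <= 1 by rewrite ge_min lexx.
have aQ : Q * a ^+ 2 < e.
  have h1 : a <= e / (2 * (Q + 1)) by rewrite ge_min lexx orbT.
  have h2 : a * (2 * (Q + 1)) <= e by rewrite -ler_pdivlMr//; lra.
  have h3 : a ^+ 2 <= a by rewrite expr2 -[leRHS]mul1r ler_wpM2r// ltW.
  have := ler_wpM2l Q0 h3; nra.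
have [A0 hA0] := vanl_fam (fun i => vv 0%N i isT) a0.
have [A1 hA1] := vanl_fam (fun i => vv 1%N i isT) a0.
exists (Num.max K (Num.max (- A0) (- A1)) + 1) => L' n' k' LL h'.
pose L := L' - 1; have L'E : L' = L + 1 by rewrite /L subrK.
have LK : K <= L.
  have : K <= Num.max K (Num.max (- A0) (- A1)) by rewrite le_max lexx.
  by rewrite /L; lra.
have LA0 : - L <= A0.
  have : - A0 <= Num.max K (Num.max (- A0) (- A1)) by rewrite !le_max lexx orbT.
  by rewrite /L; lra.
have LA1 : - L <= A1.
  have : - A1 <= Num.max K (Num.max (- A0) (- A1)) by rewrite !le_max lexx !orbT.
  by rewrite /L; lra.
have uL0 i : `|u i 0%N L| <= a by have := hA0 _ LA0 i; rewrite opprK.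
have uL1 i : `|u i 1%N L| <= a by have := hA1 _ LA1 i; rewrite opprK.
have ss : L <= L + 1 by lra.
have cL := hl_cap ss; have cR := hl_hr_cap L (L + 1).
have IL : halfline (L + 1) L by rewrite /halfline/=.
rewrite L'E in h'; apply: (idx_le aV h').
have herm_glue U : H2on setT U -> FF (Some (L + 1)) (glue L U (hermite L (U 0%N L) (U 1%N L))).
  move=> hU; split.
    apply: (H2on_glue (mhl _) (@cvx_hl _ _) IL).
    - by rewrite cL; apply: (H2onS mT) hU.
    - by rewrite cR; exact: hermite_H2.
    - by rewrite /hermite; ring.
    - by rewrite /hermite; ring.
  move=> [|[|//]] _; rewrite glue_gt ?/hermite; [ring|lra|ring|lra].
exists (fun i => glue L (u i) (hermite L (u i 0%N L) (u i 1%N L))); split.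
  by move=> i; apply: herm_glue; case: (hu i).
move=> C C0; rewrite mul0r addr0.
have [hU _] := FF_comb C hu; set U := comb C u in hU.
pose p := hermite L (U 0%N L) (U 1%N L).
have eU k0 x : comb C (fun i => glue L (u i) (hermite L (u i 0%N L) (u i 1%N L))) k0 x = glue L U p k0 x.
  rewrite /comb /glue; case: ifP => // _; rewrite /p /U /comb /hermite !mulr_suml -?big_split.
  by move: k0 => [|[|k0]] /=; apply: eq_bigr => i _; ring.
rewrite (@eq_bf _ _ _ _ (glue L U p) _ (glue L U p)) => [|k0 x _ _|k0 x _ _]; [|exact: eU|exact: eU].
have [hg _] := herm_glue U hU; rewrite -/p in hg.
have hUL : H2on (halfline L) U by apply: (H2onS mT) hU.
have hUR : H2on [set x | L <= x] U by apply: (H2onS mT) hU.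
have hp : H2on `[L, L + 1] p by exact: hermite_H2.
have hgs : H2on `[L, L + 1] (glue L U p) by apply: (H2onS (mhl _)) hg => //; exact: seg_hl.
have -> : bf V (dset (Some (L + 1))) (glue L U p) (glue L U p) = bf V (halfline L) U U + bf V `[L, L + 1] p p.
  rewrite /= (bf_split cV VM L (mhl _) hg hg) cL cR; congr (_ + _).
    by apply: eq_bf => k0 x _ xs; rewrite glue_le.
  apply: (bf_off1 cV VM (s := L)) => // k0 x _ /segP xs xL; rewrite glue_gt// lt_neqAle eq_sym xL; lra.
have b1 : bf V (halfline L) U U <= bf V setT U U.
  rewrite (bf_split cV VM L mT hU hU) !setTI lerDl.
  by apply: le_trans (bf_right_ge cV VM Wr LK hUR); rewrite mulr_ge0 ?ip_ge0// ltW.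
have b2 := hC C; rewrite -/U in b2.
have b3 := hermite_bf L (U 0%N L) (U 1%N L) cV VM; rewrite -/p in b3.
have b4 : U 0%N L ^+ 2 <= (n%:R * a) ^+ 2 * \sum_i C i ^+ 2 by exact: sum_sq_le.
have b5 : U 1%N L ^+ 2 <= (n%:R * a) ^+ 2 * \sum_i C i ^+ 2 by exact: sum_sq_le.
have S0 := sum_sqr_gt0 C0; set S := \sum_i _ in b2 b4 b5 S0.
have b6 : bf V `[L, L + 1] p p <= Q * a ^+ 2 * S.
  apply: le_trans b3 _.
  have -> : Q * a ^+ 2 * S = (100 + 2 * M) * ((n%:R * a) ^+ 2 * S + (n%:R * a) ^+ 2 * S) by rewrite /Q; ring.
  apply: ler_wpM2l; first by lra.
  exact: lerD.
have : Q * a ^+ 2 * S < e * S by rewrite ltr_pM2r.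
by rewrite /= in b2; lra.
Qed.

End Attach.

(** * Conjugate points, invertibility and the potential *)

Section Conjugate.
Variable R : realType.
Implicit Types (D I : set R) (f g h : R -> R) (u v w : nat -> R -> R).

Lemma vanlP f : vanl f <-> (f y @[y --> -oo] --> 0).
Proof.
split => [v|v].
  apply/cvgrPdist_le => e e0; have [A hA] := v e e0.
  near=> y; rewrite sub0r normrN; apply: hA.
  by near: y; apply: nbhs_ninfty_le; exact: num_real.
move=> e e0; move/cvgrPdist_le : v => /(_ e e0) [A [_ hA]].
exists (A - 1) => x xA; have : `|0 - f x| <= e by apply: hA; lra.
by rewrite sub0r normrN.
Unshelve. all: by end_near. Qed.

Variables (nu m : R) (phi : R -> R) (V : R -> R).
Hypothesis VE : forall x, V x = - fnl' nu m (phi x).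
Hypothesis aV : admissible V.

(** The coordinates in which [Bent] is written: the first and the last are value and slope, so lying
    in [lsand] means being clamped. *)
Definition phase u (x : R) (k : nat) : R :=
  match k with
  | 0 => u 0%N x | 1 => u 2%N x | 2 => u 3%N x + 2 * u 1%N x | _ => u 1%N x
  end.

Definition unphase (q : nat -> R -> R) : nat -> R -> R := fun k x =>
  match k with
  | 0 => q 0%N x | 1 => q 3%N x | 2 => q 1%N x | 3 => q 2%N x - 2 * q 3%N x
  | _ => - 2 * q 1%N x - (1 + V x) * q 0%N x
  end.

Lemma Bent_sum (i : 'I_4) (q : nat -> R -> R) (y : R) :
  \sum_(j < 4) Bent nu m phi 0 y i j * q j y =
  match val i with
  | 0 => q 3%N y | 1 => q 2%N y - 2 * q 3%N y | 2 => - (1 + V y) * q 0%N y | _ => q 1%N y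
  end.
Proof.
rewrite !big_ord_recl big_ord0 VE; case: i => [[|[|[|[|//]]]] hi] /=; ring.
Qed.

Lemma fos_sol (q : 'I_4 -> R -> R) : first_order_sol nu m phi 0 q ->
  sol V (unphase (fun k => q (inord k))).
Proof.
move=> hq; have cV := aV.1; pose Q k := q (inord k).
have dQ k (y : R) : (k < 4)%N -> is_derive y 1 (Q k) (match k with
  | 0 => Q 3%N y | 1 => Q 2%N y - 2 * Q 3%N y | 2 => - (1 + V y) * Q 0%N y | _ => Q 1%N y end).
  move=> k4; have [d e] := hq y (inord k); apply: DeriveDef; first exact: d.
  rewrite -derive1E e (eq_bigr (fun j : 'I_4 => Bent nu m phi 0 y (inord k : 'I_4) j * Q j y)).
    by rewrite (Bent_sum _ Q)/= inordK.
  by move=> j _; rewrite /Q inord_val.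
have cQ k : (k < 4)%N -> continuous (Q k).
  by move=> k4 x; apply: differentiable_continuous; apply/derivable1_diffP; have := dQ k x k4; case.
have pr (G g : R -> R) : (forall x : R, is_derive x 1 G (g x)) -> continuous g -> prim setT G g.
  by move=> d c; apply: derive_prim => // a b _ _; exact: continuous_subspaceT.
have c2 (a b : R) (f g : R -> R) : continuous f -> continuous g -> continuous (fun x => a * f x + b * g x).
  by move=> cf cg x; apply: cvgD; apply: cvgM; [exact: cvg_cst|exact: cf|exact: cvg_cst|exact: cg].
split; last by move=> x; rewrite /unphase subr0.
move=> [|[|[|[|//]]]] _; apply: pr.
- by move=> x; exact: (dQ 0%N x isT).
- exact: (cQ 3%N isT).
- by move=> x; exact: (dQ 3%N x isT).
- exact: (cQ 1%N isT).
- by move=> x; exact: (dQ 1%N x isT).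
- move=> x; apply: cvgB; first exact: (cQ 2%N isT).
  by apply: cvgM; [exact: cvg_cst|exact: (cQ 3%N isT)].
- move=> x; have d2 := dQ 2%N x isT; have d3 := dQ 3%N x isT.
  have := is_deriveB d2 (is_deriveZ 2 d3); rewrite /unphase.
  rewrite (_ : (fun y : R => _ - _) = Q 2%N - 2 \*: Q 3%N); last by apply/funext.
  by move=> h; apply: is_derive_eq; rewrite /GRing.scale/= /Q; ring.
- move=> x; apply: cvgB.
    by apply: cvgM; [exact: cvg_cst|exact: (cQ 1%N isT)].
  apply: cvgM; last exact: (cQ 0%N isT).
  by apply: cvgD; [exact: cvg_cst|exact: cV].
Qed.

Lemma sol_fos u : sol V u -> first_order_sol nu m phi 0 (fun (i : 'I_4) x => phase u x i).
Proof.
move=> su y i; have cV := aV.1.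
have cu k : (k < 5)%N -> continuous (u k).
  rewrite ltnS leq_eqVlt => /predU1P[->|]; [exact: (sol_cont4 cV su)|exact: (fsol_cont su)].
have du k (x : R) : (k < 4)%N -> is_derive x 1 (u k) (u k.+1 x).
  by move=> k4; apply: prim_derive; [exact: su.1|exact: cu].
have fin (G : R -> R) (g : R) : is_derive y 1 G g -> g = \sum_(j < 4) Bent nu m phi 0 y i j * phase u y j ->
    derivable G y 1 /\ derive1 G y = \sum_(j < 4) Bent nu m phi 0 y i j * phase u y j.
  by move=> [d e] <-; split => //; rewrite derive1E.
rewrite (Bent_sum i (fun k x => phase u x k)) in fin *.
case: i fin => [[|[|[|[|//]]]] hi] /= fin.
- by apply: fin (du 0%N y isT) _.
- by apply: fin (du 2%N y isT) _; ring.
- have h := is_deriveD (du 3%N y isT) (is_deriveZ 2 (du 1%N y isT)).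
  apply: fin h _; rewrite /GRing.scale/= su.2; ring.
- by apply: fin (du 1%N y isT) _.
Qed.

Lemma conj_KK (s : R) (v : 'I_4 -> R) : conj_set nu m phi s v ->
  exists2 t, KK V (Some s) t & forall i, v i = phase t s i.
Proof.
move=> [[q [hq [lq vq]]] [v0 v3]].
exists (unphase (fun k => q (inord k))); last first.
  move=> i; rewrite vq -[in LHS](inord_val i); case: i => [[|[|[|[|//]]]] hi] /=; by [|ring].
have vl k : vanl (q (inord k)) by apply/vanlP.
split; first exact: fos_sol.
  move=> [|[|[|[|//]]]] _; [exact: vl|exact: vl|exact: vl|].
  exact: (vanlB (vl 2%N) (vanlZ 2 (vl 3%N))).
by move=> [|[|//]] _ /=; rewrite -vq.
Qed.

Lemma KK_conj (s : R) t : KK V (Some s) t -> conj_set nu m phi s (fun i => phase t s i).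
Proof.
move=> [st dt ct]; split; last by rewrite /lsand/= !inordK//= !ct.
exists (fun (i : 'I_4) x => phase t x i); split; first exact: sol_fos.
split => // i; apply/vanlP.
case: i => [[|[|[|[|//]]]] hi] /=; try exact: dt.
by apply: vanlD; [exact: dt|apply: vanlZ; exact: dt].
Qed.

Lemma phase_comb n (c : 'I_n -> R) (t : 'I_n -> nat -> R -> R) x k :
  \sum_i c i * phase (t i) x k = phase (comb c t) x k.
Proof.
case: k => [|[|[|k]]] //=; rewrite /comb mulr_sumr -big_split/=.
by apply: eq_bigr => i _; ring.
Qed.

Lemma phase0 u x : (forall i : 'I_4, phase u x i = 0) <-> (forall k, (k < 4)%N -> u k x = 0).
Proof.
split => h.
  have h0 := h (inord 0); have h1 := h (inord 1); have h2 := h (inord 2); have h3 := h (inord 3).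
  rewrite !inordK//= in h0 h1 h2 h3.
  by move=> [|[|[|[|//]]]] _ //; lra.
by case=> [[|[|[|[|//]]]] hi] /=; rewrite !h//; ring.
Qed.

(** A solution is determined by its data at [s] and also by its restriction to the half-line, so
    independence of vectors in phase space and of functions on [(-oo, s]] amount to the same. *)
Lemma conj_dim (s : R) n k : idx V (Some s) n k -> dimIs (conj_set nu m phi s) k.
Proof.
move=> h; have [M [K [d0 [cV VM dp Wl Wr]]]] := admissibleP aV.
split.
  have [t [kt it]] := idx_ker aV h.
  exists (fun i j => phase (t i) s (val j)); split; first by move=> i; exact: KK_conj.
  move=> c hc; apply: it => x _.
  have ph0 : forall j : 'I_4, phase (comb c t) s j = 0.
    by move=> j; rewrite -phase_comb; exact: (hc j).
  have st : sol V (comb c t) by apply: sol_comb => i; case: (kt i).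
  have z0 := sol0 V.
  have q := iffLR (phase0 _ _) ph0.
  exact: (sol_eq VM (x0 := s) st z0 q x (isT : (0 < 5)%N)).
move=> [v [hv iv]].
have ex i : exists t, KK V (Some s) t /\ forall j, v i j = phase t s j.
  by have [t kt e] := conj_KK (hv i); exists t.
pose t i := sval (cid (ex i)).
have ht i : KK V (Some s) (t i) /\ forall j, v i j = phase (t i) s j by rewrite /t; case: cid.
suff : (k.+1 <= k)%N by rewrite ltnn.
apply: (idx_ker_le aV h (t := t)); first by move=> i; case: (ht i).
move=> c hc; apply: iv => j.
rewrite (eq_bigr (fun i => c i * phase (t i) s j)); last by move=> i _; rewrite (ht i).2.
rewrite phase_comb.
have st : sol V (comb c t) by apply: sol_comb => i; case: (ht i) => -[].
have ss : s - 1 < s by lra.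
have z x : s - 1 <= x <= s -> comb c t 0%N x = 0 by move=> /andP[_ xs]; exact: hc.
have z0 k0 : (k0 < 4)%N -> comb c t k0 s = 0.
  by move=> k4; apply: (sol_zero_seg cV VM ss st z); exact: ltn_trans k4 _.
by apply: (iffRL (phase0 _ _) z0).
Qed.

Lemma conj_pt (s : R) n k : idx V (Some s) n k -> conjugate_point nu m phi s <-> (0 < k)%N.
Proof.
move=> /conj_dim[h h']; split.
  move=> c1; rewrite lt0n; apply/eqP => k0; apply: h'; rewrite k0; exact: c1.
case: k h {h'} => [//|k] [v [hv iv]] _.
exists (fun _ => v ord0); split => // c hc i; rewrite ord1.
have := iv (fun j => if j == ord0 then c ord0 else 0) _ ord0; rewrite eqxx; apply=> j.
rewrite big_ord_recl eqxx big1 ?addr0 => [|l _]; last by rewrite mul0r.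
by have := hc j; rewrite big_ord_recl big_ord0 addr0.
Qed.

End Conjugate.

(** * Invertibility on a half-line *)

Section Invertible.
Variable R : realType.
Local Notation mu := (@lebesgue_measure R).
Implicit Types (D I : set R) (f g h : R -> R) (u v w : nat -> R -> R).

Hint Resolve mseg mhl mhr : core.

Variables (nu m : R) (phi : R -> R) (V : R -> R).
Hypothesis VE : forall x, V x = - fnl' nu m (phi x).
Hypothesis aV : admissible V.

(** Were the determinant zero, [(d, - c)] and [(b, - a)] would solve the homogeneous system, so all
    entries would vanish and [(1, 0)] would contradict injectivity. Cramer's rule then gives the
    solution. *)
Lemma linear_system2 (a b c d y z : R) :
  (forall p q, p * a + q * b = 0 -> p * c + q * d = 0 -> p = 0 /\ q = 0) ->
  exists p q, p * a + q * b = y /\ p * c + q * d = z.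
Proof.
move=> inj; have D0 : a * d - b * c != 0.
  apply/eqP => D0; have [d0 c0] : d = 0 /\ - c = 0 by apply: inj; lra.
  have [b0 a0] : b = 0 /\ - a = 0 by apply: inj; lra.
  by have [||/eqP] := inj 1 0; [lra|lra|rewrite oner_eq0].
by exists ((y * d - z * b) / (a * d - b * c)), ((z * a - y * c) / (a * d - b * c)); split; field.
Qed.

Lemma L2_restrict D g : measurable D -> L2 D g -> L2 setT (g \_ D).
Proof.
move=> mD [mg g2]; split; first exact/(measurable_restrictT _ mD).
rewrite (_ : (fun x => _) = (fun x => g x ^+ 2) \_ D); first by apply/(itg_mkcond _ mD).
by apply/funext => x; rewrite /patch; case: ifP => // _; rewrite expr0n.
Qed.

(** A forced solution of finite energy on the far left, continued to [s], is corrected by the two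
    decaying homogeneous solutions. The 2 by 2 system expressing the clamping is solvable because a
    null vector would be a kernel element. *)
Lemma forced_solution (s : R) n g : idx V (Some s) n 0 -> L2 (halfline s) g ->
  exists u, [/\ H4c (halfline s) u, clamped s u &
    forall x, x <= s -> u 4%N x = - 2 * u 2%N x - (1 + V x) * u 0%N x - g x].
Proof.
have [M [K [d0 [cV VM dp Wl Wr]]]] := admissibleP aV.
move=> hs lg; pose G := g \_ (halfline s).
have lG : L2 setT G by exact: L2_restrict.
pose s0 := Num.min s (- K).
have s0s : s0 <= s by rewrite ge_min lexx.
have s0K : s0 <= - K by rewrite ge_min lexx orbT.
have [w [fw _ _ lw0 lw2]] := halfline_exists cV VM dp Wl 0 0 s0K lG.
have [e1 [se1 de1 e10 e11]] := dec_exists cV VM dp Wl 1 0 s0K.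
have [e2 [se2 de2 e20 e21]] := dec_exists cV VM dp Wl 0 1 s0K.
have dw := L2_dec cV VM lG fw lw0 lw2.
have [p [q [hp hq]]] : exists p q, p * e1 0%N s + q * e2 0%N s = - w 0%N s /\
    p * e1 1%N s + q * e2 1%N s = - w 1%N s.
  apply: linear_system2 => p q h0 h1; pose t := lin2 p q e1 e2.
  have st : sol V t by exact: sol_lin.
  have dt : dec t.
    by move=> k k4; apply: vanlD; apply: vanlZ; [exact: de1|exact: de2].
  have kt : KK V (Some s) t by split => // -[|[|//]] _.
  have t0 x : x <= s -> t 0%N x = 0.
    apply: contraPP => tx xs; suff : (1 <= 0)%N by [].
    apply: (idx_ker_le aV hs (t := fun=> t)) => // c hc i; rewrite ord1.
    have := hc x xs; rewrite big_ord_recl big_ord0 addr0 => /eqP.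
    by rewrite mulf_eq0 => /orP[/eqP//|/eqP].
  have ss : s0 - 1 < s0 by lra.
  have z x : s0 - 1 <= x <= s0 -> t 0%N x = 0 by move=> h; apply: t0; lra.
  have t00 := t0 _ s0s; have t10 : t 1%N s0 = 0 by exact: (sol_zero_seg cV VM ss st z).
  by rewrite /t /lin2 e10 e20 in t00; rewrite /t /lin2 e11 e21 in t10; lra.
pose u := lin2 1 1 w (lin2 p q e1 e2).
have fu : fsol V G u by apply: fsol_add => //; exact: sol_lin.
have cu k : (k < 4)%N -> continuous (u k) by exact: (fsol_cont fu).
have le1 := dec_L2 cV VM dp Wl s0 se1 de1; have le2 := dec_L2 cV VM dp Wl s0 se2 de2.
have lu k : (k < 5)%N -> L2 (halfline s0) (w k) -> L2 (halfline s0) (u k).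
  move=> k5 lw; apply: L2D => //; apply: L2Z => //; apply: L2D => //; apply: L2Z => //; [exact: le1|exact: le2].
have lu0 : L2 (halfline s) (u 0%N) by apply: (L2_hl_extend s (cu 0%N isT) (lu 0%N isT lw0)).
have lu2 : L2 (halfline s) (u 2%N) by apply: (L2_hl_extend s (cu 2%N isT) (lu 2%N isT lw2)).
have lGs : L2 (halfline s) G by exact: (L2S (@measurableT _ R)).
have lu4 := sol_L2_4 cV VM (mhl s) lGs fu lu0 lu2.
have lu1 := L2_interp (fu.1 0%N isT) (fu.1 1%N isT) lu0 lu2.
have lu3 := L2_interp (fu.1 2%N isT) (fu.1 3%N isT) lu2 lu4.
exists u; split.
- split; first by move=> [|[|[|[|[|//]]]]] _.
  by move=> k k4; exact: primS (fu.1 k k4).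
- by move=> [|[|//]] _; rewrite /u /lin2; lra.
- by move=> x xs; rewrite fu.2 /G /patch mem_set.
Qed.

Lemma idx_invertible (s : R) n : idx V (Some s) n 0 -> invertible_half nu m phi s.
Proof.
move=> hs; have [C C0 hC] := idx_inverse_bound aV hs.
have bound g us : L2 (halfline s) g -> dom_half s us ->
    {ae mu, forall x, halfline s x -> Lexpr nu m phi us x = g x} ->
    ip (halfline s) us us <= C * integ (halfline s) (fun x => g x ^+ 2).
  move=> lg /(domP (Some s))[h4 cl] ae; apply: hC => //.
    by apply: dom_FF; apply/domP.
  move=> v hv; apply: (weak_form aV h4 hv lg).
  by apply: aeS ae => x e /e <-; rewrite (LexprE VE).
split.
- move=> us hd ae; have /(domP (Some s))[h4 _] := hd.
  have := bound (fun=> 0) us (L20 (mhl s)) hd ae.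
  rewrite (@eq_integ _ _ _ (fun=> 0)) => [|x _]; last by rewrite expr0n.
  rewrite integ0// mulr0 => h; apply: (ip_eq0 (mhl s) (@fat_hl _ s) (H4_H2 h4)).
  by apply/eqP; rewrite eq_le h ip_ge0.
split.
- move=> g mg g2; have [us [h4 cl e]] := forced_solution hs (conj mg g2).
  exists us; split; first by apply/(domP (Some s)).
  by apply: aeW => x xs; rewrite (LexprE VE) e//; ring.
- exists C => g us mg g2 hd ae; have lg : L2 (halfline s) g by split.
  have := bound g us lg hd ae; have /(domP (Some s))[[l _] _] := hd.
  rewrite -!EFin_integ//; last by case: (l 0%N isT).
Qed.

End Invertible.

(** * Limits and uniform continuity of the potential *)

Section Potential.
Variable R : realType.
Implicit Types (f g h : R -> R).

Definition tends_infty f (l : R) : Prop :=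
  forall e : R, 0 < e -> exists K, forall x, K <= `|x| -> `|f x - l| <= e.

Lemma tends_bounded f l : continuous f -> tends_infty f l -> exists M, forall x, `|f x| <= M.
Proof.
move=> cf lf; have [K hK] := lf 1 ltr01.
pose A := `|K|; have A0 : - A <= A by have := normr_ge0 K; rewrite -/A; lra.
have cn : {within `[- A, A], continuous (fun x => `|f x|)}.
  apply: continuous_subspaceT => x; apply: (@continuous_comp _ _ _ f (@Num.norm _ R)); first exact: cf.
  exact: norm_continuous.
have [c _ hc] := EVT_max A0 cn.
exists (`|f c| + (`|l| + 1)) => x; have [xA|Ax] := leP `|x| A.
  apply: le_trans (hc x _) _; first by rewrite in_itv/= -ler_norml.
  by rewrite lerDl addr_ge0.
have hx : `|f x - l| <= 1.
  by apply: hK; apply: le_trans (ltW Ax); exact: ler_norm.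
have := ler_normD (f x - l) l; rewrite subrK; have := normr_ge0 (f c); lra.
Qed.

(** Otherwise there are points with arbitrarily small displacements and oscillation above [e]; they
    stay bounded, since far out [f] is within [e / 2] of [l], and a cluster point contradicts
    continuity. *)
Lemma tends_unif f l : continuous f -> tends_infty f l ->
  forall e : R, 0 < e -> exists2 h : R, 0 < h & forall x c, `|c| < h -> `|f (x - c) - f x| <= e.
Proof.
move=> cf lf e e0; apply: contrapT => hn.
have ex (n : nat) : exists xc : R * R, `|xc.2| < n.+1%:R^-1 /\ e < `|f (xc.1 - xc.2) - f xc.1|.
  apply: contrapT => hx; apply: hn; exists n.+1%:R^-1; first by rewrite invr_gt0 ltr0n.
  move=> x c xc; rewrite leNgt; apply/negP => fx; apply: hx; by exists (x, c).
pose X n := (sval (cid (ex n))).1; pose C n := (sval (cid (ex n))).2.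
have hX n : `|C n| < n.+1%:R^-1 /\ e < `|f (X n - C n) - f (X n)| by rewrite /X /C; case: cid.
have e2 : 0 < e / 2 by lra.
have [K hK] := lf _ e2.
have C1 n : `|C n| < 1.
  by apply: lt_le_trans (hX n).1 _; rewrite invf_le1 ?ler1n ?ltr0n.
have bX n : `|X n| <= `|K| + 1.
  rewrite leNgt; apply/negP => h; have [_] := hX n.
  have KK := ler_norm K; have c1 := C1 n.
  have h1 : `|f (X n) - l| <= e / 2 by apply: hK; lra.
  have h2 : `|f (X n - C n) - l| <= e / 2.
    by apply: hK; have := lerB_normD (X n) (- C n); rewrite normrN; lra.
  have := ler_normB (f (X n - C n) - l) (f (X n) - l).
  by rewrite opprB addrA subrK; lra.
have [y [z hy]] := bolzano_weierstrass2 bX bX.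
have /cvgrPdist_le/(_ (e / 2) e2) := cf y.
move=> /nbhs_ballP[d /= d0 hd].
have [n0 hn0] := nat_above (2 / d).
have d3 : 0 < d / 3 by lra.
have [j [n0j jy _]] := hy _ n0 d3.
have cj : `|C j| < d / 2.
  apply: lt_le_trans (hX j).1 _; rewrite -[leRHS]invrK lef_pV2 ?posrE ?invr_gt0 ?ltr0n//; last by lra.
  rewrite invf_div; apply: le_trans hn0 _; rewrite ler_nat; exact: leqW.
have h1 : `|f y - f (X j)| <= e / 2.
  by apply: hd; rewrite /ball/= distrC; lra.
have h2 : `|f y - f (X j - C j)| <= e / 2.
  apply: hd; rewrite /ball/= distrC; have := ler_normB (X j - y) (C j).
  by rewrite addrAC; lra.
have [_] := hX j; have := ler_normB (f y - f (X j)) (f y - f (X j - C j)).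
rewrite (_ : f y - f (X j) - (f y - f (X j - C j)) = f (X j - C j) - f (X j)); last by ring.
by lra.
Qed.

Variables (nu m : R) (phi : R -> R).
Hypothesis h1 : H1 nu m phi.

Let V x := - fnl' nu m (phi x).

Lemma potential_cont : continuous V.
Proof.
have [sm _] := h1; have cphi : continuous phi.
  move=> x; apply: differentiable_continuous; apply/derivable1_diffP; exact: (sm 0%N x).
have -> : V = fun x => 3 * (phi x * phi x) - 2 * nu * phi x + m.
  by apply/funext => x; rewrite /V /fnl'; ring.
move=> x; apply: cvgD; last exact: cvg_cst.
apply: cvgB; apply: cvgM; [exact: cvg_cst|apply: cvgM; exact: cphi|exact: cvg_cst|exact: cphi].
Qed.

Lemma potential_tends : tends_infty V m.
Proof.
have [_ [_ [rp lp]]] := h1 => e e0.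
have l1 : vanl phi by apply/vanlP.
pose a := Num.min 1 (e / (2 * `|nu| + 3)).
have q0 : 0 < 2 * `|nu| + 3 by have := normr_ge0 nu; lra.
have a0 : 0 < a by rewrite lt_min ltr01 divr_gt0.
have a1 : a <= 1 by rewrite ge_min lexx.
have a2 : a <= e / (2 * `|nu| + 3) by rewrite ge_min lexx orbT.
have key x : `|phi x| <= a -> `|V x - m| <= e.
  move=> pa; have -> : V x - m = 3 * (phi x * phi x) - 2 * nu * phi x by rewrite /V /fnl'; ring.
  apply: le_trans (ler_normB _ _) _; rewrite !normrM !normr_nat.
  have p0 := normr_ge0 (phi x); have n0 := normr_ge0 nu.
  have e1 : `|phi x| * `|phi x| <= a.
    by rewrite -[a]mulr1; apply: ler_pM => //; exact: le_trans a1.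
  have e3 : `|nu| * `|phi x| <= `|nu| * a by exact: ler_wpM2l.
  have e4 : (2 * `|nu| + 3) * a <= e by rewrite mulrC -ler_pdivlMr.
  by lra.
have [A hA] := l1 a a0.
have [B hB] : exists B, forall x, B <= x -> `|phi x| <= a.
  move/cvgrPdist_le : rp => /(_ a a0) [B [_ hB]]; exists (B + 1) => x Bx.
  have : `|0 - phi x| <= a by apply: hB; lra.
  by rewrite sub0r normrN.
exists (Num.max (- A) B) => x; rewrite ge_max => /andP[xA xB]; apply: key.
have [x0|x0] := leP 0 x.
  by apply: hB; rewrite -(ger0_norm x0).
by apply: hA; move: xA; rewrite ltr0_norm//; lra.
Qed.

Hypothesis h2 : H2 nu m.

Lemma potential_admissible : admissible V.
Proof.
split; first exact: potential_cont.
(* (H2) reads [m > 0], as [f'(0) = - m]; hence [V] has a positive limit at both ends. *)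
have m0 : 0 < m by move: h2; rewrite /H2 /fnl' !mulr0 expr0n mulr0; lra.
have [M hM] := tends_bounded potential_cont potential_tends.
have m2 : 0 < m / 2 by lra.
have [K hK] := potential_tends m2.
exists M, K, (m / 2); split => // x /hK; rewrite ler_norml => /andP[]; lra.
Qed.

End Potential.

Theorem theorem3 (R : realType) (nu m : R) (phi : R -> R) :
  H1 nu m phi -> H2 nu m -> H3 nu m phi ->
  exists (Linf : R) (N : nat),
    MorIs (@dom_full R) setT nu m phi N /\
    conj_count nu m phi setT N /\
    (forall L : R, Linf < L ->
       MorIs (dom_half L) (halfline L) nu m phi N /\
       ~ conjugate_point nu m phi L /\
       invertible_half nu m phi L /\
       conj_count nu m phi [set x | x < L] N).
Proof.
move=> h1 h2 _; pose V x := - fnl' nu m (phi x).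
have VE x : V x = - fnl' nu m (phi x) by [].
have aV : admissible V := potential_admissible h1 h2.
have uV := tends_unif (potential_cont h1) (potential_tends h1).
have [n [k hT]] := idx_exists None aV.
have [g [kf hg]] : exists (g kf : R -> nat), forall s, idx V (Some s) (g s) (kf s).
  have h s : exists nk : nat * nat, idx V (Some s) nk.1 nk.2.
    by have [a [b hab]] := idx_exists (Some s) aV; exists (a, b).
  by exists (fun x => (sval (cid (h x))).1), (fun x => (sval (cid (h x))).2) => x; case: cid.
have [L1 hL1] := idx_attach aV hT.
(* For large [L] the index on the line bounds [g L + kf L] from above and, by cutting off, [g L]
   from below; together they force [kf L = 0]. *)
have const L : L1 < L -> g L = n /\ kf L = 0%N.
  move=> LL; have le := idx_inner (s := L) (o := None) aV I (hg L) hT.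
  have ge := hL1 L _ _ LL (hg L).
  have gn : g L = n.
    by apply/eqP; rewrite eqn_leq ge (leq_trans (leq_addr _ _) le).
  by split => //; move: le; rewrite gn -{2}[n]addn0 leq_add2l leqn0 => /eqP.
have cpt s := conj_pt VE aV (hg s).
have count (J : set R) L : L1 < L -> (forall x, J x /\ conjugate_point nu m phi x <-> x < L /\ (0 < kf x)%N) ->
    conj_count nu m phi J n.
  move=> LL hJ; have [xs [uxs hxs sxs]] := conj_list aV uV hg L.
  exists xs, (map kf xs); split => //; split; first by move=> x; rewrite hJ.
  split; first by rewrite size_map.
  split; last by rewrite sumnE big_map sxs; case: (const L LL).
  by move=> i ixs; rewrite (nth_map 0)//; exact: (conj_dim VE aV (hg _)).
exists L1, n; split; first exact: (idx_Mor aV VE hT).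
split.
  (* No conjugate point lies to the right of [L1], so the count on the line is the count up to any
     larger endpoint. *)
  apply: (count _ (L1 + 1)); first by lra.
  move=> x; split => [[_ /cpt kx]|[_ /cpt]//]; split => //.
  by rewrite ltNge; apply/negP => Lx; have [|_ k0] := const x; [lra|rewrite k0 in kx].
move=> L LL; have [gn k0] := const L LL.
have hL := hg L; rewrite gn k0 in hL.
split; first exact: (idx_Mor aV VE hL).
split; first by move=> /cpt; rewrite k0.
split; first exact: (idx_invertible VE aV hL).
by apply: (count _ L) => // x; split => -[xL /cpt].
Qed.
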